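(* Let $(M,\omega)$ be a symplectic manifold and let $E=E^+\oplus E^-$ be a $\mathbb{Z}_2$-graded smooth superbundle over $M$. For any $f\in\mathbb{C}[z]$ with derivative $f'$ and any two primitive superconnections $\mathbb{A}_0$ and $\mathbb{A}_1$ on $\Omega(M,E)\oplus\Omega(M,E)$, let $\mathbb{A}_t=t\mathbb{A}_1+(1-t)\mathbb{A}_0$. Then $$\mathbf{Str}(f(\mathbb{A}_1^2))-\mathbf{Str}(f(\mathbb{A}_0^2))=\partial\int_0^1\mathbf{Str}\left((\mathbb{A}_1-\mathbb{A}_0)f'(\mathbb{A}_t^2)\right)dt.$$ In other words, the primitive cohomology class of $\mathbf{Str}(f(\mathbb{A}^2))$ is independent of the primitive superconnection $\mathbb{A}$.
   Context: Forms. $\Omega(M)$ is the space of smooth differential forms on $M$; $\Omega(M,E)$ and $\Omega(M,\mathrm{End}(E))$ are the spaces of smooth forms with values in $E$ and $\mathrm{End}(E)$. Here $\mathrm{End}^+(E)=\mathrm{Hom}(E^+,E^+)\oplus\mathrm{Hom}(E^-,E^-)$ and $\mathrm{End}^-(E)=\mathrm{Hom}(E^+,E^-)\oplus\mathrm{Hom}(E^-,E^+)$. The total degree of $\alpha\otimes v$ is $|\alpha|+|v|$, the form degree plus the $\mathbb{Z}_2$-degree of $v$; $\Omega^+$ (resp. $\Omega^-$) denotes the subspace of even (resp. odd) total degree. If $E$ is a real bundle, expressions involving complex coefficients are understood after complexification. Signs. For forms $\alpha,\beta$ and homogeneous sections $L,K$ of $\mathrm{End}(E)$ and $v$ of $E$: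 $(\alpha\otimes L)(\beta\otimes v)=(-1)^{|L||\beta|}(\alpha\wedge\beta)\otimes L(v)$ and $(\beta\otimes K)(\alpha\otimes L)=(-1)^{|K||\alpha|}(\beta\wedge\alpha)\otimes(KL)$. Boundary map and primitive cohomology. $\partial:\Omega(M)\oplus\Omega(M)\to\Omega(M)\oplus\Omega(M)$, $\partial(\alpha,\beta)=(d\alpha+\omega\wedge\beta,-d\beta)$. It satisfies $\partial^2=0$ and restricts to $\Omega^i(M)\oplus\Omega^{i-1}(M)\to\Omega^{i+1}(M)\oplus\Omega^i(M)$ for $0\le i\le\dim M+1$; the cohomology of this complex is the primitive cohomology of $(M,\omega)$. Superconnections. A superconnection on $E$ is a first-order differential operator $A$ on $\Omega(M,E)$ mapping $\Omega^\pm(M,E)$ to $\Omega^\mp(M,E)$ with $A(\alpha\wedge\eta)=d\alpha\wedge\eta+(-1)^{|\alpha|}\alpha\wedge A\eta$ for $\alpha\in\Omega(M)$, $\eta\in\Omega(M,E)$. A primitive superconnection is a linear map $\mathbb{A}:\Omega(M,E)\oplus\Omega(M,E)\to\Omega(M,E)\oplus\Omega(M,E)$ of the form $\mathbb{A}(\alpha,\beta)=(A\alpha+\omega\wedge\beta,\ B\alpha-A\beta)$ with $A$ a superconnection on $E$ and $B\in\Omega^+(M,\mathrm{End}(E))$. Powers and products of such maps are compositions. Identification. Write a differential operator $D$ on $\Omega(M,E)=\Omega^+(M,E)\oplus\Omega^-(M,E)$ as a block matrix $D=\begin{bmatrix} D_1 & D_2 \\ D_3 & D_4 \end{bmatrix}$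 and $\alpha=\alpha^++\alpha^-$. If $D(\beta\wedge\alpha)=\beta\wedge D_1\alpha^++(-1)^{|\beta|}\beta\wedge D_2\alpha^-+(-1)^{|\beta|}\beta\wedge D_3\alpha^++\beta\wedge D_4\alpha^-$ for all $\beta\in\Omega(M)$, $\alpha\in\Omega(M,E)$, then $D$ is identified with the unique element of $\Omega(M,\mathrm{End}(E))$ whose action is $D$. If $D,\tilde D$ both satisfy this and $\mathbb{D}(\alpha,\beta)=(D\alpha,\ \tilde D\alpha+D_1\beta^+-D_2\beta^--D_3\beta^++D_4\beta^-)$, then $\mathbb{D}$ is identified with the pair $(D,\tilde D)\in\Omega(M,\mathrm{End}(E))\oplus\Omega(M,\mathrm{End}(E))$. Explicitly, let $\mathbb{A}_t$ be given by $A_t,B_t$ and set $F_t=A_t^2+\omega\wedge B_t$. For integers $k\ge1$ the map $\mathbb{A}_t^{2k}$ is identified with $\left(F_t^k,\ \sum_{i=0}^{k-1}F_t^i(B_tA_t-A_tB_t)F_t^{k-1-i}\right)$. For integers $k\ge0$ the map $(\mathbb{A}_1-\mathbb{A}_0)\mathbb{A}_t^{2k}$ is identified with $\left((A_1-A_0)F_t^k,\ (B_1-B_0)F_t^k-(A_1-A_0)\sum_{i=0}^{k-1}F_t^i(B_tA_t-A_tB_t)F_t^{k-1-i}\right)$ (empty sums are $0$; $\mathbb{A}_t^0$ is the identity, identified with $(1,0)$). These are extended linearly to $f(\mathbb{A}_t^2)$ and $(\mathbb{A}_1-\mathbb{A}_0)f'(\mathbb{A}_t^2)$ for polynomials $f$.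 Supertrace. $\mathrm{Str}:\Omega(M,\mathrm{End}(E))\to\Omega(M)$ is $\mathrm{Str}(\alpha\otimes L)=\alpha\,\mathrm{str}(L)$, where $\mathrm{str}(L)=\mathrm{tr}(L|_{E^+})-\mathrm{tr}(L|_{E^-})$ for $L$ even and $\mathrm{str}(L)=0$ for $L$ odd. For pairs, $\mathbf{Str}(\gamma,\delta)=(\mathrm{Str}(\gamma),\mathrm{Str}(\delta))$. The integral over $t$ is taken componentwise. *)

(* Defs.v *)
From HB Require Import structures.
From mathcomp Require Import all_boot all_order all_algebra.
From mathcomp Require Import complex.
From mathcomp Require Import all_classical all_reals all_analysis.

Set Implicit Arguments.
Unset Strict Implicit.
Unset Printing Implicit Defensive.

Import Order.TTheory GRing.Theory Num.Theory.
Import numFieldNormedType.Exports.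

Local Open Scope classical_set_scope.
Local Open Scope ring_scope.
Local Open Scope complex_scope.

(* Bundles may be real or complex, so the ground field K is [scal R c]:
   R[i] if [c] is true and R otherwise.  [reK], [imK], [mkK] give uniform access
   to real and imaginary parts ([imK] is 0 over the reals). *)
Definition scal (R : realType) (c : bool) : fieldType :=
  if c then (R[i] : fieldType) else (R : fieldType).

Definition reK (R : realType) (c : bool) : scal R c -> R :=
  match c with true => fun z : R[i] => complex.Re z | false => fun z : R => z end.

Definition imK (R : realType) (c : bool) : scal R c -> R :=
  match c with true => fun z : R[i] => complex.Im z | false => fun _ : R => 0 end.

Definition mkK (R : realType) (c : bool) : R -> R -> scal R c :=
  match c with true => fun a b => a +i* b | false => fun a _ => a end.

Definition ofR (R : realType) (c : bool) (a : R) : scal R c := mkK c a 0.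

Definition toC (R : realType) (c : bool) (z : scal R c) : R[i] :=
  reK z +i* imK z.

Fixpoint Cn (R : realType) (n k : nat) (U : set 'rV[R]_n) (g : 'rV[R]_n -> R) :
    Prop :=
  match k with
  | 0 => forall p, U p -> {for p, continuous g}
  | k'.+1 => (forall p, U p -> differentiable g p) /\
             (forall j : 'I_n, Cn k' U ('D_(delta_mx 0 j) g))
  end.

Definition Coo (R : realType) (n : nat) (U : set 'rV[R]_n)
  (g : 'rV[R]_n -> R) : Prop := forall k, Cn k U g.

Definition CooK (R : realType) (c : bool) (n : nat) (U : set 'rV[R]_n)
    (g : 'rV[R]_n -> scal R c) : Prop :=
  Coo U (fun p => reK (g p)) /\ Coo U (fun p => imK (g p)).

Definition partialK (R : realType) (c : bool) (n : nat) (j : 'I_n)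
    (g : 'rV[R]_n -> scal R c) (p : 'rV[R]_n) : scal R c :=
  mkK c ('D_(delta_mx 0 j) (fun q => reK (g q)) p)
        ('D_(delta_mx 0 j) (fun q => imK (g q)) p).

(* A second countable Hausdorff space with a smooth n-dimensional atlas.  [crd i]
   is a chart with domain [dom i] and inverse [icrd i]; [chart_at x] is some chart
   around x, used below to write down elements of the fibre at x of the exterior
   bundle; nothing depends on which one is chosen. *)
Record manifold (R : realType) (n : nat) := Manifold {
  mpoint :> topologicalType ;
  mhausdorff : hausdorff_space mpoint ;
  mcountable : @second_countable mpoint ;
  chart : Type ;
  dom : chart -> set mpoint ;
  crd : chart -> mpoint -> 'rV[R]_n ;
  icrd : chart -> 'rV[R]_n -> mpoint ;
  chart_at : mpoint -> chart ;
  dom_open : forall i, open (dom i) ;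
  chart_atP : forall x, dom (chart_at x) x ;
  crdK : forall i x, dom i x -> icrd i (crd i x) = x ;
  crd_open : forall i, open (crd i @` dom i) ;
  crd_continuous : forall i x, dom i x -> {for x, continuous (crd i)} ;
  icrd_continuous : forall i p, (crd i @` dom i) p ->
    {for p, continuous (icrd i)} ;
  crd_smooth : forall i j (a : 'I_n),
    Coo (crd i @` (dom i `&` dom j)) (fun p => crd j (icrd i p) 0 a)
}.

(* f is smooth on V, read in the chart i; V is open and contained in [dom i] in all
   uses. *)
Definition smooth_in (R : realType) (c : bool) (n : nat) (M : manifold R n)
    (i : chart M) (V : set M) (f : M -> scal R c) : Prop :=
  CooK (crd i @` V) (fun p => f (icrd i p)).

Definition smooth_fun (R : realType) (c : bool) (n : nat) (M : manifold R n)
    (f : M -> scal R c) : Prop :=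
  forall i : chart M, smooth_in i (dom i) f.

(* [ext n V] is Lambda(K^n) (x) V: the element a stands for
   sum_I e_I (x) a I, with e_I = e_i1 /\ ... /\ e_ik for I = {i1 < ... < ik}. *)
Notation ext n V := {ffun {set 'I_n} -> V}.

(* e_I /\ e_J = (-1)^(inversions I J) e_(I u J) for disjoint I, J *)
Definition inversions (n : nat) (I J : {set 'I_n}) : nat :=
  #|[pred p : 'I_n * 'I_n | [&& p.1 \in I, p.2 \in J & (p.2 < p.1)%N]]|.

Definition wedge (n : nat) (K : fieldType) (V : lmodType K)
    (a : ext n K^o) (b : ext n V) : ext n V :=
  [ffun S : {set 'I_n} => \sum_(I : {set 'I_n} | I \subset S)
     ((-1) ^+ inversions I (S :\: I) * a I : K) *: b (S :\: I)].

(* sum_j (v j) e_j *)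
Definition covec (n : nat) (K : fieldType) (v : 'I_n -> K) : ext n K^o :=
  [ffun S : {set 'I_n} => \sum_(j | S == [set j]%SET) v j].

(* e_{i1} /\ ... /\ e_{ik}, after the substitution e_i := sum_j (J i j) e_j *)
Definition subst_basis (n : nat) (K : fieldType) (J : 'I_n -> 'I_n -> K)
    (I : {set 'I_n}) : ext n K^o :=
  foldr (fun i w => wedge (covec (J i)) w) [ffun S => (S == finset.set0)%:R]
    (enum I).

Definition ext_subst (n : nat) (K : fieldType) (V : lmodType K)
    (J : 'I_n -> 'I_n -> K) (a : ext n V) : ext n V :=
  [ffun S => \sum_(I : {set 'I_n}) (subst_basis J I S : K) *: a I].

(* Jacobian matrix at y of the change of coordinates from the chart i to the chart
   j: [jac i j y a b] is the b-th partial derivative of the a-th coordinate of j. *)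
Definition jac (R : realType) (n : nat) (M : manifold R n) (i j : chart M)
    (y : M) (a b : 'I_n) : R :=
  'D_(delta_mx 0 b) (fun p => crd j (icrd i p) 0 a) (crd i y).

(* An inhomogeneous K-valued form is a family of elements of Lambda(T*_x M) (x) K,
   the one at x being written in the basis dx^I of the chart [chart_at x]. *)
Definition dform (R : realType) (c : bool) (n : nat) (M : manifold R n) : Type :=
  M -> ext n (scal R c)^o.

(* The components in the basis dx^I of the chart i of an element a of
   Lambda(T*_y M) (x) V. *)
Definition comps (R : realType) (c : bool) (n : nat) (M : manifold R n)
    (V : lmodType (scal R c)) (i : chart M) (y : M) (a : ext n V) : ext n V :=
  ext_subst (fun k l => ofR c (jac i (chart_at y) y k l)) a.

Definition smooth_form (R : realType) (c : bool) (n : nat) (M : manifold R n)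
    (a : dform c M) : Prop :=
  forall (i : chart M) (S : {set 'I_n}),
    smooth_in i (dom i) (fun y => comps i y (a y) S : scal R c).

Definition homogeneous (R : realType) (c : bool) (n : nat) (M : manifold R n)
    (k : nat) (a : dform c M) : Prop :=
  forall x (S : {set 'I_n}), #|S| != k -> a x S = 0.

(* d (sum_I a_I dx^I) = sum_j sum_I (d a_I / d x^j) dx^j /\ dx^I *)
Definition extd (R : realType) (c : bool) (n : nat) (M : manifold R n)
    (a : dform c M) : dform c M := fun x =>
  let i := chart_at x in
  \sum_(j < n) wedge (covec (fun l => (l == j)%:R))
    [ffun S : {set 'I_n} =>
       partialK j (fun p => comps i (icrd i p) (a (icrd i p)) S : scal R c)
         (crd i x) : (scal R c)^o].

Definition fwedge (R : realType) (c : bool) (n : nat) (M : manifold R n)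
  (a b : dform c M) : dform c M := fun x => wedge (a x) (b x).

Definition real_form (R : realType) (c : bool) (n : nat) (M : manifold R n)
    (w : dform false M) : dform c M :=
  fun x => [ffun S => ofR c (w x S : R)].

Definition cplx_form (R : realType) (c : bool) (n : nat) (M : manifold R n)
    (a : dform c M) : dform true M :=
  fun x => [ffun S => toC (a x S : scal R c)].

(* w_x(u, v) in the coordinates of [chart_at x], for a 2-form w *)
Definition eval2 (R : realType) (n : nat) (M : manifold R n)
    (w : dform false M) (x : M) (u v : 'rV[R]_n) : R :=
  \sum_(a < n) \sum_(b < n | (a < b)%N)
    (w x [set a; b]%SET : R) * (u 0 a * v 0 b - u 0 b * v 0 a).

Definition symplectic (R : realType) (n : nat) (M : manifold R n)
    (w : dform false M) : Prop :=
  [/\ smooth_form w, homogeneous 2 w, extd w = (fun=> 0) &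
      forall x (u : 'rV[R]_n), (forall v, eval2 w x u v = 0) -> u = 0].

(* [c = true]: the supertraces of f (A^2) have complex coefficients. *)
Definition bdry (R : realType) (n : nat) (M : manifold R n)
    (w : dform false M) (u : dform true M * dform true M) :
    dform true M * dform true M :=
  (fun x => extd u.1 x + fwedge (real_form true w) u.2 x,
   fun x => - extd u.2 x).

Definition smooth_pair (R : realType) (n : nat) (M : manifold R n)
    (u : dform true M * dform true M) : Prop :=
  smooth_form u.1 /\ smooth_form u.2.

Definition pair_sub (R : realType) (n : nat) (M : manifold R n)
    (u v : dform true M * dform true M) : dform true M * dform true M :=
  (fun x => u.1 x - v.1 x, fun x => u.2 x - v.2 x).

Definition cocycle (R : realType) (n : nat) (M : manifold R n)
    (w : dform false M) (u : dform true M * dform true M) : Prop :=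
  smooth_pair u /\ bdry w u = (fun=> 0, fun=> 0).

(* u and v are cocycles with the same primitive cohomology class *)
Definition same_class (R : realType) (n : nat) (M : manifold R n)
    (w : dform false M) (u v : dform true M * dform true M) : Prop :=
  [/\ cocycle w u, cocycle w v &
      exists2 z, smooth_pair z & pair_sub u v = bdry w z].

(* E^+ = fib false and E^- = fib true, given by fibres and by local frames over a
   family of open sets covering M, with smooth transition functions; the ranks are
   only locally constant. *)
Record superbundle (R : realType) (c : bool) (n : nat) (M : manifold R n) :=
    Superbundle {
  fib : bool -> M -> vectType (scal R c) ;
  triv : Type ;
  tdom : triv -> set M ;
  rk : triv -> bool -> nat ;
  frame : forall (t : triv) (b : bool) (x : M), (rk t b).-tuple (fib b x) ;
  tdom_open : forall t, open (tdom t) ;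
  tdom_cover : forall x, exists t, tdom t x ;
  frame_basis : forall t b x, tdom t x -> basis_of fullv (frame t b x) ;
  frame_smooth : forall t t' b (k : 'I_(rk t b)) (l : 'I_(rk t' b)) (i : chart M),
    smooth_in i (dom i `&` (tdom t `&` tdom t'))
      (fun y => coord (frame t b y) k (tnth (frame t' b y) l))
}.

Definition fiber (R : realType) (c : bool) (n : nat) (M : manifold R n)
    (E : superbundle c M) (x : M) : vectType (scal R c) :=
  (fib E false x * fib E true x)%type.

Definition part (R : realType) (c : bool) (n : nat) (M : manifold R n)
    (E : superbundle c M) (b : bool) (x : M) : fiber E x -> fib E b x :=
  match b with true => fun v => v.2 | false => fun v => v.1 end.

Definition inj (R : realType) (c : bool) (n : nat) (M : manifold R n)
    (E : superbundle c M) (b : bool) (x : M) : fib E b x -> fiber E x :=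
  match b with true => fun v => (0, v) | false => fun v => (v, 0) end.

Definition vform (R : realType) (c : bool) (n : nat) (M : manifold R n)
    (E : superbundle c M) : Type := forall x : M, ext n (fiber E x).

Definition eform (R : realType) (c : bool) (n : nat) (M : manifold R n)
    (E : superbundle c M) : Type := forall x : M, ext n 'End(fiber E x).

Section BundleForms.
Variables (R : realType) (c : bool) (n : nat) (M : manifold R n).
Variable E : superbundle c M.

Definition smooth_vform (a : vform E) : Prop :=
  forall (i : chart M) (t : triv E) (S : {set 'I_n}) b (k : 'I_(rk t b)),
    smooth_in i (dom i `&` tdom t)
      (fun y => coord (frame t b y) k (part b (comps i y (a y) S))).

Definition smooth_eform (L : eform E) : Prop :=
  forall (i : chart M) (t : triv E) (S : {set 'I_n}) b b'
      (k : 'I_(rk t b)) (l : 'I_(rk t b')),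
    smooth_in i (dom i `&` tdom t)
      (fun y => coord (frame t b y) k
        (part b ((comps i y (L y) S : 'End(fiber E y))
          (inj (tnth (frame t b' y) l))))).

Definition grading (x : M) (v : fiber E x) : fiber E x := (v.1, - v.2).

(* The action of Omega(M, End E) on Omega(M, E): for L homogeneous,
   (e_I (x) L)(e_J (x) v) = (-1)^(|L||J|) (e_I /\ e_J) (x) L v, and
   (-1)^(|L|) L is the conjugate of L by the grading involution. *)
Definition act (L : eform E) (a : vform E) : vform E := fun x =>
  [ffun S : {set 'I_n} => \sum_(I : {set 'I_n} | I \subset S)
    let J := S :\: I in
    (-1) ^+ inversions I J *:
      (if odd #|J| then grading ((L x I : 'End(fiber E x)) (grading (a x J)))
       else (L x I : 'End(fiber E x)) (a x J))].

(* total degree |S| + |v| congruent to b mod 2 *)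
Definition vparity (b : bool) (a : vform E) : Prop :=
  forall x (S : {set 'I_n}) b', odd #|S| (+) b' != b -> part b' (a x S) = 0.

Definition eparity (b : bool) (L : eform E) : Prop :=
  forall x (S : {set 'I_n}) b1 b2 (v : fib E b1 x),
    odd #|S| (+) (b1 (+) b2) != b ->
    part b2 ((L x S : 'End(fiber E x)) (inj v)) = 0.

Definition vadd (a b : vform E) : vform E := fun x => a x + b x.
Definition vscale (k : scal R c) (a : vform E) : vform E := fun x => k *: a x.
Definition vmul (f : M -> scal R c) (a : vform E) : vform E :=
  fun x => f x *: a x.
Definition vsub (a b : vform E) : vform E := fun x => a x - b x.
Definition vwedge (a : dform c M) (b : vform E) : vform E :=
  fun x => wedge (a x) (b x).

(* [vform E] also contains families which are not smooth; an operator on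
   Omega(M, E) is a map on [vform E] preserving smoothness, of which only the
   restriction to smooth forms is considered. *)
Definition linear_op (A : vform E -> vform E) : Prop :=
  [/\ forall a, smooth_vform a -> smooth_vform (A a),
      forall a b, smooth_vform a -> smooth_vform b ->
        A (vadd a b) = vadd (A a) (A b) &
      forall k a, smooth_vform a -> A (vscale k a) = vscale k (A a)].

(* linear, and [[A, f], g] = 0 for all smooth functions f and g *)
Definition first_order_op (A : vform E -> vform E) : Prop :=
  linear_op A /\
  forall f g a, smooth_fun f -> smooth_fun g -> smooth_vform a ->
    vsub (vsub (A (vmul f (vmul g a))) (vmul f (A (vmul g a))))
         (vsub (vmul g (A (vmul f a))) (vmul g (vmul f (A a)))) = (fun=> 0).

Definition superconnection (A : vform E -> vform E) : Prop :=
  [/\ first_order_op A,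
      forall b a, smooth_vform a -> vparity b a -> vparity (~~ b) (A a) &
      forall k (a : dform c M) (v : vform E),
        smooth_form a -> homogeneous k a -> smooth_vform v ->
        A (vwedge a v) =
          vadd (vwedge (extd a) v) (vscale ((-1) ^+ k) (vwedge a (A v)))].

Record psuperconn := PSuperconn {
  conn : vform E -> vform E ;
  pot : eform E ;
  connP : superconnection conn ;
  pot_smooth : smooth_eform pot ;
  pot_even : eparity false pot
}.

Definition pop := vform E * vform E -> vform E * vform E.

Definition psc_op (w : dform false M) (A : psuperconn) : pop := fun u =>
  (vadd (conn A u.1) (vwedge (real_form c w) u.2),
   vsub (act (pot A) u.1) (conn A u.2)).

Definition pop_sub (P Q : pop) : pop := fun u =>
  (vsub (P u).1 (Q u).1, vsub (P u).2 (Q u).2).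

Definition pop_path (P Q : pop) (t : R) : pop := fun u =>
  (vadd (vscale (ofR c t) (P u).1) (vscale (ofR c (1 - t)) (Q u).1),
   vadd (vscale (ofR c t) (P u).2) (vscale (ofR c (1 - t)) (Q u).2)).

(* 1 on Omega^+(M, E) and -1 on Omega^-(M, E) *)
Definition vsign (a : vform E) : vform E :=
  fun x => [ffun S : {set 'I_n} => (-1) ^+ #|S| *: grading (a x S)].

(* P (a, b) = (D a, D~ a + D_1 b^+ - D_2 b^- - D_3 b^+ + D_4 b^-), where D and D~
   are the actions of L.1 and L.2; the last four terms are the conjugate of D by
   [vsign], applied to b.  The condition on D (b /\ a) is part of being given by
   the action of an End(E)-valued form. *)
Definition identified (P : pop) (L : eform E * eform E) : Prop :=
  [/\ smooth_eform L.1, smooth_eform L.2 &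
      forall a b, smooth_vform a -> smooth_vform b ->
        P (a, b) = (act L.1 a, vadd (act L.2 a) (vsign (act L.1 (vsign b))))].

(* the unique pair identified with P; (0, 0) if there is none *)
Definition ident (P : pop) : eform E * eform E :=
  xget (fun=> 0, fun=> 0) [set L | identified P L].

Definition partial_trace (b : bool) (x : M) (L : 'End(fiber E x)) : scal R c :=
  \sum_i coord (vbasis {:fib E b x}) i
            (part b (L (inj (tnth (vbasis {:fib E b x}) i)))).

(* tr (L|E^+) - tr (L|E^-) on the even part of L, 0 on its odd part *)
Definition str (x : M) (L : 'End(fiber E x)) : scal R c :=
  partial_trace false L - partial_trace true L.

Definition Str (L : eform E) : dform c M :=
  fun x => [ffun S : {set 'I_n} => str (L x S : 'End(fiber E x))].

(* Str (f (P^2)) for [B] the identity, and Str (B f (P^2)) in general.  As E may be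
   real and f is complex, this is sum_k f_k Str (B P^(2 k)), the C-linear
   extension of Str being used. *)
Definition Str_poly (f : {poly R[i]}) (B P : pop) : dform true M * dform true M :=
  let L k := ident (fun u => B (iter k (P \o P) u)) in
  (fun x => \sum_(k < size f) f`_k *: cplx_form (Str (L k).1) x,
   fun x => \sum_(k < size f) f`_k *: cplx_form (Str (L k).2) x).

End BundleForms.

Definition cintegral (R : realType) (g : R -> R[i]) : R[i] :=
  (\int[lebesgue_measure]_(t in `[0%R, 1%R]) complex.Re (g t)) +i*
  (\int[lebesgue_measure]_(t in `[0%R, 1%R]) complex.Im (g t)).

Definition form_integral (R : realType) (n : nat) (M : manifold R n)
    (a : R -> dform true M) : dform true M :=
  fun x => [ffun S : {set 'I_n} => cintegral (fun t => a t x S)].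

Definition pair_integral (R : realType) (n : nat) (M : manifold R n)
    (u : R -> dform true M * dform true M) : dform true M * dform true M :=
  (form_integral (fun t => (u t).1), form_integral (fun t => (u t).2)).

(* Main.v *)
From HB Require Import structures.
From mathcomp Require Import all_boot all_order all_algebra.
From mathcomp Require Import complex.
From mathcomp Require Import all_classical all_reals all_analysis.
From mathcomp Require Import ring lra zify.
Require Import Defs.

(** The argument is the Chern-Weil transgression for the superconnection
    A_t = t A_1 + (1 - t) A_0 and its potential B_t. Put F = A_t^2 + omega B_t and
    C = [B_t, A_t]. The square of the primitive superconnection is the triangular
    matrix with diagonal entries F and lower left entry C, so its k-th power has the
    entries F^k and N_k C, where N_k X is the sum of the products F^i X F^j with
    i + j + 1 = k.

    Let a = A_1 - A_0 and b = B_1 - B_0. All computations take place in the ring of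
    smooth forms with values in End(E), with the derivation dl = [A_t, -] whose
    square is the commutator with A_t^2. In this ring omega is central and closed,
    so dl F = - omega C and dl (N_k C) = [B_t, F^k]. The derivatives in t are
    F' = dl a + omega b and C' = - dl b - [a, B_t]. The supertrace vanishes on
    supercommutators and satisfies Str (dl L) = d Str L. Hence, up to the factor
    m + 1 due to cyclicity, the derivatives of Str (F^(m+1)) and Str (N_(m+1) C) are
    Str (dl (a F^m) + omega (b F^m - a N_m C)) and - Str (dl (b F^m - a N_m C)), that
    is, the two components of the boundary of the supertrace of (a F^m,
    b F^m - a N_m C). This pair is the one identified with the product of the
    difference of the two primitive superconnections and the m-th power of the
    square. These identities are [tau_transgression1] and [tau_transgression2].
    Integrating over t, which is harmless as everything is polynomial in t, and
    summing over the coefficients of f gives the theorem. The closedness of both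
    supertraces is [tau_dl_curvX] and [tau_dl_power_deriv].

    Two facts connect the ring to the definitions. First, an operator on forms with
    values in E that is linear over forms, with the sign rule, is the action of a
    unique smooth form with values in End(E) ([tensorial_act], [act_inj]); this
    applies to A^2, to the difference of two superconnections and to [A, L]. The case
    of A^2 is [sc2_wedge] and rests on ddf = 0, hence on the symmetry of second
    derivatives. Second, Str [A, L] = d Str L ([Str_supercomm_extd]), which is seen
    in a local frame. Both are local statements about operators on global sections,
    and bump functions ([bump_exists]) provide the passage between the two. *)

Set Implicit Arguments.
Unset Strict Implicit.
Unset Printing Implicit Defensive.

Import Order.TTheory GRing.Theory Num.Theory.
Import numFieldNormedType.Exports.

Local Open Scope ring_scope.
Local Open Scope complex_scope.


(** * Exterior algebra *)

Section Inversions.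
Variable n : nat.
Implicit Types A B C I J S : {set 'I_n}.

Lemma inversionsE A B :
  inversions A B = (\sum_(i in A) \sum_(j in B) (j < i)%N)%N.
Proof.
rewrite /inversions -sum1_card (pair_big_dep (mem A) (fun i j => j \in B))/=.
rewrite big_mkcond [RHS]big_mkcond/=.
apply: eq_bigr => -[i j] _ /=; rewrite !inE/=.
by case: (i \in A); case: (j \in B); case: (j < i)%N.
Qed.

Lemma inversionsUl A B C : [disjoint A & B] ->
  inversions (A :|: B)%SET C = (inversions A C + inversions B C)%N.
Proof.
by move=> dAB; rewrite !inversionsE -bigU//=; apply: eq_bigl => i; rewrite !inE.
Qed.

Lemma inversionsUr A B C : [disjoint B & C] ->
  inversions A (B :|: C)%SET = (inversions A B + inversions A C)%N.
Proof.
move=> dBC; rewrite !inversionsE -big_split/=.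
apply: eq_bigr => i _.
by rewrite -bigU//=; apply: eq_bigl => j; rewrite !inE.
Qed.

Lemma inversionsC A B : [disjoint A & B] ->
  (inversions A B + inversions B A = #|A| * #|B|)%N.
Proof.
move=> dAB; rewrite !inversionsE [X in (_ + X)%N]exchange_big/= -big_split/=.
rewrite -sum_nat_const; apply: eq_bigr => i iA.
rewrite -big_split/= -sum1_card; apply: eq_bigr => j jB.
have : i != j by apply: contraTneq iA => ->; rewrite (disjointFl dAB).
by rewrite -val_eqE/=; case: ltngtP.
Qed.

Lemma inversions0l A : inversions finset.set0 A = 0%N.
Proof. by rewrite inversionsE big_set0. Qed.

Lemma inversions0r A : inversions A finset.set0 = 0%N.
Proof. by rewrite inversionsE big1// => i _; rewrite big_set0. Qed.

Lemma setU_setD I J : J \subset I -> (J :|: (I :\: J) = I)%SET.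
Proof.
move=> JI; apply/finset.setP => k; rewrite !inE.
by case kJ: (k \in J); rewrite //= (fintype.subsetP JI).
Qed.

(** Both sides run over the ordered partitions of S into three blocks: a flag J, I,
    S has the blocks J, I minus J and S minus I. This is the combinatorial content
    of associativity. *)
Lemma subsetD_flag (U : nmodType) S
    (P : {set 'I_n} -> {set 'I_n} -> {set 'I_n} -> U) :
  \sum_(I : {set 'I_n} | I \subset S) \sum_(J : {set 'I_n} | J \subset I)
     P J (I :\: J)%SET (S :\: I)%SET =
  \sum_(J : {set 'I_n} | J \subset S)
     \sum_(L : {set 'I_n} | L \subset S :\: J) P J L ((S :\: J) :\: L)%SET.
Proof.
rewrite (exchange_big_dep (fun J => J \subset S))/=; last first.
  by move=> I J IS JI; exact: fintype.subset_trans JI IS.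
apply: eq_bigr => J JS.
rewrite (reindex_onto (fun L => L :|: J)%SET (fun I => I :\: J)%SET)/=.
  apply: eq_big => [L|L].
    rewrite finset.subUset JS andbT finset.subsetUr andbT.
    rewrite finset.subsetD; case LS: (L \subset S) => //=.
    rewrite finset.setDUl finset.setDv finset.setU0.
    exact: (sameP eqP finset.setDidPl).
  move=> /andP[/andP[LS JL] /eqP LJ].
  by rewrite LJ -finset.setDDl finset.setDDl finset.setUC -finset.setDDl.
by move=> I /andP[IS JI]; rewrite finset.setUC setU_setD.
Qed.

End Inversions.

Section Convolution.
Variables (n : nat) (K : fieldType).
Implicit Types S I J : {set 'I_n}.

(** The common shape of the wedge product, of the action of endomorphism-valued
    forms and of their composition. The map [m p] multiplies the values; p is the
    parity of the form degree of the right factor, past which the sign rule moves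
    the left value. *)
Definition conv (U V W : lmodType K) (m : bool -> U -> V -> W)
    (a : ext n U) (b : ext n V) : ext n W :=
  [ffun S : {set 'I_n} => \sum_(I : {set 'I_n} | I \subset S)
     (-1) ^+ inversions I (S :\: I) *: m (odd #|S :\: I|) (a I) (b (S :\: I))].

Definition bilin (U V W : lmodType K) (m : bool -> U -> V -> W) : Prop :=
  (forall p v, linear (m p ^~ v)) /\ (forall p u, linear (m p u)).

Lemma bilin_suml (U V W : lmodType K) (m : bool -> U -> V -> W) : bilin m ->
  forall p v (T : Type) (r : seq T) (P : pred T) (F : T -> K) (u : T -> U),
  m p (\sum_(i <- r | P i) F i *: u i) v = \sum_(i <- r | P i) F i *: m p (u i) v.
Proof.
move=> [lm _] p v T r P F u.
pose f := GRing.isLinear.Build _ _ _ _ (m p ^~ v) (lm p v).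
pose g : {linear U -> W} := HB.pack (m p ^~ v) f.
rewrite -[LHS]/(g _) linear_sum; apply: eq_bigr => i _; exact: linearZ.
Qed.

Lemma bilin_sumr (U V W : lmodType K) (m : bool -> U -> V -> W) : bilin m ->
  forall p u (T : Type) (r : seq T) (P : pred T) (F : T -> K) (v : T -> V),
  m p u (\sum_(i <- r | P i) F i *: v i) = \sum_(i <- r | P i) F i *: m p u (v i).
Proof.
move=> [_ lm] p u T r P F v.
pose f := GRing.isLinear.Build _ _ _ _ (m p u) (lm p u).
pose g : {linear V -> W} := HB.pack (m p u) f.
rewrite -[LHS]/(g _) linear_sum; apply: eq_bigr => i _; exact: linearZ.
Qed.

Lemma bilinZl (U V W : lmodType K) (m : bool -> U -> V -> W) : bilin m ->
  forall p k u v, m p (k *: u) v = k *: m p u v.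
Proof.
move=> bm p k u v; have := bilin_suml bm p v [:: tt] xpredT (fun=> k) (fun=> u).
by rewrite !big_seq1.
Qed.

Lemma bilinZr (U V W : lmodType K) (m : bool -> U -> V -> W) : bilin m ->
  forall p k u v, m p u (k *: v) = k *: m p u v.
Proof.
move=> bm p k u v; have := bilin_sumr bm p u [:: tt] xpredT (fun=> k) (fun=> v).
by rewrite !big_seq1.
Qed.

Lemma bilin0l (U V W : lmodType K) (m : bool -> U -> V -> W) : bilin m ->
  forall p v, m p 0 v = 0.
Proof. by move=> bm p v; rewrite -(scale0r 0) (bilinZl bm) scale0r. Qed.

Lemma bilin0r (U V W : lmodType K) (m : bool -> U -> V -> W) : bilin m ->
  forall p u, m p u 0 = 0.
Proof. by move=> bm p u; rewrite -(scale0r 0) (bilinZr bm) scale0r. Qed.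

(** Both sides are sums over ordered partitions of S into blocks J, L, N, with the
    sign given by the inversions between the blocks. The parity [p (+) q] appears on
    the right because the value at J has to pass the basis forms of both L and N. *)
Lemma convA (U V W UV VW Z : lmodType K)
    (m1 : bool -> UV -> W -> Z) (m2 : bool -> U -> V -> UV)
    (m3 : bool -> U -> VW -> Z) (m4 : bool -> V -> W -> VW) :
  bilin m1 -> bilin m3 ->
  (forall p q u v w, m1 q (m2 p u v) w = m3 (p (+) q) u (m4 q v w)) ->
  forall a b c, conv m1 (conv m2 a b) c = conv m3 a (conv m4 b c).
Proof.
move=> b1 b3 mA a b c; apply/ffunP => S; rewrite !ffunE.
pose P (J L N : {set 'I_n}) : Z :=
  (-1) ^+ (inversions J L + inversions (J :|: L) N)%N *:
    m1 (odd #|N|) (m2 (odd #|L|) (a J) (b L)) (c N).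
transitivity (\sum_(I : {set 'I_n} | I \subset S)
   \sum_(J : {set 'I_n} | J \subset I) P J (I :\: J)%SET (S :\: I)%SET).
  apply: eq_bigr => I IS; rewrite ffunE (bilin_suml b1) scaler_sumr.
  apply: eq_bigr => J JI; rewrite scalerA -exprD addnC /P.
  by rewrite setU_setD.
rewrite subsetD_flag; apply: eq_bigr => J JS.
rewrite ffunE (bilin_sumr b3) scaler_sumr; apply: eq_bigr => L LSJ.
rewrite scalerA -exprD /P mA.
set N := ((S :\: J) :\: L)%SET.
have dJL : [disjoint J & L].
  by move: LSJ; rewrite finset.subsetD disjoint_sym => /andP[].
have SJ : (S :\: J = L :|: N)%SET.
  by rewrite /N setU_setD.
have dLN : [disjoint L & N] by rewrite finset.disjoints_subset finset.setCD finset.subsetUr.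
rewrite SJ (inversionsUl _ dJL) (inversionsUr _ dLN).
rewrite cardsU (disjoint_setI0 dLN) cards0 subn0 oddD.
by congr (_ ^+ _ *: _); lia.
Qed.

Lemma conv_is_linearl (U V W : lmodType K) (m : bool -> U -> V -> W) b :
  bilin m -> linear (conv m ^~ b).
Proof.
move=> [l1 _] k u v; apply/ffunP => S; rewrite !ffunE scaler_sumr -big_split/=.
apply: eq_bigr => I _; rewrite !ffunE l1 scalerDr !scalerA; congr (_ *: _ + _).
by rewrite mulrC.
Qed.

Lemma conv_is_linearr (U V W : lmodType K) (m : bool -> U -> V -> W) a :
  bilin m -> linear (conv m a).
Proof.
move=> [_ l1] k u v; apply/ffunP => S; rewrite !ffunE scaler_sumr -big_split/=.
apply: eq_bigr => I _; rewrite !ffunE l1 scalerDr !scalerA; congr (_ *: _ + _).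
by rewrite mulrC.
Qed.

Definition ebasis (S : {set 'I_n}) : ext n K^o := [ffun T => (T == S)%:R].
Definition eone := ebasis finset.set0.

(** The element a (x) v of the exterior algebra with coefficients in V. *)
Definition etens (V : lmodType K) (a : ext n K^o) (v : V) : ext n V :=
  [ffun S => (a S : K) *: v].

Lemma conv_degl (U V W : lmodType K) (m : bool -> U -> V -> W) :
  bilin m -> forall (a : ext n U) (b : ext n V) S,
  (forall I, I != finset.set0 -> a I = 0) ->
  conv m a b S = m (odd #|S|) (a finset.set0) (b S).
Proof.
move=> bm a b S a0; rewrite ffunE (bigD1 finset.set0) ?finset.sub0set//=.
rewrite big1 ?addr0 => [|I /andP[_ I0]].
  by rewrite finset.setD0 inversions0l expr0 scale1r.
by rewrite a0// (bilin0l bm) scaler0.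
Qed.

Lemma conv_degr (U V W : lmodType K) (m : bool -> U -> V -> W) :
  bilin m -> forall (a : ext n U) (b : ext n V) S,
  (forall I, I != finset.set0 -> b I = 0) ->
  conv m a b S = m false (a S) (b finset.set0).
Proof.
move=> bm a b S b0; rewrite ffunE (bigD1 S)//=.
rewrite finset.setDv inversions0r expr0 scale1r cards0/= big1 ?addr0// => I.
move=> /andP[IS nIS]; rewrite b0 ?(bilin0r bm) ?scaler0//.
rewrite finset.setD_eq0; apply: contra nIS => SI.
by rewrite finset.eqEsubset IS.
Qed.

End Convolution.

Section WedgeAlgebra.
Variables (n : nat) (K : fieldType).
Implicit Types S I L : {set 'I_n}.

Definition wmul (V : lmodType K) (_ : bool) (x : K^o) (v : V) : V := (x : K) *: v.

Lemma wmul_bilin (V : lmodType K) : bilin (@wmul V).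
Proof.
split=> p v k u w; rewrite /wmul; first by rewrite scalerDl scalerA.
by rewrite scalerDr !scalerA mulrC.
Qed.

Lemma wedgeE (V : lmodType K) (a : ext n K^o) (b : ext n V) :
  wedge a b = conv (@wmul V) a b.
Proof.
by apply/ffunP => S; rewrite !ffunE; apply: eq_bigr => I _; rewrite scalerA.
Qed.

Lemma wedgeA (V : lmodType K) (a b : ext n K^o) (c : ext n V) :
  wedge (wedge a b) c = wedge a (wedge b c).
Proof.
rewrite !wedgeE; apply: convA; [exact: wmul_bilin|exact: wmul_bilin|].
by move=> p q u v w; rewrite /wmul scalerA.
Qed.

Lemma wedge_linearl (V : lmodType K) (b : ext n V) : linear (fun a : ext n K^o => wedge a b).
Proof. by move=> k u v; rewrite !wedgeE (conv_is_linearl _ (@wmul_bilin V)). Qed.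

Lemma wedge_linearr (V : lmodType K) (a : ext n K^o) : linear (@wedge n K V a).
Proof. by move=> k u v; rewrite !wedgeE (conv_is_linearr _ (@wmul_bilin V)). Qed.

HB.instance Definition _ (V : lmodType K) (a : ext n K^o) :=
  GRing.isLinear.Build K (ext n V) (ext n V) _ (@wedge n K V a) (wedge_linearr a).

(** The wedge product with its arguments exchanged, to be linear in the form. *)
Definition wedger (V : lmodType K) (b : ext n V) (a : ext n K^o) := wedge a b.

HB.instance Definition _ (V : lmodType K) (b : ext n V) :=
  GRing.isLinear.Build K (ext n K^o) (ext n V) _ (wedger b) (wedge_linearl b).

Lemma wedge1 (V : lmodType K) (b : ext n V) : wedge (eone n K) b = b.
Proof.
apply/ffunP => S; rewrite wedgeE (conv_degl (@wmul_bilin V)).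
  by rewrite /wmul ffunE eqxx scale1r.
by move=> I I0; rewrite ffunE (negbTE I0).
Qed.

Definition hom_deg (V : lmodType K) (k : nat) (a : ext n V) : Prop :=
  forall S, #|S| != k -> a S = 0.

Lemma wedge_hom (V : lmodType K) k l (a : ext n K^o) (b : ext n V) :
  hom_deg k a -> hom_deg l b -> hom_deg (k + l) (wedge a b).
Proof.
move=> ha hb S kl; rewrite ffunE big1// => I IS.
have [Ik|Ik] := eqVneq #|I| k; last by rewrite ha// mulr0 scale0r.
rewrite hb ?scaler0//; apply: contraNneq kl => <-.
by rewrite cardsD (finset.setIidPr IS) Ik subnKC// -Ik subset_leq_card.
Qed.

Lemma covec_hom (u : 'I_n -> K) : hom_deg 1 (covec u).
Proof.
move=> S S1; rewrite ffunE big1// => j /eqP Sj; move: S1.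
by rewrite Sj cards1.
Qed.

Lemma ebasis_hom I : hom_deg #|I| (ebasis K I).
Proof. by move=> S; rewrite ffunE; case: (S =P I) => [->|//]; rewrite eqxx. Qed.

(** For basis elements the sign is the number of inversions of (I, J) plus that of
    (J, I), which is #|I| * #|J|. *)
Lemma wedgeC k l (a b : ext n K^o) : hom_deg k a -> hom_deg l b ->
  wedge a b = (-1) ^+ (k * l) *: wedge b a.
Proof.
move=> ha hb; apply/ffunP => S; rewrite !ffunE.
rewrite [in RHS](reindex_onto (fun I => S :\: I)%SET (fun I => S :\: I)%SET)/=;
  last first.
  by move=> I IS; rewrite finset.setDDr finset.setDv finset.set0U (finset.setIidPr IS).
rewrite scaler_sumr; apply: eq_big => [I|I IS].
  rewrite finset.subsetDl/= finset.setDDr finset.setDv finset.set0U.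
  by apply/idP/eqP => /finset.setIidPr.
have [Ik|Ik] := eqVneq #|I| k; last first.
  by rewrite ha// mulr0 scale0r finset.setDDr finset.setDv finset.set0U
     (finset.setIidPr IS) ha// !scaler0.
have [SIl|SIl] := eqVneq #|S :\: I|%SET l; last first.
  by rewrite hb// mulr0 scale0r !scaler0.
rewrite finset.setDDr finset.setDv finset.set0U (finset.setIidPr IS).
have dI : [disjoint I & S :\: I]%SET.
  by rewrite disjoint_sym finset.disjoints_subset finset.setDE finset.subsetIr.
have := inversionsC dI; rewrite Ik SIl => <-.
rewrite exprD /GRing.scale/=.
set s := (-1) ^+ inversions I _; set t := (-1) ^+ inversions _ I.
have e : t * t = 1 by rewrite -expr2 sqrr_sign.
set x : K := a I; set y : K := b _.
by transitivity (s * (t * t) * x * y); [rewrite e mulr1|ring].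
Qed.

Lemma etens_is_linear (V : lmodType K) (w : ext n K^o) : linear (@etens n K V w).
Proof.
move=> k u v; apply/ffunP => S; rewrite !ffunE scalerDr !scalerA.
by rewrite mulrC.
Qed.

HB.instance Definition _ (V : lmodType K) (w : ext n K^o) :=
  GRing.isLinear.Build K V (ext n V) _ (@etens n K V w) (etens_is_linear w).

Lemma etensZl (V : lmodType K) k (w : ext n K^o) (v : V) :
  etens (k *: w) v = k *: etens w v.
Proof. by apply/ffunP => S; rewrite !ffunE scalerA. Qed.

Lemma etens0l (V : lmodType K) (v : V) : etens (0 : ext n K^o) v = 0.
Proof. by apply/ffunP => S; rewrite !ffunE scale0r. Qed.

Lemma ebasis_expand (V : lmodType K) (a : ext n V) :
  a = \sum_(I : {set 'I_n}) etens (ebasis K I) (a I).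
Proof.
apply/ffunP => S; rewrite sum_ffunE (bigD1 S)//= big1 ?addr0 => [|I IS].
  by rewrite !ffunE eqxx scale1r.
by rewrite !ffunE eq_sym (negbTE IS) scale0r.
Qed.

(** On decomposable elements the form parts and the values multiply separately. The
    parity p of w' decides which of the two products [m false], [m true] applies. *)
Lemma conv_etens (U V W : lmodType K) (m : bool -> U -> V -> W) (p : bool)
    (w w' : ext n K^o) (u : U) (v : V) :
  bilin m -> (forall S, odd #|S| != p -> w' S = 0) ->
  conv m (etens w u) (etens w' v) = etens (wedge w w') (m p u v).
Proof.
move=> bm hw; apply/ffunP => S; rewrite !ffunE scaler_suml.
apply: eq_bigr => I _; rewrite !ffunE (bilinZl bm) (bilinZr bm) !scalerA.
have [->|Sp] := eqVneq (odd #|S :\: I|%SET) p; first by rewrite mulrA.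
by rewrite hw ?Sp// !(mulr0, scaler0, scale0r).
Qed.

End WedgeAlgebra.

Section Substitution.
Variables (n : nat) (K : fieldType).
Hypothesis two_neq0 : 2%:R != 0 :> K.
Implicit Types S I L : {set 'I_n}.

Lemma covecC (u v : 'I_n -> K) (V : lmodType K) (b : ext n V) :
  wedge (covec u) (wedge (covec v) b) = - wedge (covec v) (wedge (covec u) b).
Proof.
rewrite -!wedgeA (wedgeC (covec_hom u) (covec_hom v)) expr1 scaleN1r.
by rewrite -[wedge (- _) b]/(wedger b _) linearN.
Qed.

(** By anticommutativity the left side is its own opposite, and 2 is invertible. *)
Lemma covec_sqr (u : 'I_n -> K) (V : lmodType K) (b : ext n V) :
  wedge (covec u) (wedge (covec u) b) = 0.
Proof.
have /eqP := covecC u u b; rewrite -addr_eq0 -mulr2n -scaler_nat scaler_eq0.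
by rewrite (negbTE two_neq0)/= => /eqP.
Qed.

(** Sets grow by elements smaller than all previous ones, in the order in which
    [subst_basis] multiplies covectors. *)
Lemma set_min_ind (P : {set 'I_n} -> Prop) : P finset.set0 ->
  (forall (i : 'I_n) I, (forall j, j \in I -> (i < j)%N) -> P I -> P (i |: I)%SET) ->
  forall I, P I.
Proof.
move=> P0 PS I; have [k] := ubnP #|I|; elim: k I => // k IH I kI.
have [->//|[i0 i0I]] := finset.set_0Vmem I.
case: (arg_minnP (fun i : 'I_n => val i) i0I) => i iI0 imin.
have iI : i \in I := iI0.
rewrite -(finset.setD1K iI); apply: PS.
  move=> j; rewrite !inE => /andP[ji jI].
  by rewrite ltn_neqAle imin// andbT eq_sym.
by apply: IH; move: kI; rewrite (cardsD1 i) iI add1n ltnS.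
Qed.

Lemma enum_min (i : 'I_n) I : (forall j, j \in I -> (i < j)%N) ->
  enum (i |: I)%SET = i :: enum I.
Proof.
move=> iI.
have srt (A : {set 'I_n}) : sorted (fun a b : 'I_n => (a < b)%N) (enum A).
  change (sorted (relpre (@nat_of_ord n) ltn) (enum A)).
  rewrite /enum_mem; apply: sorted_filter.
    by move=> ? ? ?; exact: ltn_trans.
  by rewrite -sorted_map -enumT val_enum_ord iota_ltn_sorted.
apply: (irr_sorted_eq (leT := fun a b : 'I_n => (a < b)%N)).
- by move=> ???; exact: ltn_trans.
- by move=> ?; rewrite /= ltnn.
- exact: srt.
- rewrite /= path_min_sorted ?srt//; apply/allP => j.
  by rewrite mem_enum; exact: iI.
- by move=> j; rewrite !(inE, mem_enum).
Qed.

Variable J : 'I_n -> 'I_n -> K.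

Lemma subst_basis0 : subst_basis J finset.set0 = eone n K.
Proof. by rewrite /subst_basis enum_set0. Qed.

Lemma subst_basisU1 (i : 'I_n) I : (forall j, j \in I -> (i < j)%N) ->
  subst_basis J (i |: I)%SET = wedge (covec (J i)) (subst_basis J I).
Proof. by move=> iI; rewrite /subst_basis enum_min. Qed.

Lemma subst_basis_hom I : hom_deg #|I| (subst_basis J I).
Proof.
elim/set_min_ind: I => [|i I iI IH].
  by rewrite subst_basis0; exact: ebasis_hom.
have iNI : i \notin I by apply/negP => /iI; rewrite ltnn.
by rewrite subst_basisU1// cardsU1 iNI; apply: wedge_hom => //; exact: covec_hom.
Qed.

Lemma inversions1_gt (i : 'I_n) I : (forall j, j \in I -> (i < j)%N) ->
  inversions [set i]%SET I = 0%N.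
Proof.
move=> iI; rewrite inversionsE big_set1 big1// => j /iI ij.
by rewrite ltnNge (ltnW ij).
Qed.

Lemma inversions11 (i j : 'I_n) : inversions [set i]%SET [set j]%SET = (j < i)%N.
Proof. by rewrite inversionsE !big_set1. Qed.

(** A covector is moved to its place in the increasing product, at the cost of one
    sign for each smaller index. *)
Lemma covec_subst_basis (i : 'I_n) I :
  wedge (covec (J i)) (subst_basis J I) =
  if i \in I then 0
  else (-1) ^+ inversions [set i]%SET I *: subst_basis J (i |: I)%SET.
Proof.
elim/set_min_ind: I => [|j I jI IH].
  by rewrite inE inversions0r scale1r subst_basisU1// => j; rewrite inE.
have jNI : j \notin I by apply/negP => /jI; rewrite ltnn.
rewrite !inE subst_basisU1//.
have [ij|ji|ij] := ltngtP i j.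
- have lt_i k : k \in (j |: I)%SET -> (i < k)%N.
    by rewrite !inE => /orP[/eqP->//|/jI]; exact: ltn_trans.
  have /negbTE iNI : i \notin I by apply/negP => /jI; rewrite ltnNge (ltnW ij).
  rewrite iNI -val_eqE/= (ltn_eqF ij)/= inversions1_gt// scale1r.
  by rewrite [in RHS]subst_basisU1// subst_basisU1.
- rewrite -val_eqE/= (gtn_eqF ji)/= covecC IH.
  case: ifP => iI; first by rewrite linear0 oppr0.
  rewrite linearZ/= inversionsUr ?disjoints1// inversions11 ji add1n exprS.
  rewrite mulN1r scaleNr; congr (- (_ *: _)).
  rewrite finset.setUCA [RHS]subst_basisU1// => k; rewrite !inE.
  by move=> /orP[/eqP->//|/jI].
- by have {ij}-> := val_inj ij; rewrite eqxx/= covec_sqr.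
Qed.

(** The substituted basis elements multiply as the basis elements do. This is why a
    linear substitution is compatible with every product of the shape [conv]. *)
Lemma subst_basisM I L :
  wedge (subst_basis J I) (subst_basis J L) =
  if [disjoint I & L] then (-1) ^+ inversions I L *: subst_basis J (I :|: L)%SET
  else 0.
Proof.
elim/set_min_ind: I => [|i I iI IH].
  rewrite subst_basis0 wedge1 inversions0l finset.set0U scale1r.
  by rewrite -finset.setI_eq0 finset.set0I eqxx.
have iNI : i \notin I by apply/negP => /iI; rewrite ltnn.
rewrite subst_basisU1// wedgeA IH -[in RHS]finset.setI_eq0 finset.setIUl finset.setU_eq0.
rewrite !finset.setI_eq0 disjoints1 andbC.
case: ifP => dIL; last by rewrite linear0.
rewrite linearZ/= covec_subst_basis inE (negbTE iNI)/=.
case: (boolP (i \in L)) => iL; first by rewrite scaler0.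
rewrite scalerA finset.setUA; congr (_ *: _).
rewrite -exprD inversionsUl ?disjoints1// inversionsUr//.
by rewrite inversions1_gt// add0n addnC.
Qed.

Lemma ext_substE (V : lmodType K) (a : ext n V) :
  ext_subst J a = \sum_(I : {set 'I_n}) etens (subst_basis J I) (a I).
Proof.
apply/ffunP => S; rewrite sum_ffunE ffunE; apply: eq_bigr => I _.
by rewrite ffunE.
Qed.

Lemma ext_subst_linear (V : lmodType K) : linear (@ext_subst n K V J).
Proof.
move=> k u v; apply/ffunP => S; rewrite !ffunE scaler_sumr -big_split/=.
apply: eq_bigr => I _; rewrite !ffunE scalerDr !scalerA; congr (_ *: _ + _).
by rewrite mulrC.
Qed.

HB.instance Definition _ (V : lmodType K) :=
  GRing.isLinear.Build K (ext n V) (ext n V) _ (@ext_subst n K V J)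
    (@ext_subst_linear V).

(** Pairs of disjoint sets (I, L) are the same as sets S with a subset I; pairs that
    are not disjoint contribute 0 on both sides. *)
Lemma ext_subst_conv (U V W : lmodType K) (m : bool -> U -> V -> W)
    (a : ext n U) (b : ext n V) :
  bilin m -> conv m (ext_subst J a) (ext_subst J b) = ext_subst J (conv m a b).
Proof.
move=> bm; rewrite !ext_substE.
pose f := GRing.isLinear.Build K (ext n U) (ext n W) _
  (fun x => conv m x (\sum_(I : {set 'I_n}) etens (subst_basis J I) (b I)))
  (conv_is_linearl _ bm).
pose F : {linear ext n U -> ext n W} := HB.pack (fun x => conv m x _) f.
rewrite -[LHS]/(F _) linear_sum/=.
pose T I L : ext n W := if [disjoint I & L] then
  (-1) ^+ inversions I L *:
    etens (subst_basis J (I :|: L)%SET) (m (odd #|L|) (a I) (b L)) else 0.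
transitivity (\sum_I \sum_L T I L).
  apply: eq_bigr => I _; rewrite /F/=.
  pose g := GRing.isLinear.Build K (ext n V) (ext n W) _
    (conv m (etens (subst_basis J I) (a I))) (conv_is_linearr _ bm).
  pose G : {linear ext n V -> ext n W} := HB.pack (conv m _) g.
  rewrite -[LHS]/(G _) linear_sum/=; apply: eq_bigr => L _; rewrite /G/=.
  rewrite (conv_etens (p := odd #|L|))//; last first.
    move=> S SL; apply: subst_basis_hom; apply: contraNneq SL => ->.
    by [].
  rewrite subst_basisM /T; case: ifP => _; last by rewrite etens0l.
  by rewrite etensZl.
rewrite [RHS](_ : _ = \sum_(S : {set 'I_n}) \sum_(I : {set 'I_n} | I \subset S)
    T I (S :\: I)%SET).
  rewrite [RHS](exchange_big_dep xpredT)//=; apply: eq_bigr => I _.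
  rewrite (bigID (fun L => [disjoint I & L]))/= [X in _ + X]big1 ?addr0; last first.
    by move=> L dIL; rewrite /T; case: ifP => // h; case/negP: dIL.
  rewrite [RHS](reindex_onto (fun L => I :|: L)%SET (fun S => S :\: I)%SET)/=;
    last by move=> S IS; rewrite setU_setD.
  apply: eq_big => [L|L dIL].
    rewrite finset.subsetUl/= finset.setDUl finset.setDv finset.set0U.
    by rewrite (sameP eqP finset.setDidPl) disjoint_sym.
  rewrite finset.setDUl finset.setDv finset.set0U.
  by rewrite disjoint_sym in dIL; rewrite (finset.setDidPl dIL).
apply: eq_bigr => S _; rewrite ffunE linear_sum/=; apply: eq_bigr => I IS.
have dI : [disjoint I & S :\: I]%SET.
  by rewrite disjoint_sym finset.disjoints_subset finset.setDE finset.subsetIr.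
by rewrite linearZ/= /T dI setU_setD.
Qed.

Lemma ext_subst_wedge (V : lmodType K) (a : ext n K^o) (b : ext n V) :
  ext_subst J (wedge a b) = wedge (ext_subst J a) (ext_subst J b).
Proof. by rewrite !wedgeE ext_subst_conv//; exact: wmul_bilin. Qed.

Lemma subst_basis1 (j : 'I_n) : subst_basis J [set j]%SET = covec (J j).
Proof.
have := covec_subst_basis j finset.set0.
rewrite inE inversions0r scale1r finset.setU0 => <-.
rewrite subst_basis0.
have := wedgeC (covec_hom (J j)) (@ebasis_hom n K finset.set0).
by rewrite cards0 scale1r => ->; rewrite wedge1.
Qed.

Lemma ext_subst_covec (u : 'I_n -> K) :
  ext_subst J (covec u) = covec (fun l => \sum_k u k * J k l).
Proof.
have -> : covec u = \sum_k u k *: ebasis K [set k]%SET.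
  apply/ffunP => S; rewrite sum_ffunE ffunE big_mkcond/=; apply: eq_bigr => k _.
  by rewrite !ffunE /GRing.scale/=; case: eqP => _; rewrite ?mulr1 ?mulr0.
rewrite linear_sum/=; apply/ffunP => S; rewrite sum_ffunE ffunE.
rewrite exchange_big/=; apply: eq_bigr => k _.
rewrite linearZ/= ext_substE (bigD1 [set k]%SET)//= big1 ?addr0; last first.
  by move=> I Ik; rewrite ffunE (negbTE Ik) linear0.
rewrite !ffunE eqxx subst_basis1 ffunE.
by rewrite /GRing.scale/= mulr1 mulr_sumr.
Qed.

Lemma ext_subst1 : ext_subst J (eone n K) = eone n K.
Proof.
rewrite ext_substE (bigD1 finset.set0)//= big1 ?addr0; last first.
  by move=> I I0; rewrite ffunE (negbTE I0) linear0.
rewrite subst_basis0; apply/ffunP => S; rewrite !ffunE eqxx.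
by rewrite /GRing.scale/= mulr1.
Qed.

End Substitution.

(** * Functoriality of linear substitutions *)

Section SubstitutionFunctor.
Variables (n : nat) (K : fieldType).
Hypothesis two_neq0 : 2%:R != 0 :> K.
Implicit Types S I L : {set 'I_n}.

Lemma ext_subst_etens J (V : lmodType K) (w : ext n K^o) (v : V) :
  ext_subst J (etens w v) = etens (ext_subst J w) v.
Proof.
apply/ffunP => S; rewrite !ffunE scaler_suml; apply: eq_bigr => I _.
by rewrite !ffunE scalerA.
Qed.

(** Both sides are multiplicative in the basis elements, so it is enough to compare
    them on covectors. *)
Lemma ext_subst_comp J1 J2 (V : lmodType K) (a : ext n V) :
  ext_subst J1 (ext_subst J2 a) =
  ext_subst (fun k l => \sum_m J2 k m * J1 m l) a.
Proof.
rewrite [in LHS](ext_substE J2) linear_sum/= ext_substE.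
apply: eq_bigr => I _; rewrite ext_subst_etens; congr etens.
elim/set_min_ind: I => [|i I iI IH].
  by rewrite !subst_basis0 ext_subst1.
rewrite !subst_basisU1// (ext_subst_wedge two_neq0) IH.
by rewrite (ext_subst_covec two_neq0).
Qed.

Lemma wedge_ebasis I L : [disjoint I & L] ->
  wedge (ebasis K I) (ebasis K L) = (-1) ^+ inversions I L *: ebasis K (I :|: L)%SET.
Proof.
move=> dIL; apply/ffunP => S; rewrite !ffunE.
have SI : (S == (I :|: L)%SET) = (I \subset S) && (S :\: I == L)%SET.
  apply/eqP/andP => [->|[IS /eqP <-]]; last by rewrite setU_setD.
  rewrite finset.subsetUl finset.setDUl finset.setDv finset.set0U.
  by rewrite disjoint_sym in dIL; rewrite (finset.setDidPl dIL).
rewrite SI; have [IS|IS]/= := boolP (I \subset S); last first.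
  rewrite [RHS]mulr0 big1// => A AS; rewrite ffunE.
  have [AI|] := eqVneq A I; first by rewrite -AI AS in IS.
  by rewrite mulr0 scale0r.
rewrite (bigD1 I)//= big1 ?addr0; last first.
  by move=> A /andP[AS /negbTE AI]; rewrite ffunE AI mulr0 scale0r.
rewrite !ffunE eqxx mulr1; case: eqP => [->|_].
  by rewrite /GRing.scale/=.
by rewrite [LHS]mulr0 [RHS]mulr0.
Qed.

Lemma ext_subst_id (V : lmodType K) (a : ext n V) :
  ext_subst (fun k l => (l == k)%:R) a = a.
Proof.
rewrite [RHS]ebasis_expand ext_substE; apply: eq_bigr => I _; congr etens.
elim/set_min_ind: I => [|i I iI IH]; first exact: subst_basis0.
have iNI : i \notin I by apply/negP => /iI; rewrite ltnn.
rewrite subst_basisU1// IH (_ : covec _ = ebasis K [set i]%SET); last first.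
  apply/ffunP => S; rewrite !ffunE big_mkcond/= (bigD1 i)//= big1 ?addr0.
    by rewrite eqxx; case: eqP.
  by move=> j /negbTE ji; rewrite ji; case: eqP.
by rewrite wedge_ebasis ?disjoints1// inversions1_gt// scale1r.
Qed.

Lemma ext_subst_hom J k (V : lmodType K) (a : ext n V) :
  hom_deg k a -> hom_deg k (ext_subst J a).
Proof.
move=> ha S Sk; rewrite ffunE big1// => I _.
have [Ik|Ik] := eqVneq #|I| k; last by rewrite ha// scaler0.
by rewrite subst_basis_hom ?scale0r// Ik.
Qed.

Lemma ext_subst_map J (U V : lmodType K) (f : {linear U -> V}) (a : ext n U) :
  ext_subst J [ffun S => f (a S)] = [ffun S => f (ext_subst J a S)].
Proof.
apply/ffunP => S; rewrite !ffunE linear_sum; apply: eq_bigr => I _.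
by rewrite ffunE linearZ.
Qed.

End SubstitutionFunctor.

(** * The sign rule for endomorphism-valued forms *)

Section GradedEndomorphisms.
Variables (n : nat) (K : fieldType) (V : vectType K) (g : 'End(V)).
Hypothesis gg : (g \o g = \1)%VF.
Implicit Types (S I J : {set 'I_n}) (L N : ext n 'End(V)) (v : ext n V).

(** Conjugation by the grading involution multiplies a homogeneous f by (-1)^|f|.
    Signs of the form (-1)^(p |f|) are written in this way, which does not require f
    to be homogeneous. *)
Definition conjg (p : bool) (f : 'End(V)) : 'End(V) :=
  if p then (g \o f \o g)%VF else f.

Lemma conjg_linear p : linear (conjg p).
Proof.
case: p => k u v //=.
by rewrite comp_lfunDr -comp_lfunZr comp_lfunDl -comp_lfunZl.
Qed.

HB.instance Definition _ p :=
  GRing.isLinear.Build K 'End(V) 'End(V) _ (conjg p) (conjg_linear p).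

Lemma conjgM p f h : conjg p (f \o h)%VF = (conjg p f \o conjg p h)%VF.
Proof.
case: p => //=; rewrite !comp_lfunA; congr (_ \o _)%VF.
by rewrite -(comp_lfunA _ g g) gg comp_lfun1r.
Qed.

Lemma conjgK p q f : conjg p (conjg q f) = conjg (p (+) q) f.
Proof.
case: p q => [] [] //=; rewrite !comp_lfunA gg comp_lfun1l.
by rewrite -comp_lfunA gg comp_lfun1r.
Qed.

Lemma conjg1 p : conjg p \1%VF = \1%VF.
Proof. by case: p; rewrite //= comp_lfun1r gg. Qed.

Definition actm (p : bool) (f : 'End(V)) (x : V) : V := conjg p f x.
Definition mulm (p : bool) (f h : 'End(V)) : 'End(V) := (conjg p f \o h)%VF.

Lemma actm_bilin : bilin actm.
Proof.
split=> p v k u w; rewrite /actm; last by rewrite linearP.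
by rewrite linearP/= !lfunE/= lfunE.
Qed.

Lemma mulm_bilin : bilin mulm.
Proof.
split=> p v k u w; rewrite /mulm; last by rewrite comp_lfunDr -comp_lfunZr.
by rewrite linearP/= comp_lfunDl -comp_lfunZl.
Qed.

Definition pact L v : ext n V := conv actm L v.
Definition pmul L N : ext n 'End(V) := conv mulm L N.

HB.instance Definition _ L := GRing.isLinear.Build K (ext n V) (ext n V) _ (pact L)
  (conv_is_linearr L actm_bilin).
HB.instance Definition _ L := GRing.isLinear.Build K (ext n 'End(V)) (ext n 'End(V)) _
  (pmul L) (conv_is_linearr L mulm_bilin).

Lemma pact_linearl v : linear (fun L => pact L v).
Proof. exact: (conv_is_linearl v actm_bilin). Qed.

Definition pactr v L := pact L v.
HB.instance Definition _ v := GRing.isLinear.Build K (ext n 'End(V)) (ext n V) _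
  (pactr v) (pact_linearl v).

Lemma pact0l v : pact 0 v = 0. Proof. exact: (linear0 (pactr v)). Qed.
Lemma pactDl v L N : pact (L + N) v = pact L v + pact N v.
Proof. exact: (linearD (pactr v)). Qed.
Lemma pactNl v L : pact (- L) v = - pact L v.
Proof. exact: (linearN (pactr v)). Qed.
Lemma pactZl v k L : pact (k *: L) v = k *: pact L v.
Proof. exact: (linearZ_LR (pactr v)). Qed.

Lemma pmul_linearl N : linear (fun L => pmul L N).
Proof. exact: (conv_is_linearl N mulm_bilin). Qed.

Lemma pactM L N v : pact (pmul L N) v = pact L (pact N v).
Proof.
apply: convA; [exact: actm_bilin|exact: actm_bilin|].
move=> p q f h x; rewrite /actm /mulm.
by rewrite conjgM lfunE/= conjgK addbC.
Qed.

Lemma pmulA L N P : pmul (pmul L N) P = pmul L (pmul N P).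
Proof.
apply: convA; [exact: mulm_bilin|exact: mulm_bilin|].
move=> p q f h x; rewrite /mulm.
by rewrite conjgM conjgK comp_lfunA addbC.
Qed.

Definition pone : ext n 'End(V) := etens (eone n K) \1%VF.

Lemma pone0 I : I != finset.set0 -> pone I = 0.
Proof. by move=> I0; rewrite !ffunE (negbTE I0) scale0r. Qed.

Lemma poneE : pone finset.set0 = \1%VF.
Proof. by rewrite !ffunE eqxx scale1r. Qed.

Lemma pmul1l L : pmul pone L = L.
Proof.
apply/ffunP => S; rewrite /pmul (conv_degl mulm_bilin _ _ pone0).
by rewrite poneE /mulm conjg1 comp_lfun1l.
Qed.

Lemma pmul1r L : pmul L pone = L.
Proof.
apply/ffunP => S; rewrite /pmul (conv_degr mulm_bilin _ _ pone0).
by rewrite poneE /mulm comp_lfun1r.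
Qed.

Lemma pact1 v : pact pone v = v.
Proof.
apply/ffunP => S; rewrite /pact (conv_degl actm_bilin _ _ pone0).
by rewrite poneE /actm conjg1 lfunE.
Qed.

(** Arguments of form degree 0 recover the coefficients of L, so that L is
    determined by its action. *)
Lemma pact_etens1 L x S : pact L (etens (eone n K) x) S = L S x.
Proof.
rewrite /pact (conv_degr actm_bilin) => [|I I0].
  by rewrite !ffunE eqxx scale1r.
by rewrite !ffunE (negbTE I0) scale0r.
Qed.

Definition piota (a : ext n K^o) : ext n 'End(V) := [ffun S => (a S : K) *: \1%VF].

Lemma pact_iota a v : pact (piota a) v = wedge a v.
Proof.
rewrite wedgeE; apply/ffunP => S; rewrite !ffunE; apply: eq_bigr => I _.
by rewrite /actm ffunE linearZ/= conjg1 lfunE/= lfunE.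
Qed.

(** The total degree involution on endomorphism-valued forms. *)
Definition psig L : ext n 'End(V) :=
  [ffun S : {set 'I_n} => (-1) ^+ #|S| *: conjg true (L S)].

Definition psgn v : ext n V := [ffun S : {set 'I_n} => (-1) ^+ #|S| *: g (v S)].

Lemma psig_linear : linear psig.
Proof.
move=> k L N; apply/ffunP => S; rewrite !ffunE linearP/= scalerDr !scalerA.
by rewrite mulrC.
Qed.

Lemma psgn_linear : linear psgn.
Proof.
move=> k L N; apply/ffunP => S; rewrite !ffunE linearP/= scalerDr !scalerA.
by rewrite mulrC.
Qed.

HB.instance Definition _ :=
  GRing.isLinear.Build K (ext n 'End(V)) (ext n 'End(V)) _ psig psig_linear.
HB.instance Definition _ :=
  GRing.isLinear.Build K (ext n V) (ext n V) _ psgn psgn_linear.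

Lemma psigK L : psig (psig L) = L.
Proof.
apply/ffunP => S; rewrite ffunE [psig L S]ffunE linearZ scalerA.
by rewrite -[X in _ *: X]/(conjg true (conjg true (L S))) conjgK -expr2 sqrr_sign scale1r.
Qed.

Lemma psgnK v : psgn (psgn v) = v.
Proof.
apply/ffunP => S; rewrite ffunE [psgn v S]ffunE linearZ scalerA.
by rewrite -expr2 sqrr_sign scale1r -[LHS]/(g (g (v S))) -comp_lfunE gg lfunE.
Qed.

Lemma card_setD_sub I S : I \subset S -> (#|I| + #|S :\: I|%SET = #|S|)%N.
Proof. by move=> IS; rewrite cardsD (finset.setIidPr IS) subnKC// subset_leq_card. Qed.

Lemma pact_sig L v : pact (psig L) v = psgn (pact L (psgn v)).
Proof.
apply/ffunP => S; rewrite !ffunE linear_sum scaler_sumr; apply: eq_bigr => I IS.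
rewrite !ffunE linearZ/= scalerA mulrC -scalerA; congr (_ *: _).
rewrite /actm !linearZ/= lfunE/= scalerA -(card_setD_sub IS) exprD.
rewrite mulrCA -expr2 sqrr_sign mulr1; congr (_ *: _).
have gK x : g (g x) = x by rewrite -comp_lfunE gg lfunE.
by case: (odd _); rewrite /= !lfunE/= ?lfunE/= ?gK ?lfunE/= ?gK// !lfunE/= ?gK.
Qed.

(** Moving a form of degree k past L costs (-1)^(k |L|), that is, k applications of
    the degree involution to L. *)
Lemma psig_hom_comm L k (a : ext n K^o) : hom_deg k a ->
  pmul L (piota a) = pmul (piota a) (iter k psig L).
Proof.
move=> ha; apply/ffunP => S; rewrite !ffunE.
have DD I : I \subset S -> (S :\: (S :\: I) = I)%SET.
  by move=> IS; rewrite finset.setDDr finset.setDv finset.set0U (finset.setIidPr IS).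
rewrite [in RHS](reindex_onto (fun I => S :\: I)%SET (fun I => S :\: I)%SET)/=;
  last exact: DD.
apply: eq_big => [I|I IS].
  rewrite finset.subsetDl/= finset.setDDr finset.setDv finset.set0U.
  by apply/idP/eqP => /finset.setIidPr.
rewrite DD// /mulm !ffunE !linearZ/= -comp_lfunZr comp_lfun1r.
rewrite conjg1 -comp_lfunZl comp_lfun1l.
have [SIl|SIl] := eqVneq #|S :\: I|%SET k; last by rewrite ha// !(scale0r, scaler0).
have iterE : iter k psig L I = (-1) ^+ (k * #|I|) *: conjg (odd k) (L I).
  elim: (k) => [|j IH]; first by rewrite mul0n scale1r.
  rewrite iterS ffunE IH linearZ scalerA -exprD mulSn; congr (_ *: _).
  exact: conjgK.
rewrite iterE SIl !scalerA; congr (_ *: _).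
have dI : [disjoint I & S :\: I]%SET.
  by rewrite disjoint_sym finset.disjoints_subset finset.setDE finset.subsetIr.
have := inversionsC dI; rewrite SIl mulnC => <-.
rewrite exprD; set s := (-1) ^+ inversions I _; set t := (-1) ^+ inversions _ I.
have e : t * t = 1 by rewrite -expr2 sqrr_sign.
set x : K := a _.
by transitivity (s * (t * t) * x); [rewrite e mulr1|ring].
Qed.

Variable tr : {linear 'End(V) -> K^o}.
Hypothesis trC : forall f h, tr (f \o h)%VF = tr (h \o f)%VF.

Definition pstr L : ext n K^o := [ffun S => tr (g \o L S)%VF].

(** The supertrace vanishes on supercommutators: exchanging the two factors costs
    the sign (-1)^(#|I| * #|J|) between form parts, and cyclicity of the trace
    accounts for the remaining signs. *)
Lemma pstr_supercomm (p : bool) L N : psig L = (-1) ^+ p *: L ->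
  pstr (pmul L N) = pstr (pmul (iter p psig N) L).
Proof.
move=> sL.
have conjL I q : conjg q (L I) = (-1) ^+ (q * (p + #|I|))%N *: L I.
  case: q; last by rewrite mul0n scale1r.
  have /ffunP/(_ I) := sL; rewrite !ffunE => /(congr1 (GRing.scale ((-1) ^+ #|I|))).
  by rewrite scalerA -expr2 sqrr_sign scale1r scalerA mul1n addnC exprD => <-.
have DD S I : I \subset S -> (S :\: (S :\: I) = I)%SET.
  by move=> IS; rewrite finset.setDDr finset.setDv finset.set0U (finset.setIidPr IS).
apply/ffunP => S; rewrite !ffunE.
have lin (X : {set 'I_n} -> K) (Y : {set 'I_n} -> 'End(V)) :
    tr (g \o \sum_(I : {set 'I_n} | I \subset S) X I *: Y I)%VF =
    \sum_(I : {set 'I_n} | I \subset S) X I *: tr (g \o Y I)%VF.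
  have gl : linear (fun f : 'End(V) => tr (g \o f)%VF).
    by move=> k f h; rewrite comp_lfunDr -comp_lfunZr linearP.
  pose fl := GRing.isLinear.Build K 'End(V) K^o _ _ gl.
  pose F : {linear 'End(V) -> K^o} := HB.pack (fun f => tr (g \o f)%VF) fl.
  by rewrite -[LHS]/(F _) linear_sum; apply: eq_bigr => I _; rewrite linearZ.
rewrite !lin [RHS](reindex_onto (fun I => S :\: I)%SET (fun I => S :\: I)%SET)/=;
  last exact: DD.
apply: eq_big => [I|I IS].
  rewrite finset.subsetDl/= finset.setDDr finset.setDv finset.set0U.
  by apply/idP/eqP => /finset.setIidPr.
rewrite DD// /mulm.
set J := (S :\: I)%SET.
have iterE : iter p psig N J = (-1) ^+ (p * #|J|) *: conjg p (N J).
  by case: (p) => /=; rewrite ?ffunE ?mul1n// mul0n scale1r.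
rewrite iterE linearZ/= conjgK conjL.
rewrite -!comp_lfunZl -!comp_lfunZr !linearZ/= !scalerA.
set q := odd #|I| (+) p.
(* cyclicity moves the conjugation from N J to L I, where it is a sign *)
have key : tr (g \o (conjg q (N J) \o L I))%VF = tr (g \o (L I \o N J))%VF.
  have gc f : tr (g \o conjg q f)%VF = tr (g \o f)%VF.
    case: q => //=; rewrite comp_lfunA trC !comp_lfunA.
    by rewrite gg comp_lfun1l.
  have -> : (conjg q (N J) \o L I = conjg q (N J \o conjg q (L I)))%VF.
    by rewrite conjgM conjgK addbb.
  have sq : odd (q * (p + #|I|)) = q by rewrite oddM oddD oddb /q addbC oddb andbb.
  rewrite gc conjL -signr_odd sq -comp_lfunZr -comp_lfunZr linearZ/=.
  rewrite comp_lfunA trC comp_lfunA.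
  have -> : (L I \o g = g \o conjg true (L I))%VF.
    by rewrite /= !comp_lfunA gg comp_lfun1l.
  rewrite conjL mul1n -comp_lfunZr -comp_lfunZl linearZ/= scalerA -comp_lfunA.
  rewrite -[X in _ * X]signr_odd oddD oddb addbC -/q -expr2 sqrr_sign.
  by rewrite scale1r.
rewrite key; congr (_ *: _).
have dI : [disjoint I & J]%SET.
  by rewrite disjoint_sym /J finset.disjoints_subset finset.setDE finset.subsetIr.
rewrite -!exprD -signr_odd -[RHS]signr_odd; congr (_ ^+ nat_of_bool _).
have := congr1 odd (inversionsC dI).
rewrite !oddD !oddM oddD !oddb.
by case: (odd _) (odd _) (odd _) (odd _) p {sL conjL iterE q key} => [] [] [] [] [].
Qed.

End GradedEndomorphisms.

(** * Smooth functions on open sets of a coordinate space *)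

Local Open Scope classical_set_scope.

Section CnCalculus.
Variables (R : realType) (n : nat).
Implicit Types (U V : set 'rV[R]_n) (f g : 'rV[R]_n -> R).
Local Notation del j := (delta_mx 0 j : 'rV[R]_n).

Lemma Cn_sub k U V g : U `<=` V -> Cn k V g -> Cn k U g.
Proof.
move=> UV; elim: k g => [|k IH] g /=; first by move=> h p /UV; exact: h.
by move=> [h1 h2]; split=> [p /UV|j]; [exact: h1|apply: IH].
Qed.

Lemma Cn_pointwise k U g : (forall p, U p -> Cn k [set p] g) -> Cn k U g.
Proof.
elim: k g => [|k IH] g /=; first by move=> h p Up; apply: h Up _ _.
move=> h; split=> [p Up|j]; first by have [+ _] := h p Up; apply.
by apply: IH => p Up; have [_] := h p Up; apply.
Qed.

Lemma Cn_le k U g : Cn k.+1 U g -> Cn k U g.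
Proof.
elim: k g => [|k IH] g /= [h1 h2].
  by move=> p Up; apply: differentiable_continuous; exact: h1.
by split=> // j; apply: IH; exact: h2.
Qed.

Lemma eq_on_nbhs U f g p : open U -> U p -> {in U, f =1 g} ->
  \forall q \near p, f q = g q.
Proof.
move=> oU Up fg; near=> q; apply: fg; rewrite inE.
by near: q; exact: open_nbhs_nbhs.
Unshelve. all: by end_near. Qed.

Lemma derive_eq_on U f g v : open U -> {in U, f =1 g} ->
  {in U, 'D_v f =1 'D_v g}.
Proof.
move=> oU fg p; rewrite inE => Up; apply: near_eq_derive.
exact: (eq_on_nbhs oU).
Qed.

Lemma differentiable_eq_on U f g p : open U -> U p -> {in U, f =1 g} ->
  differentiable f p -> differentiable g p.
Proof.
move=> oU Up fg df.
have fgp : f p = g p by apply: fg; rewrite inE.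
apply/diff_locallyP; have /diff_locallyP[c e] := df.
have near0 : \forall h \near (0 : 'rV[R]_n), f (h + p) = g (h + p).
  have := eq_on_nbhs oU Up fg.
  by rewrite (near_shift 0 p); apply: filterS => h /=; rewrite subr0.
have dE : 'd g p = 'd f p :> (_ -> _).
  apply: (diff_unique c); rewrite -fgp; apply/eqaddoP => _/posnumP[eps].
  have /eqaddoP/(_ _ [gt0 of eps%:num]) := e.
  apply: filter_app; apply: filterS near0 => h /= hE.
  by rewrite !fctE/= hE.
split; first by rewrite dE.
rewrite -fgp dE; apply/eqaddoP => _/posnumP[eps].
have /eqaddoP/(_ _ [gt0 of eps%:num]) := e.
apply: filter_app; apply: filterS near0 => h /= hE.
by rewrite !fctE/= hE.
Qed.

(** Induction on k: two functions that agree on an open set also have the same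
    derivatives there. *)
Lemma Cn_eq_on k U f g : open U -> {in U, f =1 g} -> Cn k U f -> Cn k U g.
Proof.
move=> oU; elim: k f g => [|k IH] f g fg /=.
  move=> h p Up; have cf : f q @[q --> p] --> f p := h p Up.
  have e := eq_on_nbhs oU Up fg.
  have {}cf : f q @[q --> p] --> g p by rewrite -(fg p) ?inE.
  exact: cvg_trans (near_eq_cvg e) cf.
move=> [h1 h2]; split=> [p Up|j].
  exact: (differentiable_eq_on oU Up fg (h1 _ Up)).
by apply: IH (h2 j); exact: derive_eq_on.
Qed.

Lemma Cn_cst k U (c : R) : Cn k U (cst c).
Proof.
elim: k c => [|k IH] c /=; first by move=> p _; exact: cst_continuous.
split=> [p _|j]; first exact: differentiable_cst.
rewrite (_ : 'D_(del j) (cst c) = cst 0) //.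
by apply/funext => p; rewrite derive_cst.
Qed.

Lemma CnD k U f g : open U -> Cn k U f -> Cn k U g -> Cn k U (f + g).
Proof.
move=> oU; elim: k f g => [|k IH] f g /=.
  by move=> hf hg p Up; exact: continuousD (hf _ Up) (hg _ Up).
move=> [f1 f2] [g1 g2]; split=> [p Up|j]; first exact: differentiableD (f1 _ Up) (g1 _ Up).
apply: (@Cn_eq_on _ _ ('D_(del j) f + 'D_(del j) g)) => //.
  move=> p; rewrite inE => Up; rewrite deriveD//; apply: diff_derivable;
    [exact: f1|exact: g1].
by apply: IH.
Qed.

Lemma CnM k U f g : open U -> Cn k U f -> Cn k U g -> Cn k U (f * g).
Proof.
move=> oU; elim: k f g => [|k IH] f g.
  by move=> hf hg p Up; exact: continuousM (hf _ Up) (hg _ Up).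
move=> hf hg; have [f1 f2] := hf; have [g1 g2] := hg.
split=> [p Up|j]; first exact: differentiableM (f1 _ Up) (g1 _ Up).
apply: (@Cn_eq_on _ _ (f * 'D_(del j) g + g * 'D_(del j) f)) => //.
  by move=> p; rewrite inE => Up; rewrite deriveM//; apply: diff_derivable;
    [exact: f1|exact: g1].
by apply: CnD => //; apply: IH; [exact: Cn_le hf|exact: g2|exact: Cn_le hg|exact: f2].
Qed.

(** Induction on k, as the derivative of 1 / f is - f' / f^2. *)
Lemma CnV k U f : open U -> (forall p, U p -> f p != 0) -> Cn k U f ->
  Cn k U (fun p => (f p)^-1).
Proof.
move=> oU f0; elim: k f f0 => [|k IH] f f0.
  by move=> hf p Up; exact: continuousV (f0 _ Up) (hf _ Up).
move=> hf; have [f1 f2] := hf.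
split=> [p Up|j]; first exact: differentiableV (f1 _ Up) (f0 _ Up).
pose g p := (f p)^-1.
apply: (@Cn_eq_on _ _ (cst (-1) * (g * g * 'D_(del j) f))) => //.
  move=> p; rewrite inE => Up; rewrite deriveV//; last exact/diff_derivable/f1.
    by rewrite !fctE /g /GRing.scale/= expr2 invfM; ring.
  exact: f0.
apply: CnM => //; first exact: Cn_cst.
have hg : Cn k U g by apply: IH => //; exact: Cn_le hf.
by apply: CnM => //; [exact: CnM|exact: f2].
Qed.

Lemma Cn_coord k U (j : 'I_n) : Cn k U (fun p => p 0 j).
Proof.
have dc (p : 'rV[R]_n) : differentiable (fun p : 'rV[R]_n => p 0 j : R) p.
  exact: differentiable_coord.
have D i : 'D_(del i) (fun p : 'rV[R]_n => p 0 j : R) = cst ((j == i)%:R).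
  apply/funext => p; rewrite deriveE// -[cst _ p]/(_%:R).
  have /(congr1 (fun F : 'rV[R]_n -> R => F (del i))) :
    'd (fun p : 'rV[R]_n => p 0 j : R) p = (fun p => p 0 j) :> (_ -> _).
    have @F : {linear 'rV[R]_n -> R}.
      by exists (fun N : 'rV[R]_n => N 0 j); do 2![eexists]; do ?[constructor];
        rewrite ?mxE// => ? *; rewrite ?mxE//; move=> ?; rewrite !mxE.
    exact: (@diff_lin R _ _ F p (@coord_continuous _ _ _ 0 j)).
  by move=> ->; rewrite mxE eqxx.
case: k => [|k]/=; first by move=> p _; exact: coord_continuous.
by split=> // i; rewrite D; exact: Cn_cst.
Qed.

End CnCalculus.

(** * The chain rule and the symmetry of second derivatives *)

Section ChainRule.
Variables (R : realType) (n : nat).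
Local Notation del j := (delta_mx 0 j : 'rV[R]__).

Lemma rV_sum_coord m (h : 'rV[R]_n -> 'rV[R]_m) :
  h = (fun p => \sum_a h p 0 a *: delta_mx 0 a).
Proof. by apply/funext => p; rewrite [LHS]row_sum_delta. Qed.

Lemma differentiable_coords m (h : 'rV[R]_n -> 'rV[R]_m) p :
  (forall a, differentiable (fun q => h q 0 a : R) p) -> differentiable h p.
Proof.
move=> hd; rewrite (rV_sum_coord h).
rewrite (_ : (fun p => _) =
  \sum_a ((fun p => h p 0 a *: (delta_mx 0 a : 'rV[R]_m)) : 'rV[R]_n -> 'rV[R]_m)).
  by apply: differentiable_sum => a; exact: differentiableZl.
by apply/funext => q; rewrite fct_sumE.
Qed.

Lemma derive_coord m (h : 'rV[R]_n -> 'rV[R]_m) p v a :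
  differentiable h p -> ('D_v h p) 0 a = 'D_v (fun q => h q 0 a : R) p.
Proof. by move=> hd; rewrite derive_mx ?mxE//; exact: diff_derivable. Qed.

Lemma derive_chain m (h : 'rV[R]_n -> 'rV[R]_m) (g : 'rV[R]_m -> R) p v :
  (forall a, differentiable (fun q => h q 0 a : R) p) ->
  differentiable g (h p) ->
  'D_v (g \o h) p = \sum_a 'D_v (fun q => h q 0 a : R) p * 'D_(del a) g (h p).
Proof.
move=> hd gd; have dh := differentiable_coords hd.
rewrite deriveE; last exact: differentiable_comp.
rewrite diff_comp//= -(deriveE v dh) [in LHS](row_sum_delta ('D_v h p)) linear_sum.
apply: eq_bigr => a _; rewrite linearZ/= derive_coord//.
by rewrite [in RHS](deriveE _ gd).
Qed.

(** Induction on k: by the chain rule, the derivatives of the composite are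
    combinations of derivatives of h and of composites of h with derivatives of g.
    *)
Lemma Cn_comp m k (U : set 'rV[R]_n) (V : set 'rV[R]_m)
    (h : 'rV[R]_n -> 'rV[R]_m) (g : 'rV[R]_m -> R) :
  open U -> (forall p, U p -> V (h p)) ->
  (forall a, Cn k U (fun p => h p 0 a)) -> Cn k V g -> Cn k U (g \o h).
Proof.
move=> oU UV; elim: k g => [|k IH] g hC gC.
  move=> p Up; apply: continuous_comp; last exact: gC (UV _ Up).
  rewrite (rV_sum_coord h).
  rewrite (_ : (fun p => _) =
    \sum_a ((fun p => h p 0 a *: (delta_mx 0 a : 'rV[R]_m)) : 'rV[R]_n -> 'rV[R]_m)).
    elim/big_ind : _ => [|f1 f2 c1 c2|a _]; first exact: cst_continuous.
      exact: continuousD.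
    exact: cvgZl (hC a _ Up).
  by apply/funext => q; rewrite fct_sumE.
have hd a p : U p -> differentiable (fun q => h q 0 a : R) p.
  by move=> Up; have [d _] := hC a; exact: d.
have [gd gD] := gC.
split=> [p Up|j].
  apply: differentiable_comp; last exact: gd (UV _ Up).
  by apply: differentiable_coords => a; exact: hd.
have hCk a : Cn k U (fun p => h p 0 a) by apply: Cn_le; exact: hC.
pose F a : 'rV[R]_n -> R := 'D_(del j) (fun q => h q 0 a : R) * ('D_(del a) g \o h).
apply: (@Cn_eq_on _ _ _ _ (\sum_a F a)) => //.
  move=> p; rewrite inE => Up; rewrite fct_sumE derive_chain//; first by move=> a; exact: hd.
  exact: gd (UV _ Up).
elim/big_ind : _ => [|f1 f2 c1 c2|a _]; first exact: Cn_cst.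
  exact: CnD.
apply: CnM => //; first by have [_] := hC a; apply.
by apply: IH => //; exact: gD.
Qed.

End ChainRule.

Lemma squeeze_quotients (R : realFieldType) (A B C D X Y e h : R) :
  `|A - B - (C - D) - X * h * h| <= e / 2 * h * h ->
  `|A - C - (B - D) - Y * h * h| <= e / 2 * h * h ->
  `|(X - Y) * h * h| <= e * h * h.
Proof.
by rewrite !ler_norml => /andP[? ?] /andP[? ?]; apply/andP; split; lra.
Qed.

Section Schwarz.
Variables (R : realType) (n : nat).
Implicit Types (g : 'rV[R]_n -> R) (p u v : 'rV[R]_n).

Lemma is_derive_line g a u (s : R) : differentiable g (a + s *: u) ->
  is_derive s 1 (fun s => g (a + s *: u)) ('D_u g (a + s *: u)).
Proof.
move=> gd.
have [ld lE] : is_diff s (fun s : R => a + s *: u) (0 + (fun r : R => r *: u)).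
  exact: (is_diffD (is_diff_cst a s) (is_diff_scalel s u)).
have cd : differentiable (g \o (fun s : R => a + s *: u)) s.
  exact: differentiable_comp.
apply: DeriveDef; first exact: diff_derivable.
rewrite [LHS](deriveE _ cd) diff_comp//= lE -[(0 + _) _]/(0 + 1 *: u) add0r scale1r.
by rewrite deriveE.
Qed.

(** The mean value theorem in the direction u for the increment of g in the
    direction v, then in the direction v. *)
Lemma second_difference g p u v (W : set 'rV[R]_n) (h : R) : 0 < h ->
  (forall q, W q -> differentiable g q) ->
  (forall q, W q -> differentiable ('D_u g) q) ->
  (forall s r, 0 <= s <= h -> 0 <= r <= h -> W (p + s *: u + r *: v)) ->
  exists s r, [/\ 0 <= s <= h, 0 <= r <= h &
    g (p + h *: u + h *: v) - g (p + h *: u) - (g (p + h *: v) - g p) =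
    'D_v ('D_u g) (p + s *: u + r *: v) * h * h].
Proof.
move=> h0 gd gud hW.
pose phi s := g (p + h *: v + s *: u) - g (p + s *: u).
pose dphi s := 'D_u g (p + h *: v + s *: u) - 'D_u g (p + s *: u).
have inW1 s : 0 <= s <= h -> W (p + h *: v + s *: u).
  by move=> sh; rewrite addrAC; apply: hW => //; rewrite lexx ltW.
have inW0 s : 0 <= s <= h -> W (p + s *: u).
  by move=> sh; have := hW s 0 sh; rewrite scale0r addr0; apply; rewrite lexx ltW.
have phid s : 0 <= s <= h -> is_derive s 1 phi (dphi s).
  move=> sh; apply: is_deriveB; apply: is_derive_line; apply: gd.
    exact: inW1.
  exact: inW0.
have [s sh] : exists2 s, s \in `]0, h[%R & phi h - phi 0 = dphi s * (h - 0).
  apply: MVT => // [s|].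
    by rewrite in_itv/= => /andP[s0 sh]; apply: phid; rewrite !ltW.
  apply: derivable_within_continuous => s; rewrite in_itv/= => sh.
  by have [] := phid _ sh.
move: (sh); rewrite in_itv/= => /andP[s0 s1].
have {}sh : 0 <= s <= h by rewrite !ltW.
rewrite subr0 /phi !scale0r !addr0 => phiE.
pose psi r := 'D_u g (p + s *: u + r *: v).
have psid r : 0 <= r <= h -> is_derive r 1 psi ('D_v ('D_u g) (p + s *: u + r *: v)).
  by move=> rh; apply: is_derive_line; apply: gud; exact: hW.
have [r rh] : exists2 r, r \in `]0, h[%R &
    psi h - psi 0 = 'D_v ('D_u g) (p + s *: u + r *: v) * (h - 0).
  apply: (@MVT _ psi (fun r => 'D_v ('D_u g) (p + s *: u + r *: v)) 0 h h0) => [r|].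
    by rewrite in_itv/= => /andP[r0 r1]; apply: psid; rewrite !ltW.
  apply: derivable_within_continuous => r; rewrite in_itv/= => rh.
  by have [] := psid _ rh.
move: rh; rewrite in_itv/= => /andP[r0 r1].
rewrite subr0 /psi scale0r addr0 => psiE.
exists s, r; rewrite !ltW//; split=> //.
by rewrite -psiE (addrAC p (s *: u)) (addrAC p (h *: u)) -phiE.
Qed.

(** The second difference divided by h^2 tends to the second derivative, by
    continuity of the latter at p. *)
Lemma second_difference_lim g p u v (U : set 'rV[R]_n) : open U -> U p ->
  (forall q, U q -> differentiable g q) ->
  (forall q, U q -> differentiable ('D_u g) q) ->
  {for p, continuous ('D_v ('D_u g))} ->
  forall e, 0 < e -> \forall h \near (0 : R)^'+,
   `|g (p + h *: u + h *: v) - g (p + h *: u) - (g (p + h *: v) - g p) -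
     'D_v ('D_u g) p * h * h| <= e * h * h.
Proof.
move=> oU Up gd gud c e e0.
have : \forall q \near p, U q /\ `|'D_v ('D_u g) q - 'D_v ('D_u g) p| <= e.
  near=> q; split; first by near: q; exact: open_nbhs_nbhs.
  rewrite distrC; near: q.
  by move/cvgrPdist_le : c; apply.
move=> /nbhs_ballP[d /= d0 dW].
pose N := `|u| + `|v| + 1.
have N0 : 0 < N by rewrite ltr_wpDl// addr_ge0.
near=> h.
have h0 : 0 < h by near: h; exact: nbhs_right_gt.
have hd : h < d / N by near: h; apply: nbhs_right_lt; rewrite divr_gt0.
have inB s r : 0 <= s <= h -> 0 <= r <= h -> ball p d (p + s *: u + r *: v).
  move=> /andP[s0 sh] /andP[r0 rh]; rewrite -ball_normE/=.
  rewrite -addrA opprD addNKr normrN.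
  apply: (le_lt_trans (ler_normD _ _)); rewrite !normrZ !ger0_norm//.
  apply: (@le_lt_trans _ _ (h * N)); last by rewrite -ltr_pdivlMr.
  rewrite /N !mulrDr mulr1.
  have := ler_wpM2r (normr_ge0 u) sh; have := ler_wpM2r (normr_ge0 v) rh.
  by have := ltW h0; lra.
have [s [r [sh rh ->]]] := @second_difference g p u v (ball p d) h h0
  (fun q hq => gd q (dW q hq).1) (fun q hq => gud q (dW q hq).1) inB.
rewrite -!mulrBl !normrM (gtr0_norm h0) !ler_pM2r//.
exact: (dW _ (inB _ _ sh rh)).2.
Unshelve. all: by end_near. Qed.

(** The second difference is symmetric in u and v, so both mixed derivatives are
    limits of the same quotient. *)
Lemma derive_sym g p u v (U : set 'rV[R]_n) : open U -> U p ->
  (forall q, U q -> differentiable g q) ->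
  (forall q, U q -> differentiable ('D_u g) q) ->
  (forall q, U q -> differentiable ('D_v g) q) ->
  {for p, continuous ('D_v ('D_u g))} ->
  {for p, continuous ('D_u ('D_v g))} ->
  'D_v ('D_u g) p = 'D_u ('D_v g) p.
Proof.
move=> oU Up gd gud gvd cuv cvu.
apply/eqP; rewrite -subr_eq0 -normr_le0; apply/ler_addgt0Pl => e e0.
rewrite addr0; have e20 : 0 < e / 2 by rewrite divr_gt0.
have n1 := second_difference_lim oU Up gd gud cuv e20.
have n2 := second_difference_lim oU Up gd gvd cvu e20.
have [h [h0 [H1 H2]]] := filter_ex (filterI (nbhs_right_gt (0 : R)) (filterI n1 n2)).
move: H2; rewrite (addrAC p) => H2.
rewrite -(ler_pM2r h0) -(ler_pM2r h0).
apply: le_trans (squeeze_quotients H1 H2).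
by rewrite !normrM (gtr0_norm h0).
Qed.

End Schwarz.

(** * Bump functions *)

Section FlatFunction.
Variable R : realType.

(** The factors x^-m close the family under differentiation, so that the smoothness
    of exp (-1/x) at 0 follows by induction from one derivative computation. *)
Definition flat (m : nat) (x : R) : R :=
  if 0 < x then x^-1 ^+ m * expR (- x^-1) else 0.

Lemma flat_le0 m x : x <= 0 -> flat m x = 0.
Proof. by move=> x0; rewrite /flat ltNge x0. Qed.

Lemma flat_ge0 m x : 0 <= flat m x.
Proof.
rewrite /flat; case: ifP => // x0.
by rewrite mulr_ge0 ?expR_ge0// exprn_ge0// invr_ge0 ltW.
Qed.

Lemma flat_gt0 m x : 0 < x -> 0 < flat m x.
Proof. by move=> x0; rewrite /flat x0 mulr_gt0 ?expR_gt0// exprn_gt0// invr_gt0. Qed.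

(** The exponential series of 1/x dominates its term of order m + 2. The bound by
    x^2 gives derivative 0 at the origin. *)
Lemma flat_bound m x : 0 < x -> flat m x <= (m.+2)`!%:R * x ^+ 2.
Proof.
move=> x0; rewrite /flat x0; have y0 : 0 < x^-1 by rewrite invr_gt0.
have := expR_ge1Dxn m.+1 (ltW y0).
have f0 : 0 < ((m.+2)`!)%:R :> R by rewrite ltr0n fact_gt0.
move=> h; have {h} : x^-1 ^+ m.+2 <= (m.+2)`!%:R * expR x^-1.
  rewrite -ler_pdivrMl// mulrC; apply: le_trans h.
  by rewrite lerDr ler01.
rewrite expRN => h; rewrite ler_pdivrMr ?expR_gt0//.
rewrite (_ : x^-1 ^+ m = x^-1 ^+ m.+2 * x ^+ 2); last first.
  by rewrite -addn2 exprD -mulrA -exprMn mulVf ?gt_eqF// expr1n mulr1.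
by rewrite [leRHS]mulrAC ler_pM2r// exprn_gt0.
Qed.

Lemma is_derive_flat (m : nat) (x : R) :
  is_derive x 1 (flat m) (- m%:R * flat m.+1 x + flat m.+2 x).
Proof.
have [x0|x0|->] := ltgtP x 0.
- rewrite !flat_le0 ?ltW// mulr0 addr0.
  apply: (@near_eq_is_derive _ _ _ (cst 0)) => //.
  near=> y; rewrite flat_le0//; apply: ltW; near: y.
  exact: lt_nbhsl.
- apply: (@near_eq_is_derive _ _ _ (fun x : R => x^-1 ^+ m * expR (- x^-1) : R)).
    near=> y; rewrite /flat ifT//; near: y; exact: lt_nbhsr.
  have xn0 : x != 0 by rewrite gt_eqF.
  have dV : is_derive x 1 (fun x : R => x^-1) (- x ^- 2).
    have := @is_deriveV R id x 1 1 xn0 (is_derive_id x 1).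
    by rewrite /GRing.scale/= mulr1.
  have dX : is_derive x 1 (fun x : R => x^-1 ^+ m) ((m%:R * x^-1 ^+ m.-1) *: - x ^- 2).
    have -> : (fun x : R => x^-1 ^+ m) = (fun x : R => x^-1) ^+ m.
      by apply/funext => y; rewrite fctE.
    exact: is_deriveX.
  have dE : is_derive x 1 (fun x : R => expR (- x^-1)) (x ^- 2 * expR (- x^-1)).
    have dN : is_derive x 1 (fun x : R => - x^-1) (x ^- 2).
      by have := is_deriveN dV; rewrite opprK.
    have := @is_derive1_comp R expR (fun x : R => - x^-1) x _ _ (is_derive_expR _) dN.
    by rewrite /GRing.scale/= mulrC.
  have D : is_derive x 1 (fun x : R => x^-1 ^+ m * expR (- x^-1)) _ := is_deriveM dX dE.
  apply: (is_derive_eq D).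
  rewrite /flat x0 /GRing.scale/= -!exprVn.
  case: (m) => [|k] /=; rewrite ?exprS ?expr0; ring.
- rewrite !flat_le0// mulr0 addr0.
  have lim0 : h^-1 *: (flat m (h *: 1 + 0) - flat m 0) @[h --> 0^'] --> (0 : R).
    apply: (@cvg_to_0_linear _ _ (m.+2)`!%:R 1) => // h /andP[hn0 _].
    rewrite addr0 [h *: 1]mulr1 [flat m 0]flat_le0// subr0.
    have [h0|h0] := ltP 0 h; last by rewrite flat_le0// scaler0 normr0 mulr_ge0.
    rewrite !ger0_norm ?(ltW h0)//; last by rewrite mulr_ge0 ?invr_ge0 ?(ltW h0) ?flat_ge0.
    rewrite [leLHS]mulrC ler_pdivrMr//.
    by apply: (le_trans (flat_bound m h0)); rewrite expr2 mulrA.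
  apply: DeriveDef; first by apply/cvg_ex; exists 0.
  exact: cvg_lim lim0.
Unshelve. all: by end_near. Qed.

Lemma Cn_flat n k m (U : set 'rV[R]_n) (q : 'rV[R]_n -> R) : open U ->
  Coo U q -> Cn k U (flat m \o q).
Proof.
move=> oU qC; elim: k m => [|k IH] m.
  move=> p Up; apply: continuous_comp; first exact: (qC 0 p Up).
  apply: differentiable_continuous; apply/derivable1_diffP.
  by have [] := is_derive_flat m (q p).
have qd p : U p -> differentiable q p by have [+ _] := qC 1%N; apply.
have fd p : differentiable (flat m) (q p).
  by apply/derivable1_diffP; have [] := is_derive_flat m (q p).
split=> [p Up|j]; first exact: differentiable_comp (qd _ Up) (fd p).
set v := delta_mx 0 j.
apply: (@Cn_eq_on _ _ _ _
  ((cst (- m%:R) * (flat m.+1 \o q) + (flat m.+2 \o q)) * 'D_v q)) => //.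
  move=> p; rewrite inE => Up; rewrite deriveE; last first.
    exact: differentiable_comp (qd _ Up) (fd p).
  rewrite (diff_comp (qd p Up) (fd p))/= -(deriveE v (qd p Up)).
  have /derivable1_diffP dm := fd p.
  rewrite deriv1E// derive1E; have -> := @derive_val _ _ _ _ _ _ _ (is_derive_flat m (q p)).
  by rewrite [RHS]mulrC.
apply: CnM => //; last by have [_] := qC k.+1; apply.
by apply: CnD => //; apply: CnM => //; exact: Cn_cst.
Qed.

End FlatFunction.

Section EuclideanBump.
Variables (R : realType) (n : nat) (p0 : 'rV[R]_n) (r : R).
Hypothesis r0 : 0 < r.

Definition sqdist (p : 'rV[R]_n) : R := \sum_a (p 0 a - p0 0 a) ^+ 2.

(** The quotient is a smooth step, equal to 0 for s <= 0 and to 1 for s >= 1; with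
    this s, it is 1 when the squared distance is at most r and 0 when it is at least
    2 r. *)
Definition ebump (p : 'rV[R]_n) : R :=
  let s := 2 - sqdist p / r in flat 0 s / (flat 0 s + flat 0 (1 - s)).

Lemma ebump1 p : sqdist p <= r -> ebump p = 1.
Proof.
move=> h; rewrite /ebump; set s := 2 - _.
have s1 : 1 <= s by rewrite lerBrDr -lerBrDl addrK// ler_pdivrMr// mul1r.
rewrite [flat 0 (1 - s)]flat_le0 ?subr_le0// addr0 divff// gt_eqF//.
by rewrite flat_gt0// (lt_le_trans ltr01).
Qed.

Lemma ebump0 p : 2 * r <= sqdist p -> ebump p = 0.
Proof.
move=> h; rewrite /ebump; set s := 2 - _.
by rewrite flat_le0 ?mul0r// subr_le0 ler_pdivlMr.
Qed.

Lemma sqdist_Coo (U : set 'rV[R]_n) : open U -> Coo U sqdist.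
Proof.
move=> oU k; rewrite /sqdist.
have -> : (fun p : 'rV[R]_n => \sum_a (p 0 a - p0 0 a) ^+ 2 : R) =
  \sum_a ((fun p : 'rV[R]_n => p 0 a : R) + cst (- p0 0 a)) *
         ((fun p : 'rV[R]_n => p 0 a : R) + cst (- p0 0 a)).
  by apply/funext => p; rewrite fct_sumE; apply: eq_bigr => a _; rewrite expr2.
elim/big_ind : _ => [|f1 f2 c1 c2|a _]; first exact: Cn_cst.
  exact: CnD.
by apply: CnM => //; apply: CnD => //; first [exact: Cn_coord|exact: Cn_cst].
Qed.

Lemma ebump_Coo (U : set 'rV[R]_n) : open U -> Coo U ebump.
Proof.
move=> oU k; rewrite /ebump.
pose s : 'rV[R]_n -> R := cst 2 + sqdist * cst (- r^-1).
have sC : Coo U s.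
  move=> j; apply: CnD => //; first exact: Cn_cst.
  by apply: CnM => //; [exact: sqdist_Coo|exact: Cn_cst].
have s'C : Coo U (cst 1 + s * cst (- 1)).
  move=> j; apply: CnD => //; first exact: Cn_cst.
  by apply: CnM => //; exact: Cn_cst.
have sE p : s p = 2 - sqdist p / r.
  by rewrite -[s p]/(2 + sqdist p * - r^-1) mulrN.
pose den : 'rV[R]_n -> R := (flat 0 \o s) + (flat 0 \o (cst 1 + s * cst (- 1))).
have -> : (fun p => flat 0 (2 - sqdist p / r) /
    (flat 0 (2 - sqdist p / r) + flat 0 (1 - (2 - sqdist p / r)))) =
    (flat 0 \o s) * (fun p => (den p)^-1).
  apply/funext => p; rewrite -!sE.
  rewrite -[RHS]/(flat 0 (s p) / (flat 0 (s p) + flat 0 (1 + s p * -1))).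
  by rewrite mulrN1.
apply: CnM => //; first exact: Cn_flat.
apply: CnV => // [p _|].
  rewrite -[den p]/(flat 0 (s p) + flat 0 (1 + s p * -1)) mulrN1.
  have [s0|s0] := ltP 0 (s p).
    by rewrite gt_eqF// ltr_wpDr ?flat_ge0 ?flat_gt0.
  by rewrite gt_eqF// ltr_wpDl ?flat_ge0 ?flat_gt0// subr_gt0 (le_lt_trans s0).
by apply: CnD => //; exact: Cn_flat.
Qed.

End EuclideanBump.

(** * Germs of smooth functions *)

Section Germs.
Variables (R : realType) (n : nat).
Implicit Types (p q : 'rV[R]_n) (f g : 'rV[R]_n -> R).

(** [Cn] can be asked at a single point because partial derivatives are total
    functions; asking it at all nearby points makes smoothness an open condition on
    p. *)
Definition sm p g : Prop := \forall q \near p, forall k, Cn k [set q] g.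

Lemma smP p g : sm p g <-> exists U, [/\ open U, U p & Coo U g].
Proof.
split=> [h|[U [oU Up gU]]].
  exists (interior [set q | forall k, Cn k [set q] g]); split.
  - exact: open_interior.
  - exact: h.
  - by move=> k; apply: Cn_pointwise => q /interior_subset; exact.
near=> q; move=> k; apply: Cn_sub (gU k) => _ ->; near: q.
exact: open_nbhs_nbhs.
Unshelve. all: by end_near. Qed.

Lemma sm_near p g : sm p g -> \forall q \near p, sm q g.
Proof. by move=> h; apply: near_join. Qed.

Lemma sm_Coo U g : open U -> (forall p, U p -> sm p g) <-> Coo U g.
Proof.
move=> oU; split=> [h k|h p Up]; last by apply/smP; exists U.
by apply: Cn_pointwise => p /h/nbhs_singleton; exact.
Qed.

Lemma sm_eq p f g : (\forall q \near p, f q = g q) -> sm p f -> sm p g.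
Proof.
move=> fg /smP[U [oU Up fU]].
apply/smP; exists (U `&` interior [set q | f q = g q]); split.
- by apply: openI => //; exact: open_interior.
- by split.
- move=> k; apply: (Cn_eq_on (f := f)).
  + by apply: openI => //; exact: open_interior.
  + by move=> q; rewrite inE => -[_ /interior_subset].
  + by apply: Cn_sub (fU k) => q [].
Qed.

Lemma sm_cst p (c : R) : sm p (cst c).
Proof. by apply: filterE => q k; exact: Cn_cst. Qed.

Lemma sm2 p f g : sm p f -> sm p g ->
  exists U, [/\ open U, U p, Coo U f & Coo U g].
Proof.
move=> /smP[U [oU Up fU]] /smP[V [oV Vp gV]].
exists (U `&` V); split=> //; first exact: openI.
  by move=> k; apply: Cn_sub (fU k) => q [].
by move=> k; apply: Cn_sub (gV k) => q [].
Qed.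

Lemma smD p f g : sm p f -> sm p g -> sm p (fun q => f q + g q).
Proof.
move=> hf hg; have [U [oU Up fU gU]] := sm2 hf hg; apply/smP; exists U.
by split=> // k; exact: CnD (fU k) (gU k).
Qed.

Lemma smM p f g : sm p f -> sm p g -> sm p (fun q => f q * g q).
Proof.
move=> hf hg; have [U [oU Up fU gU]] := sm2 hf hg; apply/smP; exists U.
by split=> // k; exact: CnM (fU k) (gU k).
Qed.

Lemma smN p f : sm p f -> sm p (fun q => - f q).
Proof.
move=> hf; have := smM (sm_cst p (- 1)) hf.
by apply: sm_eq; apply: filterE => q; rewrite mulN1r.
Qed.

Lemma sm_differentiable p f : sm p f -> differentiable f p.
Proof. by move=> /nbhs_singleton/(_ 1%N)[+ _]; apply. Qed.

Lemma sm_continuous p f : sm p f -> {for p, continuous f}.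
Proof. by move=> /sm_differentiable/differentiable_continuous. Qed.

Lemma sm_derive p f (j : 'I_n) : sm p f -> sm p ('D_(delta_mx 0 j) f).
Proof. by apply: filterS => q h k; have [_] := h k.+1; apply. Qed.

Lemma sm_derive_sym p f (i j : 'I_n) : sm p f ->
  'D_(delta_mx 0 i) ('D_(delta_mx 0 j) f) p =
  'D_(delta_mx 0 j) ('D_(delta_mx 0 i) f) p.
Proof.
move=> hf; have /smP[U [oU Up /sm_Coo fU]] := hf.
apply: (@derive_sym _ _ _ _ _ _ U) => //.
- by move=> q /(fU oU)/sm_differentiable.
- by move=> q /(fU oU)/(sm_derive j)/sm_differentiable.
- by move=> q /(fU oU)/(sm_derive i)/sm_differentiable.
- exact/sm_continuous/sm_derive/sm_derive.
- exact/sm_continuous/sm_derive/sm_derive.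
Qed.

End Germs.

Lemma sm_comp (R : realType) n m (p : 'rV[R]_n) (h : 'rV[R]_n -> 'rV[R]_m)
    (g : 'rV[R]_m -> R) :
  (forall a, sm p (fun q => h q 0 a)) -> sm (h p) g -> sm p (g \o h).
Proof.
move=> hs /smP[V [oV Vp gV]].
have hnear : \forall q \near p, forall a, sm q (fun q => h q 0 a).
  apply: (@filter_forall _ 'I_m (fun a q => sm q (fun q => h q 0 a)) (nbhs p)).
  by move=> a; exact: sm_near.
have hc q : (forall a, sm q (fun q => h q 0 a)) -> {for q, continuous h}.
  move=> hq; apply: differentiable_continuous; apply: differentiable_coords => a.
  exact: sm_differentiable.
have hV : \forall q \near p, V (h q).
  have : nbhs (h p) V by exact: open_nbhs_nbhs.
  exact: hc.
pose U := interior [set q | (forall a, sm q (fun q => h q 0 a)) /\ V (h q)].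
apply/smP; exists U; split.
- exact: open_interior.
- by rewrite /U /interior/=; near=> q; split; near: q.
- have oU : open U by exact: open_interior.
  move=> k; apply: (Cn_comp oU (V := V)) => //.
  + by move=> q /interior_subset[].
  + by move=> a; apply: (proj1 (sm_Coo _ oU) _ k) => q /interior_subset[].
Unshelve. all: by end_near. Qed.

Section Scalars.
Variables (R : realType) (c : bool).
Local Notation K := (scal R c).

Lemma reKD (z w : K) : reK (z + w) = reK z + reK w.
Proof. by case: c z w => [] // [a b] [a' b']. Qed.
Lemma imKD (z w : K) : imK (z + w) = imK z + imK w.
Proof. by case: c z w => [[a b] [a' b']|z w] //=; rewrite addr0. Qed.
Lemma reKN (z : K) : reK (- z) = - reK z.
Proof. by case: c z => [] // [a b]. Qed.
Lemma imKN (z : K) : imK (- z) = - imK z.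
Proof. by case: c z => [[a b]|z] //=; rewrite oppr0. Qed.
Lemma reKM (z w : K) : reK (z * w) = reK z * reK w - imK z * imK w.
Proof. by case: c z w => [[a b] [a' b']|z w] //=; rewrite mul0r subr0. Qed.
Lemma imKM (z w : K) : imK (z * w) = reK z * imK w + imK z * reK w.
Proof. by case: c z w => [[a b] [a' b']|z w] //=; rewrite mul0r mulr0 addr0. Qed.
Lemma mkKK (z : K) : mkK c (reK z) (imK z) = z.
Proof. by case: c z => [[a b]|z]. Qed.
Lemma K_ext (z w : K) : reK z = reK w -> imK z = imK w -> z = w.
Proof. by move=> h1 h2; rewrite -(mkKK z) h1 h2 mkKK. Qed.
Lemma reK_ofR (a : R) : reK (ofR c a) = a.
Proof. by rewrite /ofR; case: c. Qed.
Lemma imK_ofR (a : R) : imK (ofR c a) = 0.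
Proof. by rewrite /ofR; case: c. Qed.
Lemma reK_mkK (a b : R) : reK (mkK c a b) = a.
Proof. by case: c. Qed.
Lemma imK_mkK (a b : R) : (c = false -> b = 0) -> imK (mkK c a b) = b.
Proof. by case: c => // ->. Qed.
Lemma imK_real (z : K) : c = false -> imK z = 0.
Proof. by case: c z. Qed.
Lemma reK0 : reK (0 : K) = 0. Proof. by case: c. Qed.
Lemma imK0 : imK (0 : K) = 0. Proof. by case: c. Qed.
Lemma reK1 : reK (1 : K) = 1. Proof. by case: c. Qed.
Lemma imK1 : imK (1 : K) = 0. Proof. by case: c. Qed.

Lemma ofRD (a b : R) : ofR c (a + b) = ofR c a + ofR c b.
Proof. by apply: K_ext; rewrite ?(reKD, imKD, reK_ofR, imK_ofR) ?addr0. Qed.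
Lemma ofRM (a b : R) : ofR c (a * b) = ofR c a * ofR c b.
Proof.
by apply: K_ext; rewrite ?(reKM, imKM, reK_ofR, imK_ofR) ?(mulr0, mul0r) ?subr0 ?addr0.
Qed.
Lemma ofR0 : ofR c (0 : R) = 0.
Proof. by apply: K_ext; rewrite ?(reK_ofR, imK_ofR) ?(reK0, imK0). Qed.
Lemma ofR1 : ofR c (1 : R) = 1.
Proof. by apply: K_ext; rewrite ?(reK_ofR, imK_ofR) ?(reK1, imK1). Qed.
Lemma ofRN (a : R) : ofR c (- a) = - ofR c a.
Proof. by apply: K_ext; rewrite ?(reKN, imKN, reK_ofR, imK_ofR) ?oppr0. Qed.
Lemma ofR_bool (b : bool) : ofR c (b%:R : R) = b%:R.
Proof. by case: b; rewrite ?ofR0 ?ofR1. Qed.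
Lemma ofR_nat (k : nat) : ofR c (k%:R : R) = k%:R.
Proof. by elim: k => [|k IH]; rewrite ?ofR0// -natr1 ofRD IH ofR1 natr1. Qed.

Lemma scal2_neq0 : 2%:R != 0 :> K.
Proof.
apply/negP => /eqP/(congr1 (@reK R c)); rewrite -ofR_nat reK_ofR reK0 => /eqP.
by rewrite pnatr_eq0.
Qed.

Variable n : nat.
Implicit Types (p q : 'rV[R]_n) (f g : 'rV[R]_n -> K).

Definition smK p f := sm p (fun q => reK (f q)) /\ sm p (fun q => imK (f q)).

Lemma smK_near p f : smK p f -> \forall q \near p, smK q f.
Proof. by move=> [/sm_near h1 /sm_near h2]; near=> q; split; near: q.
Unshelve. all: by end_near. Qed.

Lemma smK_eq p f g : (\forall q \near p, f q = g q) -> smK p f -> smK p g.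
Proof.
by move=> fg [h1 h2]; split; [apply: sm_eq h1|apply: sm_eq h2];
  apply: filterS fg => q ->.
Qed.

Lemma smK_cst p (z : K) : smK p (cst z).
Proof. by split; [exact: (sm_cst p (reK z))|exact: (sm_cst p (imK z))]. Qed.

Lemma smKD p f g : smK p f -> smK p g -> smK p (fun q => f q + g q).
Proof.
move=> [f1 f2] [g1 g2]; split.
  by under eq_fun do rewrite reKD; exact: smD.
by under eq_fun do rewrite imKD; exact: smD.
Qed.

Lemma smKM p f g : smK p f -> smK p g -> smK p (fun q => f q * g q).
Proof.
move=> [f1 f2] [g1 g2]; split.
  by under eq_fun do rewrite reKM; apply: smD; [exact: smM|apply: smN; exact: smM].
by under eq_fun do rewrite imKM; apply: smD; exact: smM.
Qed.

Lemma smK_ofR p (f : 'rV[R]_n -> R) : sm p f -> smK p (fun q => ofR c (f q)).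
Proof.
move=> hf; split; first by under eq_fun do rewrite reK_ofR.
by under eq_fun do rewrite imK_ofR; exact: sm_cst.
Qed.

Lemma reK_partial (j : 'I_n) f q :
  reK (partialK j f q) = 'D_(delta_mx 0 j) (fun q => reK (f q)) q.
Proof. by rewrite /partialK reK_mkK. Qed.

Lemma imK_partial (j : 'I_n) f q :
  imK (partialK j f q) = 'D_(delta_mx 0 j) (fun q => imK (f q)) q.
Proof.
rewrite /partialK imK_mkK// => cF.
rewrite (_ : (fun q => imK (f q)) = cst 0) ?derive_cst//.
by apply/funext => y; rewrite imK_real.
Qed.

Lemma smK_partial p f (j : 'I_n) : smK p f -> smK p (partialK j f).
Proof.
move=> [h1 h2]; split.
  by under eq_fun do rewrite reK_partial; exact: sm_derive.
by under eq_fun do rewrite imK_partial; exact: sm_derive.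
Qed.

Lemma partialK_sym p f (i j : 'I_n) : smK p f ->
  partialK i (partialK j f) p = partialK j (partialK i f) p.
Proof.
move=> [h1 h2].
have reE k : (fun q => reK (partialK k f q)) = 'D_(delta_mx 0 k) (fun q => reK (f q)).
  by apply/funext => q; rewrite reK_partial.
have imE k : (fun q => imK (partialK k f q)) = 'D_(delta_mx 0 k) (fun q => imK (f q)).
  by apply/funext => q; rewrite imK_partial.
apply: K_ext.
  by rewrite [LHS]reK_partial [RHS]reK_partial (reE j) (reE i); exact: sm_derive_sym.
by rewrite [LHS]imK_partial [RHS]imK_partial (imE j) (imE i); exact: sm_derive_sym.
Qed.

Lemma partialK_eq p f g (j : 'I_n) : (\forall q \near p, f q = g q) ->
  partialK j f p = partialK j g p.
Proof.
move=> fg; apply: K_ext.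
  by rewrite 2!reK_partial; apply: near_eq_derive; apply: filterS fg => q ->.
by rewrite 2!imK_partial; apply: near_eq_derive; apply: filterS fg => q ->.
Qed.

Lemma partialK_cst p (z : K) (j : 'I_n) : partialK j (cst z) p = 0.
Proof.
apply: K_ext.
  by rewrite reK_partial reK0; exact: (derive_cst (reK z)).
by rewrite imK_partial imK0; exact: (derive_cst (imK z)).
Qed.

Lemma partialKD p f g (j : 'I_n) : smK p f -> smK p g ->
  partialK j (fun q => f q + g q) p = partialK j f p + partialK j g p.
Proof.
move=> [f1 f2] [g1 g2].
have d h : sm p h -> derivable h p (delta_mx 0 j).
  by move=> /sm_differentiable; exact: diff_derivable.
apply: K_ext.
  rewrite reKD 3!reK_partial.
  by under eq_fun do rewrite reKD; exact: deriveD (d _ f1) (d _ g1).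
rewrite imKD 3!imK_partial.
by under eq_fun do rewrite imKD; exact: deriveD (d _ f2) (d _ g2).
Qed.

Lemma partialKM p f g (j : 'I_n) : smK p f -> smK p g ->
  partialK j (fun q => f q * g q) p = partialK j f p * g p + f p * partialK j g p.
Proof.
move=> [f1 f2] [g1 g2].
have d h : sm p h -> derivable h p (delta_mx 0 j).
  by move=> /sm_differentiable; exact: diff_derivable.
have dM h k : sm p h -> sm p k -> 'D_(delta_mx 0 j) (fun q => h q * k q) p =
    h p * 'D_(delta_mx 0 j) k p + k p * 'D_(delta_mx 0 j) h p.
  by move=> hs ks; exact: deriveM (d _ hs) (d _ ks).
have dD h k : sm p h -> sm p k -> 'D_(delta_mx 0 j) (fun q => h q + k q) p =
    'D_(delta_mx 0 j) h p + 'D_(delta_mx 0 j) k p.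
  by move=> hs ks; exact: deriveD (d _ hs) (d _ ks).
have dN h : sm p h -> 'D_(delta_mx 0 j) (fun q => - h q) p =
    - 'D_(delta_mx 0 j) h p.
  by move=> hs; exact: deriveN (d _ hs).
apply: K_ext.
  rewrite reKD 2!reKM 3!reK_partial 2!imK_partial.
  under eq_fun do rewrite reKM.
  rewrite dD ?dN ?dM//; last 2 first.
  - exact: smM.
  - by apply: smN; exact: smM.
  - by ring.
  exact: smM.
rewrite imKD 2!imKM 3!imK_partial 2!reK_partial.
under eq_fun do rewrite imKM.
rewrite dD ?dM//; last 2 first.
- exact: smM.
- exact: smM.
by ring.
Qed.

End Scalars.

Lemma smK_comp (R : realType) (c : bool) n m (p : 'rV[R]_n)
    (h : 'rV[R]_n -> 'rV[R]_m) (g : 'rV[R]_m -> scal R c) :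
  (forall a, sm p (fun q => h q 0 a)) -> smK (h p) g -> smK p (g \o h).
Proof. by move=> hs [g1 g2]; split; [apply: sm_comp g1|apply: sm_comp g2]. Qed.

Lemma partialK_chain (R : realType) (c : bool) n m (p : 'rV[R]_n)
    (h : 'rV[R]_n -> 'rV[R]_m) (g : 'rV[R]_m -> scal R c) (j : 'I_n) :
  (forall a, sm p (fun q => h q 0 a)) -> smK (h p) g ->
  partialK j (g \o h) p = \sum_a partialK a g (h p) *
    ofR c ('D_(delta_mx 0 j) (fun q => h q 0 a) p).
Proof.
move=> hs [g1 g2].
have reS (F : 'I_m -> scal R c) : reK (\sum_a F a) = \sum_a reK (F a).
  exact: (big_morph _ (@reKD R c) (@reK0 R c)).
have imS (F : 'I_m -> scal R c) : imK (\sum_a F a) = \sum_a imK (F a).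
  exact: (big_morph _ (@imKD R c) (@imK0 R c)).
have chain (k : 'rV[R]_m -> R) : sm (h p) k ->
    'D_(delta_mx 0 j) (k \o h) p =
    \sum_a 'D_(delta_mx 0 j) (fun q => h q 0 a) p * 'D_(delta_mx 0 a) k (h p).
  move=> ks; apply: derive_chain => [a|]; last exact: sm_differentiable.
  exact: sm_differentiable (hs a).
apply: K_ext.
  rewrite reS reK_partial.
  rewrite (chain _ g1); apply: eq_bigr => a _.
  by rewrite reKM reK_ofR imK_ofR mulr0 subr0 reK_partial mulrC.
rewrite imS imK_partial (chain _ g2); apply: eq_bigr => a _.
by rewrite imKM reK_ofR imK_ofR mulr0 add0r imK_partial mulrC.
Qed.

(** * Calculus in charts *)

Section ManifoldCalculus.
Variables (R : realType) (c : bool) (n : nat) (M : manifold R n).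
Implicit Types (x y : M) (i : chart M) (f g : M -> scal R c).

Lemma crd_near i x (P : M -> Prop) : dom i x ->
  (\forall y \near x, P y) -> \forall p \near crd i x, P (icrd i p).
Proof.
move=> ix Px.
have c0 : {for crd i x, continuous (icrd i)} by apply: icrd_continuous; exists x.
by have := c0; rewrite /prop_for/continuous_at crdK//; apply.
Qed.

Lemma near_crd i x (P : 'rV[R]_n -> Prop) : dom i x ->
  (\forall p \near crd i x, P p) -> \forall y \near x, P (crd i y).
Proof. by move=> ix; exact: crd_continuous. Qed.

Lemma near_dom i x : dom i x -> \forall y \near x, dom i y.
Proof. by move=> ix; apply: open_nbhs_nbhs; split => //; exact: dom_open. Qed.

Lemma crd_icrd i p : (crd i @` dom i) p -> crd i (icrd i p) = p.
Proof. by move=> [x ix <-]; rewrite crdK. Qed.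

Lemma near_crd_image i x : dom i x -> \forall p \near crd i x, (crd i @` dom i) p.
Proof.
move=> ix; apply: open_nbhs_nbhs; split; first exact: crd_open.
by exists x.
Qed.

Lemma crd_image_open i (V : set M) : open V -> V `<=` dom i -> open (crd i @` V).
Proof.
move=> oV Vi; rewrite openE => _ [x Vx <-]; rewrite /interior.
have ix := Vi _ Vx.
have h1 : \forall p \near crd i x, V (icrd i p).
  by apply: crd_near => //; exact: open_nbhs_nbhs.
have h2 := near_crd_image ix.
apply: filterS2 h1 h2 => p Vp ip.
by exists (icrd i p) => //; exact: crd_icrd.
Qed.

(** [smooth_atE] shows that any other chart around x gives the same condition. *)
Definition smooth_at x f : Prop :=
  smK (crd (chart_at x) x) (fun p => f (icrd (chart_at x) p)).

Lemma sm_transition i j x (a : 'I_n) : dom i x -> dom j x ->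
  sm (crd i x) (fun p => crd j (icrd i p) 0 a).
Proof.
move=> ix jx; have oij : open (dom i `&` dom j) by apply: openI; exact: dom_open.
have := crd_smooth i j a => /sm_Coo; apply.
  by apply: crd_image_open => // y [].
by exists x.
Qed.

Lemma smooth_at_change i j x f : dom i x -> dom j x ->
  smK (crd i x) (fun p => f (icrd i p)) -> smK (crd j x) (fun p => f (icrd j p)).
Proof.
move=> ix jx fi; pose h p := crd i (icrd j p).
have hx : h (crd j x) = crd i x by rewrite /h crdK.
apply: (@smK_eq _ _ _ _ ((fun p => f (icrd i p)) \o h)).
  have := crd_near jx (near_dom ix); apply: filterS => p ip.
  by rewrite /h/= crdK.
by apply: smK_comp; [move=> a; exact: sm_transition|rewrite hx].
Qed.

Lemma smooth_atE i x f : dom i x ->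
  smooth_at x f <-> smK (crd i x) (fun p => f (icrd i p)).
Proof.
move=> ix; split; apply: smooth_at_change => //; exact: chart_atP.
Qed.

Lemma smooth_at_eq x f g : (\forall y \near x, f y = g y) ->
  smooth_at x f -> smooth_at x g.
Proof.
by move=> fg; apply: smK_eq; apply: (crd_near _ fg); exact: chart_atP.
Qed.

Lemma smooth_at_near x f : smooth_at x f -> \forall y \near x, smooth_at y f.
Proof.
move=> /smK_near/(near_crd (chart_atP x)) h.
apply: filterS2 h (near_dom (chart_atP x)) => y fy iy.
exact/(smooth_atE f iy).
Qed.

Lemma smooth_inP i (V : set M) f : open V -> V `<=` dom i ->
  smooth_in i V f <-> forall x, V x -> smooth_at x f.
Proof.
move=> oV Vi; have oU := crd_image_open oV Vi.
split=> [[h1 h2] x Vx|h].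
  apply/(smooth_atE f (Vi _ Vx)); split.
    by apply: (proj2 (sm_Coo _ oU) h1); exists x.
  by apply: (proj2 (sm_Coo _ oU) h2); exists x.
split; apply/(sm_Coo _ oU) => _ [x Vx <-].
  by have /(smooth_atE f (Vi _ Vx))[] := h _ Vx.
by have /(smooth_atE f (Vi _ Vx))[] := h _ Vx.
Qed.

Lemma smooth_funP f : smooth_fun f <-> forall x, smooth_at x f.
Proof.
split=> [h x|h i].
  have := h (chart_at x) => /smooth_inP; apply=> //; first exact: dom_open.
  exact: chart_atP.
by apply/smooth_inP => //; exact: dom_open.
Qed.

Lemma smooth_at_cst x (z : scal R c) : smooth_at x (fun=> z).
Proof. exact: (smK_cst _ z). Qed.

Lemma smooth_atD x f g : smooth_at x f -> smooth_at x g ->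
  smooth_at x (fun y => f y + g y).
Proof. exact: smKD. Qed.

Lemma smooth_atM x f g : smooth_at x f -> smooth_at x g ->
  smooth_at x (fun y => f y * g y).
Proof. exact: smKM. Qed.

Lemma smooth_at_sum x (I : Type) (r : seq I) (P : pred I) (F : I -> M -> scal R c) :
  (forall k, P k -> smooth_at x (F k)) ->
  smooth_at x (fun y => \sum_(k <- r | P k) F k y).
Proof.
move=> h; elim: r => [|k r IH].
  by under eq_fun do rewrite big_nil; exact: smooth_at_cst.
under eq_fun do rewrite big_cons.
by case Pk : (P k) => //; apply: smooth_atD => //; exact: h.
Qed.

Definition PD i (j : 'I_n) f x : scal R c :=
  partialK j (fun p => f (icrd i p)) (crd i x).

Lemma PD_eq i j x f g : dom i x -> (\forall y \near x, f y = g y) ->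
  PD i j f x = PD i j g x.
Proof. by move=> ix fg; apply: partialK_eq; exact: (crd_near ix fg). Qed.

Lemma PDD i j x f g : dom i x -> smooth_at x f -> smooth_at x g ->
  PD i j (fun y => f y + g y) x = PD i j f x + PD i j g x.
Proof. by move=> ix /(smooth_atE _ ix) fs /(smooth_atE _ ix) gs; exact: partialKD. Qed.

Lemma PDM i j x f g : dom i x -> smooth_at x f -> smooth_at x g ->
  PD i j (fun y => f y * g y) x = PD i j f x * g x + f x * PD i j g x.
Proof.
move=> ix /(smooth_atE _ ix) fs /(smooth_atE _ ix) gs.
by rewrite /PD (partialKM _ fs gs) !crdK.
Qed.

Lemma PD_cst i j x (z : scal R c) : PD i j (fun=> z) x = 0.
Proof. exact: partialK_cst. Qed.

Lemma PD_sum i j x (I : Type) (r : seq I) (P : pred I) (F : I -> M -> scal R c) :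
  dom i x -> (forall k, P k -> smooth_at x (F k)) ->
  PD i j (fun y => \sum_(k <- r | P k) F k y) x = \sum_(k <- r | P k) PD i j (F k) x.
Proof.
move=> ix h; elim: r => [|k r IH].
  by under eq_fun do rewrite big_nil; rewrite big_nil PD_cst.
under eq_fun do rewrite big_cons.
rewrite big_cons; case Pk : (P k) => //; rewrite -IH -PDD//; first exact: h.
exact: smooth_at_sum.
Qed.

Lemma smooth_at_PD i (j : 'I_n) x f : dom i x -> smooth_at x f ->
  smooth_at x (PD i j f).
Proof.
move=> ix /(smooth_atE _ ix) fs; apply/(smooth_atE _ ix).
apply: smK_eq (smK_partial j fs).
have := near_crd_image ix; apply: filterS => p ip.
by rewrite /PD crd_icrd.
Qed.

Lemma PD_sym i (j k : 'I_n) x f : dom i x -> smooth_at x f ->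
  PD i j (PD i k f) x = PD i k (PD i j f) x.
Proof.
move=> ix /(smooth_atE _ ix) fs; rewrite /PD.
transitivity (partialK j (partialK k (fun p => f (icrd i p))) (crd i x)).
  apply: partialK_eq; have := near_crd_image ix; apply: filterS => p ip.
  by rewrite crd_icrd.
rewrite (partialK_sym j k fs).
apply: partialK_eq; have := near_crd_image ix; apply: filterS => p ip.
by rewrite crd_icrd.
Qed.

Definition crdf i (a : 'I_n) : M -> scal R c := fun y => ofR c (crd i y 0 a).

Lemma smooth_crdf i (a : 'I_n) x : dom i x -> smooth_at x (crdf i a).
Proof.
move=> ix; apply/(smooth_atE _ ix); apply: smK_ofR.
by exact: sm_transition.
Qed.

Lemma jacE i j x (a b : 'I_n) : ofR c (jac i j x a b) = PD i b (crdf j a) x.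
Proof.
apply: K_ext; rewrite ?reK_ofR ?imK_ofR.
  by rewrite reK_partial; under [in RHS]eq_fun do rewrite reK_ofR.
rewrite imK_partial; under eq_fun do rewrite imK_ofR.
by rewrite (derive_cst (0 : R)).
Qed.

Lemma PD_chain i j x f (l : 'I_n) : dom i x -> dom j x -> smooth_at x f ->
  PD j l f x = \sum_m PD i m f x * ofR c (jac j i x m l).
Proof.
move=> ix jx /(smooth_atE _ ix) fs; pose h p := crd i (icrd j p).
have hx : h (crd j x) = crd i x by rewrite /h crdK.
rewrite /PD.
rewrite (@partialK_eq _ _ _ _ _ ((fun p => f (icrd i p)) \o h)).
  by rewrite partialK_chain ?hx// => a; exact: sm_transition.
have := crd_near jx (near_dom ix); apply: filterS => p ip.
by rewrite /h/= crdK.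
Qed.

Lemma jac_chain i j k x (a l : 'I_n) : dom i x -> dom j x -> dom k x ->
  ofR c (jac j k x a l) = \sum_m ofR c (jac i k x a m) * ofR c (jac j i x m l).
Proof.
move=> ix jx kx; rewrite jacE (PD_chain l ix jx); last exact: smooth_crdf.
by apply: eq_bigr => m _; rewrite -jacE.
Qed.

Lemma jac_id i x (a b : 'I_n) : dom i x -> ofR c (jac i i x a b) = (b == a)%:R.
Proof.
move=> ix; rewrite -(@ofR_bool R c); congr ofR; rewrite /jac.
rewrite (@near_eq_derive _ _ _ _ (fun p : 'rV[R]_n => p 0 a : R)).
  rewrite deriveE; last exact: differentiable_coord.
  have @F : {linear 'rV[R]_n -> R}.
    by exists (fun N : 'rV[R]_n => N 0 a); do 2![eexists]; do ?[constructor];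
      rewrite ?mxE// => ? *; rewrite ?mxE//; move=> ?; rewrite !mxE.
  have -> := @diff_lin R _ _ F (crd i x) (@coord_continuous _ _ _ 0 a).
  by rewrite /F/= mxE eqxx eq_sym.
have := near_crd_image ix; apply: filterS => p ip.
by rewrite crd_icrd.
Qed.

(** A Euclidean bump function in a chart, extended by 0. Its support lies in the
    image of a compact cube, which is closed in M because M is Hausdorff; hence the
    extension is smooth outside the chart as well. *)
Lemma bump_exists x (V : set M) : (\forall y \near x, V y) ->
  exists phi : M -> scal R c, [/\ smooth_fun phi, \forall y \near x, phi y = 1 &
    forall y, V y \/ \forall z \near y, phi z = 0].
Proof.
move=> Vx; set i := chart_at x; have ix : dom i x := chart_atP x.
have : \forall p \near crd i x, (crd i @` dom i) p /\ V (icrd i p).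
  near=> p; split; near: p; first exact: near_crd_image.
  exact: crd_near.
move=> /nbhs_ballP[e /= e0 eV].
pose d := e / 2; have d0 : 0 < d by rewrite divr_gt0.
pose r := d ^+ 2 / 2; have r0 : 0 < r by rewrite divr_gt0// exprn_gt0.
pose p0 := crd i x.
pose Q := [set p : 'rV[R]_n | forall a, `[p0 0 a - d, p0 0 a + d] (p 0 a)].
have QP p : Q p <-> forall a, `|p 0 a - p0 0 a| <= d.
  by split=> h a; have := h a; rewrite /= in_itv/= ler_norml => /andP[? ?];
    apply/andP; split; lra.
have Qball p : Q p -> ball p0 e p.
  move=> /QP h; split=> // u a; rewrite ord1 -ball_normE/= distrC.
  by apply: le_lt_trans (h a) _; rewrite /d ltr_pdivrMr// ltr_pMr// ltr1n.
have Qsq p : sqdist p0 p < 2 * r -> Q p.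
  rewrite /r mulrC divfK// => h; apply/QP => a.
  rewrite -ler_sqr ?nnegrE ?(ltW d0)// real_normK ?num_real//; apply: le_trans (ltW h).
  by rewrite /sqdist (bigD1 a)//= lerDl sumr_ge0// => b _; exact: sqr_ge0.
(* the support of the bump function lies in the image of the compact cube Q *)
pose Kc := icrd i @` Q.
have cK : closed Kc.
  apply: compact_closed; first exact: mhausdorff.
  apply: continuous_compact; last first.
    exact: (@rV_compact R n (fun a => `[p0 0 a - d, p0 0 a + d]%classic)
      (fun a => @segment_compact R _ _)).
  apply: continuous_in_subspaceT => p; rewrite inE => /Qball/eV[ip _].
  exact: icrd_continuous.
have KcP y : Kc y -> dom i y /\ V y /\ Q (crd i y).
  move=> [p Qp <-]; have [[z iz zp] Vp] := eV _ (Qball _ Qp).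
  split; last split => //; first by rewrite -zp crdK.
  by rewrite crd_icrd//; exists z.
have out y : ~ Kc y -> \forall z \near y, ~ Kc z.
  move=> Ky; apply: open_nbhs_nbhs; split=> //; exact: closed_openC.
pose phi y : scal R c := if `[< Kc y >] then ofR c (ebump p0 r (crd i y)) else 0.
have phiE y : dom i y -> phi y = ofR c (ebump p0 r (crd i y)).
  move=> iy; rewrite /phi; case: asboolP => // nK.
  rewrite ebump0 ?ofR0// leNgt; apply/negP => /Qsq Qy; apply: nK.
  by exists (crd i y) => //; rewrite crdK.
exists phi; split.
- apply/smooth_funP => y; have [iy|niy] := pselect (dom i y).
    apply: (@smooth_at_eq _ (fun y => ofR c (ebump p0 r (crd i y)))).
      by apply: filterS (near_dom iy) => z /phiE ->.
    apply/(smooth_atE _ iy); apply: smK_ofR.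
    apply: (@sm_eq _ _ _ (ebump p0 r)).
      by apply: filterS (near_crd_image iy) => p /crd_icrd ->.
    apply/smP; exists setT; split=> //; first exact: openT.
    by apply: ebump_Coo => //; exact: openT.
  have nK : ~ Kc y by move=> /KcP[].
  apply: (@smooth_at_eq _ (fun=> 0)); last exact: smooth_at_cst.
  by apply: filterS (out _ nK) => z Kz; rewrite /phi; case: asboolP.
- have : \forall p \near p0, sqdist p0 p < r.
    have c0 : {for p0, continuous (sqdist p0)}.
      apply: sm_continuous; apply/smP; exists setT; split=> //; first exact: openT.
      by apply: sqdist_Coo; exact: openT.
    have s0 : sqdist p0 p0 < r.
      by rewrite /sqdist big1// => a _; rewrite subrr expr0n.
    exact: (c0 _ (lt_nbhsl s0)).
  move=> /(near_crd ix) h.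
  apply: filterS2 h (near_dom ix) => y hy iy.
  by rewrite phiE// ebump1 ?ofR1// ltW.
- move=> y; have [/KcP[_ []]|nK] := pselect (Kc y); first by left.
  right; apply: filterS (out _ nK) => z Kz; rewrite /phi.
  by case: asboolP.
Unshelve. all: by end_near. Qed.

(** Superconnections act on global objects only. This lemma replaces functions
    defined near x, such as coordinates, by global ones. *)
Lemma smooth_extend x (f : M -> scal R c) : smooth_at x f ->
  exists2 g : M -> scal R c, smooth_fun g & \forall y \near x, g y = f y.
Proof.
move=> /smooth_at_near/bump_exists[phi [phis phi1 phi0]].
exists (fun y => phi y * f y); last by apply: filterS phi1 => y ->; rewrite mul1r.
apply/smooth_funP => y; have [fy|p0] := phi0 y.
  by apply: smooth_atM => //; exact: (proj1 (smooth_funP _) phis).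
apply: (@smooth_at_eq _ (fun=> 0)); last exact: smooth_at_cst.
by apply: filterS p0 => z ->; rewrite mul0r.
Qed.

End ManifoldCalculus.

(** * Differential forms *)

Section FormCalculus.
Variables (R : realType) (c : bool) (n : nat) (M : manifold R n).
Local Notation K := (scal R c).
Implicit Types (x y : M) (i : chart M) (f : M -> K).
Let two0 : 2%:R != 0 :> K := scal2_neq0 R c.

Lemma compsE i y (V : lmodType K) (a : ext n V) :
  comps i y a = ext_subst (fun k l => ofR c (jac i (chart_at y) y k l)) a.
Proof. by []. Qed.

Lemma comps_linear i y (V : lmodType K) : linear (@comps R c n M V i y).
Proof. exact: ext_subst_linear. Qed.

HB.instance Definition _ i y (V : lmodType K) :=
  GRing.isLinear.Build K (ext n V) (ext n V) _ (@comps R c n M V i y)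
    (@comps_linear i y V).

(** Substitutions compose, and Jacobian matrices multiply by the chain rule. *)
Lemma comps_change i j y (V : lmodType K) (a : ext n V) : dom i y -> dom j y ->
  comps j y a = ext_subst (fun k l => ofR c (jac j i y k l)) (comps i y a).
Proof.
move=> iy jy; rewrite !compsE (ext_subst_comp two0); congr ext_subst.
apply/funext => k; apply/funext => l.
by rewrite (jac_chain c k l iy jy (chart_atP y)).
Qed.

Lemma comps_id y (V : lmodType K) (a : ext n V) : comps (chart_at y) y a = a.
Proof.
rewrite compsE (_ : (fun k l => _) = (fun k l => (l == k)%:R)) ?ext_subst_id//.
by apply/funext => k; apply/funext => l; rewrite jac_id//; exact: chart_atP.
Qed.

Lemma comps_inv i y (V : lmodType K) (a : ext n V) : dom i y ->
  a = ext_subst (fun k l => ofR c (jac (chart_at y) i y k l)) (comps i y a).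
Proof. by move=> iy; rewrite -(comps_change a iy (chart_atP y)) comps_id. Qed.

Lemma comps_conv i y (U V W : lmodType K) (m : bool -> U -> V -> W)
    (a : ext n U) (b : ext n V) :
  bilin m -> comps i y (conv m a b) = conv m (comps i y a) (comps i y b).
Proof. by move=> bm; rewrite !compsE (ext_subst_conv two0). Qed.

Lemma comps_wedge i y (V : lmodType K) (a : ext n K^o) (b : ext n V) :
  comps i y (wedge a b) = wedge (comps i y a) (comps i y b).
Proof. by rewrite !wedgeE comps_conv//; exact: wmul_bilin. Qed.

Lemma comps_map i y (U V : lmodType K) (h : {linear U -> V}) (a : ext n U) :
  comps i y [ffun S => h (a S)] = [ffun S => h (comps i y a S)].
Proof. exact: ext_subst_map. Qed.

Lemma comps_hom i y k (V : lmodType K) (a : ext n V) :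
  hom_deg k a -> hom_deg k (comps i y a).
Proof. exact: ext_subst_hom. Qed.

Lemma comps_etens1 i y (V : lmodType K) (v : V) :
  comps i y (etens (eone n K) v) = etens (eone n K) v.
Proof. by rewrite compsE ext_subst_etens ext_subst1. Qed.

Lemma comps_eone i y : comps i y (eone n K) = eone n K.
Proof. by rewrite compsE ext_subst1. Qed.

Definition sext x (a : M -> ext n K^o) : Prop :=
  forall S, smooth_at x (fun y => a y S : K).

Lemma sext_covec x (u : M -> 'I_n -> K) : (forall j, smooth_at x (u ^~ j)) ->
  sext x (fun y => covec (u y)).
Proof.
by move=> h S; under eq_fun do rewrite ffunE; apply: smooth_at_sum => j _.
Qed.

Lemma smooth_formP (a : dform c M) :
  smooth_form a <-> forall i x, dom i x -> sext x (fun y => comps i y (a y)).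
Proof.
split=> [h i x ix S|h i S].
  have := h i S => /smooth_inP; apply => //; exact: dom_open.
apply/smooth_inP => //; first exact: dom_open.
by move=> x ix; exact: h.
Qed.

Lemma smooth_formD (a b : dform c M) : smooth_form a -> smooth_form b ->
  smooth_form (fun x => a x + b x).
Proof.
move=> /smooth_formP ha /smooth_formP hb; apply/smooth_formP => i x ix S.
under eq_fun do rewrite linearD/= ffunE.
by apply: smooth_atD; [exact: ha|exact: hb].
Qed.

Lemma smooth_formM f (a : dform c M) : smooth_fun f -> smooth_form a ->
  smooth_form (fun x => f x *: a x).
Proof.
move=> /smooth_funP hf /smooth_formP ha; apply/smooth_formP => i x ix S.
under eq_fun do rewrite linearZ/= ffunE.
by apply: smooth_atM; [exact: hf|exact: ha].
Qed.

Lemma smooth_formZ k (a : dform c M) : smooth_form a ->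
  smooth_form (fun x => k *: a x).
Proof.
by move=> ha; apply: smooth_formM => //; apply/smooth_funP => x; exact: smooth_at_cst.
Qed.

Definition form0 : dform c M := fun=> 0.

Lemma smooth_form0 : smooth_form form0.
Proof.
apply/smooth_formP => i x ix S; under eq_fun do rewrite linear0 ffunE.
exact: smooth_at_cst.
Qed.

Lemma smooth_form_sum (I : Type) (r : seq I) (P : pred I) (F : I -> dform c M) :
  (forall k, P k -> smooth_form (F k)) ->
  smooth_form (fun x => \sum_(k <- r | P k) F k x).
Proof.
move=> h; elim: r => [|k r IH].
  rewrite (_ : (fun x => _) = form0); first exact: smooth_form0.
  by apply/funext => y; rewrite big_nil.
under eq_fun do rewrite big_cons.
by case Pk : (P k) => //; apply: smooth_formD => //; exact: h.
Qed.

Lemma extdE (a : dform c M) x : extd a x =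
  \sum_(j < n) wedge (covec (fun l => (l == j)%:R))
    [ffun S : {set 'I_n} =>
      PD (chart_at x) j (fun y => comps (chart_at x) y (a y) S : K) x : K^o].
Proof. by []. Qed.

Lemma extd_eq (a b : dform c M) x : (\forall y \near x, a y = b y) ->
  extd a x = extd b x.
Proof.
move=> ab; rewrite !extdE; apply: eq_bigr => j _; congr wedge.
apply/ffunP => S; rewrite !ffunE; apply: PD_eq; first exact: chart_atP.
by apply: filterS ab => y ->.
Qed.

Lemma extdD (a b : dform c M) x : smooth_form a -> smooth_form b ->
  extd (fun y => a y + b y) x = extd a x + extd b x.
Proof.
move=> /smooth_formP ha /smooth_formP hb; rewrite !extdE -big_split/=.
apply: eq_bigr => j _; rewrite -[RHS]linearD; congr wedge.
apply/ffunP => S; rewrite !ffunE.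
under [in LHS]eq_fun do rewrite linearD ffunE.
have ix := chart_atP x.
by apply: PDD => //; [exact: ha|exact: hb].
Qed.

Lemma extdZ k (a : dform c M) x : smooth_form a ->
  extd (fun y => k *: a y) x = k *: extd a x.
Proof.
move=> /smooth_formP ha; rewrite !extdE scaler_sumr.
apply: eq_bigr => j _; rewrite -[RHS]linearZ; congr wedge.
apply/ffunP => S; rewrite !ffunE.
under [in LHS]eq_fun do rewrite linearZ ffunE.
have ix := chart_atP x.
rewrite [LHS](@PDM _ _ _ _ _ _ _ (fun=> k)) ?PD_cst ?mul0r ?add0r//.
  exact: smooth_at_cst.
exact: ha.
Qed.

Lemma extd0 x : extd form0 x = 0.
Proof.
have := extdZ 0 x smooth_form0; rewrite scale0r => <-.
by congr (extd _ x); apply/funext => y; rewrite scaler0.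
Qed.

Lemma extd_sum (I : Type) (r : seq I) (P : pred I) (F : I -> dform c M) x :
  (forall k, P k -> smooth_form (F k)) ->
  extd (fun x => \sum_(k <- r | P k) F k x) x = \sum_(k <- r | P k) extd (F k) x.
Proof.
move=> h; elim: r => [|k r IH].
  by rewrite big_nil -[RHS](extd0 x); congr (extd _ x); apply/funext => y; rewrite big_nil.
transitivity (extd (fun x => if P k then F k x + \sum_(j <- r | P j) F j x
    else \sum_(j <- r | P j) F j x) x).
  by congr (extd _ x); apply/funext => y; rewrite big_cons.
rewrite big_cons; case Pk : (P k) => //; rewrite extdD ?IH//; first exact: h.
exact: smooth_form_sum.
Qed.

Lemma extd_hom k (a : dform c M) : homogeneous k a -> homogeneous k.+1 (extd a).
Proof.
move=> ha x S Sk; rewrite extdE sum_ffunE big1// => j _.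
apply: (@wedge_hom _ _ _ 1 k) => //.
  exact: covec_hom.
move=> S' Sk'; rewrite ffunE -[RHS](PD_cst (chart_at x) j x 0); congr (PD _ _ _ x).
apply/funext => y.
have hc : hom_deg k (comps (chart_at x) y (a y)) by apply: comps_hom => T; exact: ha.
exact: hc.
Qed.

Definition fun0 f : dform c M := fun x => (f x : K) *: eone n K.

Lemma fun0_hom f : homogeneous 0 (fun0 f).
Proof.
move=> x S S0; rewrite !ffunE (_ : S == finset.set0 = false) ?scaler0//.
by apply: contraNF S0 => /eqP ->; rewrite cards0.
Qed.

Lemma wedge_fun0 f y (V : lmodType K) (v : ext n V) : wedge (fun0 f y) v = f y *: v.
Proof. by rewrite /fun0 -[LHS]/(wedger _ _) linearZ/= /wedger wedge1. Qed.

Lemma smooth_fun0 f : smooth_fun f -> smooth_form (fun0 f).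
Proof.
move=> /smooth_funP hf; apply/smooth_formP => i x ix S.
rewrite /fun0; under eq_fun do rewrite linearZ/= comps_eone ffunE.
by apply: smooth_atM; [exact: hf|exact: smooth_at_cst].
Qed.

Lemma covec_delta (u : 'I_n -> K) :
  \sum_(j < n) u j *: covec (fun l => (l == j)%:R) = covec u.
Proof.
apply/ffunP => S; rewrite sum_ffunE ffunE.
under eq_bigr => j _ do rewrite ffunE ffunE [_ *: _]mulr_sumr.
rewrite exchange_big/=; apply: eq_bigr => l _.
rewrite (bigD1 l)//= eqxx mulr1 big1 ?addr0// => j jl.
by rewrite eq_sym (negbTE jl) mulr0.
Qed.

Lemma extd_fun0 f x : smooth_at x f ->
  extd (fun0 f) x = covec (fun l => PD (chart_at x) l f x).
Proof.
move=> fs; rewrite extdE -covec_delta; apply: eq_bigr => j _.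
rewrite (_ : [ffun S => _] = (PD (chart_at x) j f x) *: eone n K).
  rewrite linearZ/=; congr (_ *: _).
  have := wedgeC (covec_hom (fun l : 'I_n => (l == j)%:R : K)) (@ebasis_hom n K finset.set0).
  by rewrite cards0 muln0 scale1r => ->; rewrite wedge1.
apply/ffunP => S; rewrite !ffunE.
have -> : (fun y => comps (chart_at x) y (fun0 f y) S : K) =
    (fun y => f y * (S == finset.set0)%:R).
  by apply/funext => y; rewrite linearZ/= comps_eone !ffunE.
rewrite PDM ?PD_cst ?mulr0 ?addr0//; first exact: chart_atP.
exact: smooth_at_cst.
Qed.

(** The differential of a function has the expected components in every chart, not
    only in the one used to define it. *)
Lemma comps_extd_fun0 f i y : dom i y -> smooth_at y f ->
  comps i y (extd (fun0 f) y) = covec (fun l => PD i l f y).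
Proof.
move=> iy fs; rewrite extd_fun0// compsE (ext_subst_covec two0); congr covec.
by apply/funext => l; rewrite (PD_chain l (chart_atP y) iy).
Qed.

Lemma smooth_extd_fun0 f : smooth_fun f -> smooth_form (extd (fun0 f)).
Proof.
move=> /smooth_funP hf; apply/smooth_formP => i x ix S.
apply: (@smooth_at_eq _ _ _ _ _ (fun y => covec (fun l => PD i l f y) S)).
  by apply: filterS (near_dom ix) => y iy; rewrite comps_extd_fun0.
by apply: sext_covec => l; exact: smooth_at_PD.
Qed.

(** Second partial derivatives are symmetric and the products of two coordinate
    covectors are antisymmetric, so the sum is its own opposite. *)
Lemma extd_extd_fun0 f x : smooth_fun f -> extd (extd (fun0 f)) x = 0.
Proof.
move=> /smooth_funP hf; rewrite extdE; set i := chart_at x.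
have ix : dom i x := chart_atP x.
pose P j l := PD i j (PD i l f) x.
pose e j : ext n K^o := covec (fun l => (l == j)%:R).
have -> : \sum_(j < n) wedge (e j)
    [ffun S => PD i j (fun y => comps i y (extd (fun0 f) y) S : K) x : K^o] =
    \sum_(j < n) \sum_(l < n) P j l *: wedge (e j) (e l).
  apply: eq_bigr => j _.
  rewrite (_ : [ffun S => _] = covec (P j)).
    rewrite -covec_delta linear_sum/=; apply: eq_bigr => l _.
    by rewrite linearZ.
  apply/ffunP => S; rewrite !ffunE.
  rewrite (@PD_eq _ _ _ _ _ _ _ _ (fun y => covec (fun l => PD i l f y) S))//; last first.
    by apply: filterS (near_dom ix) => y iy; rewrite comps_extd_fun0.
  under eq_fun do rewrite ffunE.
  by rewrite PD_sum// => l _; exact: smooth_at_PD.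
have anti j l : wedge (e j) (e l) = - wedge (e l) (e j).
  have := wedgeC (@covec_hom n K (fun m => (m == j)%:R)) (@covec_hom n K (fun m => (m == l)%:R)).
  by rewrite expr1 scaleN1r.
set X := \sum_(j < n) _.
have : X = - X.
  rewrite {1}/X exchange_big/= -sumrN; apply: eq_bigr => j _.
  rewrite -sumrN; apply: eq_bigr => l _.
  have -> : P l j = P j l by exact: (PD_sym l j ix (hf x)).
  by rewrite -scalerN -(anti l j).
move/eqP; rewrite -addr_eq0 -mulr2n -scaler_nat scaler_eq0 (negbTE two0)/=.
by move/eqP.
Qed.

End FormCalculus.

(** * Forms with values in a superbundle *)

Section Fibers.
Variables (R : realType) (c : bool) (n : nat) (M : manifold R n).
Variable E : superbundle c M.
Local Notation K := (scal R c).
Implicit Types (x y : M) (i : chart M) (t : triv E).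

Lemma vform_ext (a b : vform E) : (forall x, a x = b x) -> a = b.
Proof. exact: functional_extensionality_dep. Qed.

Lemma eform_ext (a b : eform E) : (forall x, a x = b x) -> a = b.
Proof. exact: functional_extensionality_dep. Qed.

Lemma part_linear b x : linear (@part R c n M E b x).
Proof. by case: b => k u v. Qed.
HB.instance Definition _ b x :=
  GRing.isLinear.Build K (fiber E x) (fib E b x) _ (@part R c n M E b x) (@part_linear b x).

Lemma inj_linear b x : linear (@inj R c n M E b x).
Proof. by case: b => k u v; congr pair; rewrite /= ?scaler0 ?addr0. Qed.
HB.instance Definition _ b x :=
  GRing.isLinear.Build K (fib E b x) (fiber E x) _ (@inj R c n M E b x) (@inj_linear b x).

Lemma grading_linear x : linear (@grading R c n M E x).
Proof. by move=> k u v; congr pair; rewrite /= opprD scalerN. Qed.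
HB.instance Definition _ x :=
  GRing.isLinear.Build K (fiber E x) (fiber E x) _ (@grading R c n M E x) (@grading_linear x).

Definition gr x : 'End(fiber E x) := linfun (@grading R c n M E x).

Lemma grE x v : gr x v = grading v. Proof. exact: lfunE. Qed.

Lemma grK x : (gr x \o gr x = \1)%VF.
Proof.
apply/lfunP => v; rewrite comp_lfunE !grE lfunE/=.
by case: v => v w; rewrite /grading/= opprK.
Qed.

Lemma part_grading b x (v : fiber E x) : part b (grading v) = (-1) ^+ b *: part b v.
Proof. by case: b; rewrite /= ?scaleN1r ?scale1r. Qed.

Lemma grading_inj b x (v : fib E b x) : grading (inj v) = (-1) ^+ b *: inj v.
Proof.
case: b v => v; rewrite /= ?expr1 ?expr0 ?scaleN1r ?scale1r /grading/=.
  by congr pair; rewrite /= oppr0.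
by rewrite oppr0.
Qed.

Lemma actE (L : eform E) (a : vform E) x : act L a x = pact (gr x) (L x) (a x).
Proof.
apply/ffunP => S; rewrite !ffunE; apply: eq_bigr => I _ /=.
congr (_ *: _); rewrite /actm /conjg; case: ifP => // _.
by rewrite comp_lfunE comp_lfunE !grE.
Qed.

Lemma vsignE (a : vform E) x : vsign a x = psgn (gr x) (a x).
Proof. by apply/ffunP => S; rewrite !ffunE grE. Qed.

(** Frame indices of both parities together. *)
Definition fidx t : finType := {b : bool & 'I_(rk t b)}.

Definition ebas t (k : fidx t) y : fiber E y :=
  inj (tnth (frame t (tag k) y) (tagged k)).
Definition eps t (k : fidx t) y (v : fiber E y) : K :=
  coord (frame t (tag k) y) (tagged k) (part (tag k) v).

Lemma eps_linear t k y : linear (@eps t k y : fiber E y -> K^o).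
Proof. by move=> a u v; rewrite /eps !linearP. Qed.
HB.instance Definition _ t k y :=
  GRing.isLinear.Build K (fiber E y) K^o _ (@eps t k y : fiber E y -> K^o) (@eps_linear t k y).

Lemma ebas_eps t y (v : fiber E y) : tdom t y ->
  \sum_k eps k v *: ebas (t := t) k y = v.
Proof.
move=> ty; transitivity (\sum_b inj (part b v)); last first.
  by rewrite big_bool; case: v => v w /=; congr pair; rewrite /= ?addr0 ?add0r.
pose F (b : bool) (k : 'I_(rk t b)) :=
  coord (frame t b y) k (part b v) *: inj (tnth (frame t b y) k).
rewrite -(sig_big_dep xpredT (fun _ => xpredT) F)/=.
apply: eq_bigr => b _; rewrite /F.
have /andP[/eqP sp _] := frame_basis b ty.
rewrite [in RHS](coord_span (X := frame t b y) (v := part b v)); last first.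
  by rewrite sp memvf.
rewrite linear_sum; apply: eq_bigr => k _; rewrite linearZ/=.
by rewrite (tnth_nth 0).
Qed.

Lemma eps_grading t (k : fidx t) y (v : fiber E y) :
  eps k (grading v) = (-1) ^+ tag k * eps k v.
Proof. by rewrite /eps part_grading linearZ. Qed.

Lemma ebas_grading t (k : fidx t) y :
  grading (ebas k y) = (-1) ^+ tag k *: ebas k y.
Proof. exact: grading_inj. Qed.

(** These are the entries of the transition functions, the ones between different
    parities being 0. *)
Lemma smooth_eps_ebas t t' (k : fidx t) (l : fidx t') x : tdom t x -> tdom t' x ->
  smooth_at x (fun y => eps k (ebas l y)).
Proof.
move=> tx t'x; case: k l => [b k] [b' l]; rewrite /eps /ebas/=.
have [e|nb] := eqVneq b b'; last first.
  have p0 y (v : fib E b' y) : part b (inj v) = 0 by case: b b' v nb k l => [] [].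
  by under eq_fun do rewrite p0 linear0; exact: smooth_at_cst.
move: l; rewrite -{}e => l.
have pK y (v : fib E b y) : part b (inj v) = v by case: b v {k l}.
under eq_fun do rewrite pK.
have := @frame_smooth _ _ _ _ E t t' b k l (chart_at x) => /smooth_inP; apply.
- by apply: openI; [exact: dom_open|apply: openI; exact: tdom_open].
- by move=> y [].
- by split; [exact: chart_atP|split].
Qed.

Lemma smooth_vformP (a : vform E) : smooth_vform a <->
  forall i t x S (k : fidx t), dom i x -> tdom t x ->
    smooth_at x (fun y => eps k (comps i y (a y) S)).
Proof.
have oit i t : open (dom i `&` tdom t).
  by apply: openI; [exact: dom_open|exact: tdom_open].
split=> [h i t x S [b k] ix tx|h i t S b k].
  by have := h i t S b k => /smooth_inP; apply => // y [].
by apply/smooth_inP => // x [ix tx]; exact: (h i t x S (Tagged _ k)).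
Qed.

Lemma smooth_eformP (L : eform E) : smooth_eform L <->
  forall i t x S (k l : fidx t), dom i x -> tdom t x ->
    smooth_at x (fun y => eps k ((comps i y (L y) S : 'End(fiber E y)) (ebas l y))).
Proof.
have oit i t : open (dom i `&` tdom t).
  by apply: openI; [exact: dom_open|exact: tdom_open].
split=> [h i t x S [b k] [b' l] ix tx|h i t S b b' k l].
  by have := h i t S b b' k l => /smooth_inP; apply => // y [].
by apply/smooth_inP => // x [ix tx]; exact: (h i t x S (Tagged _ k) (Tagged _ l)).
Qed.

Lemma smooth_vadd (a b : vform E) : smooth_vform a -> smooth_vform b ->
  smooth_vform (vadd a b).
Proof.
move=> /smooth_vformP ha /smooth_vformP hb; apply/smooth_vformP => i t x S k ix tx.
rewrite /vadd; under eq_fun do rewrite linearD ffunE linearD.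
by apply: smooth_atD; [exact: ha|exact: hb].
Qed.

Lemma smooth_vmul f (a : vform E) : smooth_fun f -> smooth_vform a ->
  smooth_vform (vmul f a).
Proof.
move=> /smooth_funP hf /smooth_vformP ha; apply/smooth_vformP => i t x S k ix tx.
rewrite /vmul; under eq_fun do rewrite linearZ ffunE linearZ.
by apply: smooth_atM; [exact: hf|exact: ha].
Qed.

Lemma smooth_vscale z (a : vform E) : smooth_vform a -> smooth_vform (vscale z a).
Proof.
by apply: (@smooth_vmul (fun=> z)); apply/smooth_funP => x; exact: smooth_at_cst.
Qed.

Lemma vsubE (a b : vform E) : vsub a b = vadd a (vscale (- 1) b).
Proof. by apply: vform_ext => x; rewrite /vsub /vadd /vscale scaleN1r. Qed.

Lemma smooth_vsub (a b : vform E) : smooth_vform a -> smooth_vform b ->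
  smooth_vform (vsub a b).
Proof. by move=> ha hb; rewrite vsubE; apply: smooth_vadd => //; exact: smooth_vscale. Qed.

Definition vform0 : vform E := fun=> 0.

Lemma smooth_vform0 : smooth_vform vform0.
Proof.
apply/smooth_vformP => i t x S k ix tx.
rewrite /vform0; under eq_fun do rewrite linear0 ffunE linear0.
exact: smooth_at_cst.
Qed.

Lemma smooth_vsum (I : Type) (r : seq I) (P : pred I) (F : I -> vform E) :
  (forall k, P k -> smooth_vform (F k)) ->
  smooth_vform (fun x => \sum_(k <- r | P k) F k x).
Proof.
move=> h; apply/smooth_vformP => i t x S k ix tx.
under eq_fun do rewrite linear_sum sum_ffunE linear_sum.
by apply: smooth_at_sum => j Pj; have /smooth_vformP := h j Pj; apply.
Qed.

Lemma smooth_vwedge (a : dform c M) (b : vform E) : smooth_form a ->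
  smooth_vform b -> smooth_vform (vwedge a b).
Proof.
move=> /smooth_formP ha /smooth_vformP hb; apply/smooth_vformP => i t x S k ix tx.
rewrite /vwedge; under eq_fun do rewrite comps_wedge ffunE linear_sum.
apply: smooth_at_sum => I _; under eq_fun do rewrite linearZ.
apply: smooth_atM; last exact: hb.
by apply: smooth_atM; [exact: smooth_at_cst|exact: ha].
Qed.

Lemma comps_psgn i y (v : ext n (fiber E y)) :
  comps i y (psgn (gr y) v) = psgn (gr y) (comps i y v).
Proof.
apply/ffunP => S; rewrite compsE !ffunE linear_sum scaler_sumr.
apply: eq_bigr => I _; rewrite !ffunE [in RHS]linearZ/= !scalerA.
have [IS|IS] := eqVneq #|S| #|I|; first by rewrite IS [in RHS]mulrC.
by rewrite (subst_basis_hom _ IS) !(mul0r, mulr0) !scale0r.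
Qed.

Lemma smooth_vsign (a : vform E) : smooth_vform a -> smooth_vform (vsign a).
Proof.
move=> /smooth_vformP ha; apply/smooth_vformP => i t x S k ix tx.
under eq_fun do rewrite vsignE comps_psgn ffunE linearZ/= grE eps_grading.
apply: smooth_atM; first exact: smooth_at_cst.
by apply: smooth_atM; [exact: smooth_at_cst|exact: ha].
Qed.

Lemma comps_pact i y (L : ext n 'End(fiber E y)) (v : ext n (fiber E y)) :
  comps i y (pact (gr y) L v) = pact (gr y) (comps i y L) (comps i y v).
Proof. exact/comps_conv/actm_bilin. Qed.

Lemma smooth_act (L : eform E) (a : vform E) : smooth_eform L -> smooth_vform a ->
  smooth_vform (act L a).
Proof.
move=> /smooth_eformP hL /smooth_vformP ha; apply/smooth_vformP => i t x S k ix tx.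
pose F y I (l : fidx t) : K := (-1) ^+ inversions I (S :\: I)%SET *
   ((-1) ^+ (odd #|S :\: I|%SET && (tag k (+) tag l)) *
   (eps l (comps i y (a y) (S :\: I)%SET) *
    eps k ((comps i y (L y) I : 'End(fiber E y)) (ebas l y)))).
apply: (@smooth_at_eq _ _ _ _ _ (fun y =>
    \sum_(I : {set 'I_n} | I \subset S) \sum_l F y I l)); last first.
  apply: smooth_at_sum => I _; apply: smooth_at_sum => l _.
  apply: smooth_atM; first exact: smooth_at_cst.
  apply: smooth_atM; first exact: smooth_at_cst.
  by apply: smooth_atM; [exact: ha|exact: hL].
have : \forall y \near x, tdom t y.
  by apply: open_nbhs_nbhs; split=> //; exact: tdom_open.
apply: filterS => y ty; rewrite actE comps_pact ffunE linear_sum.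
apply: eq_bigr => I _; rewrite linearZ /F -mulr_sumr; congr (_ * _).
rewrite /actm /conjg; set v := comps _ _ (a y) _; set N := comps _ _ (L y) I.
rewrite -{2}(ebas_eps v ty).
case: ifP => _.
  rewrite 2!comp_lfunE !grE -[RHS]/(eps k (grading _)) eps_grading !linear_sum mulr_sumr.
  apply: eq_bigr => l _; rewrite !linearZ/= ebas_grading !linearZ/=.
  rewrite signr_addb/= /GRing.scale/=; ring.
rewrite !linear_sum; apply: eq_bigr => l _; rewrite !linearZ/=.
by rewrite mul1r.
Qed.

End Fibers.

(** * Tensorial operators *)

Lemma etens_as_conv n (K : fieldType) (V : lmodType K) (w : ext n K^o) (v : V) :
  wedge w (etens (eone n K) v) = etens w v.
Proof.
apply/ffunP => S; rewrite wedgeE (conv_degr (@wmul_bilin K V)).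
  by rewrite /wmul !ffunE eqxx scale1r.
by move=> I I0; rewrite !ffunE (negbTE I0) scale0r.
Qed.

Definition degpart n (K : fieldType) (V : lmodType K) (d : nat) (a : ext n V) : ext n V :=
  [ffun S : {set 'I_n} => if #|S| == d then a S else 0].

Lemma degpart_hom n (K : fieldType) (V : lmodType K) d (a : ext n V) :
  hom_deg d (degpart d a).
Proof. by move=> S Sd; rewrite ffunE (negbTE Sd). Qed.

Lemma degpart_sum n (K : fieldType) (V : lmodType K) (a : ext n V) :
  a = \sum_(d < n.+1) degpart d a.
Proof.
apply/ffunP => S; rewrite sum_ffunE.
have Sn : (#|S| < n.+1)%N by rewrite ltnS -[X in (_ <= X)%N](card_ord n) max_card.
rewrite (bigD1 (Ordinal Sn))//= big1 ?addr0; first by rewrite ffunE eqxx.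
move=> d; rewrite -val_eqE/= => dS; rewrite ffunE.
by rewrite eq_sym (negbTE dS).
Qed.

Section Sections.
Variables (R : realType) (c : bool) (n : nat) (M : manifold R n).
Variable E : superbundle c M.
Local Notation K := (scal R c).
Implicit Types (x y : M) (i : chart M) (t : triv E).

Lemma smooth_degpart d (a : dform c M) : smooth_form a ->
  smooth_form (fun y => degpart d (a y)).
Proof.
move=> /smooth_formP ha; apply/smooth_formP => i x ix S.
pose z : K := (#|S| == d)%:R.
apply: (@smooth_at_eq _ _ _ _ _ (fun y => z * comps i y (a y) S)); last first.
  by apply: smooth_atM; [exact: smooth_at_cst|exact: ha].
apply: filterE => y; rewrite compsE !ffunE /z.
rewrite [LHS]mulr_sumr; apply: eq_bigr => I _; rewrite ffunE.
have [IS|IS] := eqVneq #|S| #|I|; last by rewrite subst_basis_hom// !(scale0r, mulr0).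
by rewrite -IS; case: eqP => _; rewrite ?mul1r// mul0r scaler0.
Qed.

(** Frame sections and frame coordinates, cut off by phi so as to be defined
    globally. *)
Definition sect (phi : M -> K) t (k : fidx t) : vform E :=
  fun y => etens (eone n K) (phi y *: ebas k y).

Definition coef (phi : M -> K) t (k : fidx t) (v : vform E) : dform c M :=
  fun y => [ffun S => phi y * eps k (v y S) : K^o].

Definition cutoff t x (phi : M -> K) : Prop :=
  [/\ smooth_fun phi, \forall y \near x, phi y = 1 &
      forall y, tdom t y \/ \forall z \near y, phi z = 0].

Lemma cutoff_exists t x : tdom t x -> exists phi, cutoff t x phi.
Proof.
by move=> tx; apply: bump_exists; apply: open_nbhs_nbhs; split=> //; exact: tdom_open.
Qed.

Lemma smooth_sect phi t x k : cutoff t x phi -> smooth_vform (sect phi (t := t) k).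
Proof.
move=> [/smooth_funP ps _ p0]; apply/smooth_vformP => i t' y S l iy t'y.
rewrite /sect; under eq_fun do rewrite comps_etens1 ffunE !linearZ/=.
apply: smooth_atM; first exact: smooth_at_cst.
have [ty|z0] := p0 y.
  by apply: smooth_atM; [exact: ps|exact: smooth_eps_ebas].
apply: (@smooth_at_eq _ _ _ _ _ (fun=> 0)); last exact: smooth_at_cst.
by apply: filterS z0 => z ->; rewrite scale0r.
Qed.

Lemma smooth_coef phi t x k v : cutoff t x phi -> smooth_vform v ->
  smooth_form (coef phi (t := t) k v).
Proof.
move=> [/smooth_funP ps _ p0] /smooth_vformP sv; apply/smooth_formP => i y iy S.
have E1 z : comps i z (coef phi k v z) S = phi z * eps k (comps i z (v z) S).
  rewrite /coef (_ : [ffun _ => _] = phi z *: [ffun S => eps k (v z S) : K^o]).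
    by rewrite linearZ/= comps_map !ffunE.
  by apply/ffunP => T; rewrite !ffunE.
under eq_fun do rewrite E1.
have [ty|z0] := p0 y.
  by apply: smooth_atM; [exact: ps|exact: sv].
apply: (@smooth_at_eq _ _ _ _ _ (fun=> 0)); last exact: smooth_at_cst.
by apply: filterS z0 => z ->; rewrite mul0r.
Qed.

(** Coordinates and sections are both cut off, hence the square of phi. *)
Lemma sum_coef_sect phi t x (v : vform E) y : cutoff t x phi ->
  \sum_k wedge (coef phi (t := t) k v y) (sect phi k y) = (phi y * phi y) *: v y.
Proof.
move=> [_ _ p0]; rewrite /sect; under eq_bigr do rewrite etens_as_conv.
apply/ffunP => S; rewrite sum_ffunE [RHS]ffunE.
have [ty|z0] := p0 y; last first.
  rewrite (nbhs_singleton z0) mul0r scale0r big1// => k _.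
  by rewrite !ffunE (nbhs_singleton z0) mul0r scale0r.
rewrite -(ebas_eps (v y S) ty) scaler_sumr; apply: eq_bigr => k _.
rewrite !ffunE !scalerA; congr (_ *: _); ring.
Qed.

Definition vconj (T : vform E -> vform E) : vform E -> vform E :=
  fun v => vsign (T (vsign v)).

Lemma vsignK (v : vform E) : vsign (vsign v) = v.
Proof. by apply: vform_ext => x; rewrite !vsignE psgnK// grK. Qed.

Lemma vconj_iter k T v : iter k vconj T v = if odd k then vconj T v else T v.
Proof.
elim: k v => //= k IH v; rewrite {1}/vconj IH.
by case: (odd k) => //=; rewrite /vconj !vsignK.
Qed.

(** Linearity over forms with the sign rule. As T need not have a parity, the sign
    (-1)^(k |T|) is expressed by k conjugations with the degree involution. *)
Definition tensorial (T : vform E -> vform E) : Prop :=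
  [/\ forall v, smooth_vform v -> smooth_vform (T v),
      forall u v, smooth_vform u -> smooth_vform v -> T (vadd u v) = vadd (T u) (T v) &
      forall k (a : dform c M) v, smooth_form a -> homogeneous k a -> smooth_vform v ->
        T (vwedge a v) = vwedge a (iter k vconj T v)].

Lemma tensorial_sum T (I : Type) (r : seq I) (F : I -> vform E) x : tensorial T ->
  (forall k, smooth_vform (F k)) ->
  T (fun y => \sum_(k <- r) F k y) x = \sum_(k <- r) T (F k) x.
Proof.
move=> [_ TD TW] h; elim: r => [|k r IH].
  rewrite big_nil.
  have := TW 0%N (@form0 R c n M) (@vform0 R c n M E) (@smooth_form0 R c n M) (fun _ _ _ =>
    ffunE _ _)
    (@smooth_vform0 R c n M E) => /(congr1 (fun f => f x)).
  rewrite /vwedge -[wedge _ _ in RHS]/(wedger _ (0 : ext n K^o)) linear0 => <-.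
  congr (T _ x); apply: vform_ext => y; rewrite big_nil /form0.
  by rewrite -[RHS]/(wedger _ (0 : ext n K^o)) linear0.
rewrite big_cons -IH -[RHS]/(vadd _ _ x) -TD//; last exact: smooth_vsum.
by congr (T _ x); apply: vform_ext => y; rewrite big_cons.
Qed.

Lemma tensorialM T f v : tensorial T -> smooth_fun f -> smooth_vform v ->
  T (vmul f v) = vmul f (T v).
Proof.
move=> [_ _ TW] fs vs.
have e u : vmul f u = vwedge (fun0 f) u.
  by apply: vform_ext => y; rewrite /vwedge wedge_fun0.
by rewrite !e (TW 0%N)//; [exact: smooth_fun0|exact: fun0_hom].
Qed.

Lemma psig_iter x k (L : ext n 'End(fiber E x)) :
  iter k (psig (gr E x)) L = if odd k then psig (gr E x) L else L.
Proof.
elim: k => //= k ->; case: (odd k) => //=.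
by rewrite psigK// grK.
Qed.

Definition frame_end t x (w : fidx t -> fiber E x) (v : fiber E x) : fiber E x :=
  \sum_k eps k v *: w k.

Lemma frame_end_linear t x w : linear (@frame_end t x w).
Proof.
move=> k u v; rewrite /frame_end scaler_sumr -big_split/=; apply: eq_bigr => l _.
by rewrite linearP/= scalerDl scalerA.
Qed.
HB.instance Definition _ t x w :=
  GRing.isLinear.Build K (fiber E x) (fiber E x) _ (@frame_end t x w)
    (@frame_end_linear t x w).

Lemma eps_ebas t (k l : fidx t) x : tdom t x -> eps k (ebas l x) = (k == l)%:R.
Proof.
move=> tx; case: k l => [b k] [b' l]; rewrite /eps /ebas/=.
have [e|nb] := eqVneq b b'; last first.
  have p0 (v : fib E b' x) : part b (inj v) = 0 by case: b b' v nb k l => [] [].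
  rewrite p0 linear0; case: eqP => // /(congr1 (@tag _ _))/= e.
  by rewrite e eqxx in nb.
move: l; rewrite -{}e => l.
have pK (v : fib E b x) : part b (inj v) = v by case: b v {k l}.
rewrite pK (tnth_nth 0) coord_free; last first.
  by have /andP[_ fr] := frame_basis b tx.
by rewrite -[LHS]/((_ == _)%:R); congr (_%:R); rewrite eq_Tagged/= eq_sym.
Qed.

Lemma psgn_ebas t (k : fidx t) x (z : K) :
  psgn (gr E x) (etens (eone n K) (z *: ebas k x)) =
  (-1) ^+ tag k *: etens (eone n K) (z *: ebas k x).
Proof.
apply/ffunP => S; rewrite !ffunE !linearZ/= grE ebas_grading !scalerA.
congr (_ *: _); case: (S =P finset.set0) => [->|_]; last by rewrite !(mul0r, mulr0).
by rewrite cards0; ring.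
Qed.

Lemma vsign_sect phi t (k : fidx t) :
  vsign (sect phi k) = vscale ((-1) ^+ tag k) (sect phi k).
Proof. by apply: vform_ext => y; rewrite vsignE /vscale psgn_ebas. Qed.

Definition from_frame t x (w : fidx t -> ext n (fiber E x)) : ext n 'End(fiber E x) :=
  [ffun S => linfun (frame_end (fun k => w k S))].

Lemma from_frameE t x (w : fidx t -> ext n (fiber E x)) k : tdom t x ->
  pact (gr E x) (from_frame w) (etens (eone n K) (ebas k x)) = w k.
Proof.
move=> tx; apply/ffunP => S; rewrite pact_etens1 ffunE lfunE/= /frame_end (bigD1 k)//=.
rewrite eps_ebas// eqxx scale1r big1 ?addr0// => l lk.
by rewrite eps_ebas// (negbTE lk) scale0r.
Qed.

Lemma pact_frame_inj t x (L N : ext n 'End(fiber E x)) : tdom t x ->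
  (forall k : fidx t, pact (gr E x) L (etens (eone n K) (ebas k x)) =
                      pact (gr E x) N (etens (eone n K) (ebas k x))) -> L = N.
Proof.
move=> tx h; apply/ffunP => S; apply/lfunP => v.
rewrite -(ebas_eps v tx) !linear_sum; apply: eq_bigr => k _; rewrite !linearZ/=.
by have /ffunP/(_ S) := h k; rewrite !pact_etens1 => ->.
Qed.

(** The values of L on frame sections cut off around a point are the matrix entries
    of L near that point. *)
Lemma smooth_eform_of_act (L : eform E) :
  (forall v, smooth_vform v -> smooth_vform (act L v)) -> smooth_eform L.
Proof.
move=> h; apply/smooth_eformP => i t x S k l ix tx.
have [phi cphi] := cutoff_exists tx.
have := h _ (smooth_sect l cphi) => /smooth_vformP /(_ i t x S k ix tx).
apply: smooth_at_eq; have [_ {}p1 _] := cphi.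
apply: filterS p1 => y py; rewrite actE /sect py scale1r.
pose ev (f : 'End(fiber E y)) := f (ebas l y).
have evl : linear ev by move=> a u v; rewrite /ev lfunE/= lfunE.
pose evL := GRing.isLinear.Build K _ _ _ ev evl.
pose EV : {linear 'End(fiber E y) -> fiber E y} := HB.pack ev evL.
rewrite (_ : pact _ _ _ = [ffun S => EV (L y S)]).
  by rewrite comps_map ffunE.
by apply/ffunP => T; rewrite pact_etens1 ffunE.
Qed.

Lemma act_inj (L N : eform E) :
  (forall v, smooth_vform v -> act L v = act N v) -> L = N.
Proof.
move=> h; apply: eform_ext => x; apply/ffunP => S; apply/lfunP => v.
have [t tx] := tdom_cover E x; have [phi cphi] := cutoff_exists tx.
have [_ /nbhs_singleton p1 _] := cphi.
rewrite -(ebas_eps v tx) !linear_sum; apply: eq_bigr => k _; rewrite !linearZ/=.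
have := h _ (smooth_sect k cphi) => /(congr1 (fun f : vform E => f x S)).
by rewrite !actE /sect p1 scale1r !pact_etens1 => ->.
Qed.

(** The values of T at x on a cut off frame define L x. They determine T v x:
    multiplying v by the square of the cutoff does not change T v at x and makes v a
    combination of the frame sections with forms as coefficients. *)
Lemma tensorial_act T : tensorial T ->
  exists2 L, smooth_eform L & forall v, smooth_vform v -> T v = act L v.
Proof.
move=> tT; have [Ts TD TW] := tT.
pose t x := projT1 (cid (tdom_cover E x)).
have tx x : tdom (t x) x := projT2 (cid (tdom_cover E x)).
pose phi x := projT1 (cid (cutoff_exists (tx x))).
have cphi x : cutoff (t x) x (phi x) := projT2 (cid (cutoff_exists (tx x))).
pose L : eform E := fun x => from_frame (fun k => T (sect (phi x) (t := t x) k) x).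
have TL v : smooth_vform v -> T v = act L v.
  move=> vs; apply: vform_ext => x; rewrite actE.
  have [ps /nbhs_singleton p1 _] := cphi x.
  pose s k := sect (phi x) (t := t x) k.
  pose a k := coef (phi x) (t := t x) k v.
  have Ls k : pact (gr E x) (L x) (etens (eone n K) (ebas k x)) = T (s k) x.
    exact: from_frameE.
  have ss k : smooth_vform (s k) := smooth_sect k (cphi x).
  have sa k : smooth_form (a k) := smooth_coef k (cphi x) vs.
  have phi2 : smooth_fun (fun y => phi x y * phi x y).
    by apply/smooth_funP => y; apply: smooth_atM; exact: (proj1 (smooth_funP _) ps).
  pose F k (d : 'I_n.+1) : vform E := vwedge (fun y => degpart d (a k y)) (s k).
  have sF k d : smooth_vform (F k d).
    by apply: smooth_vwedge => //; exact: smooth_degpart.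
  (* phi is 1 at x, and T commutes with functions *)
  have -> : T v x = T (vmul (fun y => phi x y * phi x y) v) x.
    by rewrite tensorialM// /vmul p1 mulr1 scale1r.
  have -> : vmul (fun y => phi x y * phi x y) v =
      (fun y => \sum_k \sum_d F k d y).
    apply: vform_ext => y; rewrite /vmul -(sum_coef_sect v y (cphi x)).
    apply: eq_bigr => k _; rewrite [coef _ _ _ _]degpart_sum.
    by rewrite -[LHS]/(wedger _ _) linear_sum.
  rewrite (@tensorial_sum T _ _ (fun k y => \sum_d F k d y) x tT)//; last first.
    by move=> k; exact: smooth_vsum.
  have -> : v x = \sum_k wedge (a k x) (etens (eone n K) (ebas k x)).
    have := sum_coef_sect v x (cphi x).
    by rewrite /sect p1 mulr1 scale1r => <-; apply: eq_bigr => k _; rewrite scale1r.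
  rewrite linear_sum; apply: eq_bigr => k _.
  rewrite (@tensorial_sum T _ _ (fun d => F k d) x tT)// {1}[a k x]degpart_sum.
  rewrite -[wedge _ _]/(wedger _ _) !linear_sum; apply: eq_bigr => d _.
  rewrite /F (TW d)//; first last.
  - by move=> y; exact: degpart_hom.
  - exact: smooth_degpart.
  rewrite -[RHS]/(pact (gr E x) (L x) (wedge _ _)) -[in RHS](pact_iota (grK E x)) -pactM; last
    exact: grK.
  rewrite (psig_hom_comm (grK E x) _ (@degpart_hom _ _ _ _ _)).
  rewrite pactM; last exact: grK.
  rewrite (pact_iota (grK E x)).
  rewrite /vwedge; congr wedge.
  rewrite vconj_iter psig_iter; case: ifP => _; last by rewrite Ls.
  rewrite (pact_sig (grK E x)) /vconj vsignE; congr psgn.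
  have sg := psgn_ebas k x 1.
  rewrite scale1r in sg.
  have vs1 : vsign (s k) = vmul (fun=> (-1) ^+ tag k) (s k) := vsign_sect (phi x) k.
  rewrite vs1 tensorialM//; last by apply/smooth_funP => y; exact: smooth_at_cst.
  by rewrite sg linearZ/= Ls.
exists L => //; apply: smooth_eform_of_act => v vs.
by rewrite -TL//; exact: Ts.
Qed.

End Sections.

(** * Superconnections *)

Section Superconnections.
Variables (R : realType) (c : bool) (n : nat) (M : manifold R n).
Variable E : superbundle c M.
Local Notation K := (scal R c).
Implicit Types (x y : M) (i : chart M) (t : triv E).
Let two0 : 2%:R != 0 :> K := scal2_neq0 R c.

Lemma opp_eq0 (V : lmodType K) (v : V) : v = - v -> v = 0.
Proof.
move/eqP; rewrite -addr_eq0 -mulr2n -scaler_nat scaler_eq0 (negbTE two0)/=.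
by move/eqP.
Qed.

Lemma fiber_ext x (v w : fiber E x) : (forall b, part b v = part b w) -> v = w.
Proof.
move=> h; have h1 := h false; have h2 := h true.
by case: v w h1 h2 {h} => [v1 v2] [w1 w2] /= -> ->.
Qed.

(** Parity as an eigenvalue condition for the degree involution. *)
Lemma vparity_vsign b (a : vform E) :
  vparity b a <-> vsign a = vscale ((-1) ^+ b) a.
Proof.
split=> [h|h].
  apply: vform_ext => x; apply/ffunP => S; rewrite !ffunE; apply: fiber_ext => b'.
  rewrite !linearZ/= part_grading scalerA -signr_odd -signr_addb.
  have [->//|hb] := eqVneq (odd #|S| (+) b') b.
  by rewrite h// !scaler0.
move=> x S b' hb; apply: opp_eq0.
have /(congr1 (fun f : vform E => part b' (f x S))) := h.
rewrite !ffunE !linearZ/= part_grading scalerA -signr_odd -signr_addb.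
move: hb; case: (_ (+) _); case: b {h} => //= _;
  by rewrite expr0 expr1 scale1r scaleN1r.
Qed.

Section OneConnection.
Variable A : vform E -> vform E.
Hypothesis hA : superconnection A.

Lemma sc_smooth v : smooth_vform v -> smooth_vform (A v).
Proof. by have [[[+ _ _] _] _ _] := hA; apply. Qed.

Lemma scD u v : smooth_vform u -> smooth_vform v -> A (vadd u v) = vadd (A u) (A v).
Proof. by have [[[_ + _] _] _ _] := hA; apply. Qed.

Lemma scZ k v : smooth_vform v -> A (vscale k v) = vscale k (A v).
Proof. by have [[[_ _ +] _] _ _] := hA; apply. Qed.

Lemma sc0 : A (vform0 E) = vform0 E.
Proof.
have := scZ 0 (@smooth_vform0 _ _ _ _ E).
have -> : vscale 0 (vform0 E) = vform0 E.
  by apply: vform_ext => x; rewrite /vscale scale0r.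
by move=> ->; apply: vform_ext => x; rewrite /vscale scale0r.
Qed.

Lemma sc_sum (I : Type) (r : seq I) (F : I -> vform E) x :
  (forall k, smooth_vform (F k)) ->
  A (fun y => \sum_(k <- r) F k y) x = \sum_(k <- r) A (F k) x.
Proof.
move=> h; elim: r => [|k r IH].
  rewrite big_nil -[RHS]/(vform0 E x) -sc0; congr (A _ x).
  by apply: vform_ext => y; rewrite big_nil.
rewrite big_cons -IH -[RHS]/(vadd _ _ x) -scD//; last exact: smooth_vsum.
by congr (A _ x); apply: vform_ext => y; rewrite big_cons.
Qed.

Lemma sc_wedge k (a : dform c M) v : smooth_form a -> homogeneous k a ->
  smooth_vform v -> A (vwedge a v) =
    vadd (vwedge (extd a) v) (vscale ((-1) ^+ k) (vwedge a (A v))).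
Proof. by have [_ _ +] := hA; apply. Qed.

(** A is odd, so it anticommutes with the degree involution. This is checked on the
    even and odd parts of v. *)
Lemma sc_vsign v : smooth_vform v -> vsign (A (vsign v)) = vscale (- 1) (A v).
Proof.
move=> vs; have vs' := smooth_vsign vs.
(* the part of v of parity b *)
pose h (b : bool) : vform E := vscale 2^-1 (vadd v (vscale ((-1) ^+ b) (vsign v))).
have hs b : smooth_vform (h b).
  exact: (smooth_vscale _ (smooth_vadd vs (smooth_vscale _ vs'))).
have hp b : vparity b (h b).
  apply/vparity_vsign; apply: vform_ext => x.
  rewrite /h vsignE /vscale /vadd /vscale !vsignE linearZ linearD linearZ/=.
  rewrite psgnK; last exact: grK.
  rewrite [RHS]scalerA mulrC -[RHS]scalerA; congr (_ *: _).
  by rewrite scalerDr scalerA -expr2 sqrr_sign scale1r addrC.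
have Ah b : vsign (A (h b)) = vscale ((-1) ^+ (~~ b)) (A (h b)).
  by apply/vparity_vsign; have [_ pA _] := hA; exact: (pA b (h b) (hs b) (hp b)).
have vE : v = vadd (h false) (h true).
  apply: vform_ext => x; rewrite /vadd /h /vscale /vadd -scalerDr.
  rewrite scale1r scaleN1r addrACA subrr addr0 -mulr2n -scaler_nat scalerA.
  by rewrite mulVf ?scale1r.
have vE' : vsign v = vadd (h false) (vscale (- 1) (h true)).
  apply: vform_ext => x; rewrite /vadd /h /vscale /vadd scaleN1r -scalerN -scalerDr.
  rewrite scale1r scaleN1r opprB [X in _ *: X]addrC addrA subrK.
  by rewrite -mulr2n -scaler_nat scalerA mulVf ?scale1r.
have hm := smooth_vscale (-1) (hs true).
rewrite vE' (scD (hs false) hm) (scZ _ (hs true)) [in RHS]vE (scD (hs false) (hs true)).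
apply: vform_ext => x; rewrite vsignE /vadd /vscale linearD linearZ/=.
by rewrite -!vsignE (Ah false) (Ah true) /vscale/= expr0 expr1 scale1r scaleN1r scalerDr
  !scaleN1r.
Qed.

Lemma vmulE f (v : vform E) : vmul f v = vwedge (fun0 f) v.
Proof. by apply: vform_ext => y; rewrite /vwedge wedge_fun0. Qed.

Lemma sc_vmul f v : smooth_fun f -> smooth_vform v ->
  A (vmul f v) = vadd (vwedge (extd (fun0 f)) v) (vmul f (A v)).
Proof.
move=> fs vs; rewrite vmulE (sc_wedge (k := 0))//; last 2 first.
- exact: smooth_fun0.
- exact: fun0_hom.
by congr vadd; apply: vform_ext => y; rewrite /vscale expr0 scale1r -vmulE.
Qed.

(** In the Leibniz rule for A twice, the two terms df /\ A v cancel and ddf = 0. *)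
Lemma sc2_vmul f v : smooth_fun f -> smooth_vform v ->
  A (A (vmul f v)) = vmul f (A (A v)).
Proof.
move=> fs vs; have sdf := smooth_extd_fun0 fs; have sAv := sc_smooth vs.
rewrite sc_vmul// scD; last 2 first.
- exact: smooth_vwedge.
- exact: smooth_vmul.
rewrite sc_vmul// (sc_wedge (k := 1))//; last exact: extd_hom (@fun0_hom _ _ _ _ _).
apply: vform_ext => x; rewrite /vadd /vscale /vwedge extd_extd_fun0//.
rewrite -[wedge 0 _]/(wedger _ (0 : ext n K^o)) linear0 add0r expr1 scaleN1r.
by rewrite addKr.
Qed.

Lemma sc2_df f v : smooth_fun f -> smooth_vform v ->
  A (A (vwedge (extd (fun0 f)) v)) = vwedge (extd (fun0 f)) (A (A v)).
Proof.
move=> fs vs; have sdf := smooth_extd_fun0 fs; have sAv := sc_smooth vs.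
have hdf : homogeneous 1 (extd (fun0 f)) := extd_hom (@fun0_hom _ _ _ _ _).
have ddf u : vwedge (extd (extd (fun0 f))) u = vform0 E.
  apply: vform_ext => x; rewrite /vwedge extd_extd_fun0//.
  by rewrite -[wedge 0 _]/(wedger _ (0 : ext n K^o)) linear0.
have add0 u : vadd (vform0 E) u = u.
  by apply: vform_ext => x; rewrite /vadd add0r.
rewrite (sc_wedge (k := 1))// ddf add0 scZ; last exact: smooth_vwedge.
rewrite (sc_wedge (k := 1))// ddf add0.
by apply: vform_ext => x; rewrite /vscale scalerA -expr2 expr1 sqrrN expr1n scale1r.
Qed.

Lemma sc2_smooth v : smooth_vform v -> smooth_vform (A (A v)).
Proof. by move=> vs; apply: sc_smooth; exact: sc_smooth. Qed.

(** The square commutes with functions and with differentials of functions. Near x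
    every form is a sum of products h dg_1 /\ ... /\ dg_k of global functions,
    obtained by extending the coordinates and the components of the form. *)
Lemma sc2_wedge (a : dform c M) v x : smooth_form a -> smooth_vform v ->
  A (A (vwedge a v)) x = wedge (a x) (A (A v) x).
Proof.
move=> sa vs; set i := chart_at x; have ix : dom i x := chart_atP x.
(* global functions that agree with the coordinates near x *)
have gex (j : 'I_n) : exists g : M -> K, smooth_fun g /\ \forall y \near x, g y = crdf c i j y.
  by have [g gs ge] := smooth_extend (smooth_crdf c j ix); exists g.
pose g j := projT1 (cid (gex j)).
have gs j : smooth_fun (g j) := (projT2 (cid (gex j))).1.
have ge j : \forall y \near x, g j y = crdf c i j y := (projT2 (cid (gex j))).2.
(* global functions that agree with the components of a near x *)
have hex (I : {set 'I_n}) : exists h : M -> K, smooth_fun h /\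
    \forall y \near x, h y = comps i y (a y) I.
  have /smooth_formP/(_ i x ix I)/smooth_extend[h hs he] := sa.
  by exists h.
pose h I := projT1 (cid (hex I)).
have hs I : smooth_fun (h I) := (projT2 (cid (hex I))).1.
have he I : \forall y \near x, h I y = comps i y (a y) I := (projT2 (cid (hex I))).2.
pose B (s : seq 'I_n) (u : vform E) : vform E :=
  foldr (fun j w => vwedge (extd (fun0 (g j))) w) u s.
have Bs s u : smooth_vform u -> smooth_vform (B s u).
  move=> us; elim: s => //= j s IH; apply: smooth_vwedge => //.
  exact: smooth_extd_fun0.
have AB s u : smooth_vform u -> A (A (B s u)) = B s (A (A u)).
  by move=> us; elim: s => //= j s IH; rewrite sc2_df ?IH//; exact: Bs.
have Bnear : \forall y \near x, forall s u, B s u y =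
    wedge (foldr (fun k w => wedge (covec ((fun k l => ofR c (jac (chart_at y) i y k l)) k)) w)
      (eone n K) s) (u y).
  have gnear : \forall y \near x, forall j, \forall z \near y, g j z = crdf c i j z.
    apply: (@filter_forall _ 'I_n (fun j y => \forall z \near y, g j z = crdf c i j z) (nbhs x)).
    by move=> j; exact: near_join (ge j).
  apply: filterS2 gnear (near_dom ix) => y gy iy s u.
  elim: s => [|j s IH] /=; first by rewrite wedge1.
  rewrite wedgeA -IH /vwedge; congr wedge.
  have gj : \forall z \near y, fun0 (g j) z = fun0 (crdf c i j) z.
    by apply: filterS (gy j) => z e; rewrite /fun0 e.
  rewrite (extd_eq gj) extd_fun0; last exact: smooth_crdf.
  by congr covec; apply/funext => l; rewrite jacE.
have aE : \forall y \near x, vwedge a v y =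
    \sum_(I : {set 'I_n}) vmul (h I) (B (enum I) v) y.
  have hnear : \forall y \near x, forall I, h I y = comps i y (a y) I.
    exact: (@filter_forall _ {set 'I_n} (fun I y => h I y = comps i y (a y) I) (nbhs x)).
  apply: filterS3 Bnear hnear (near_dom ix) => y By hy iy.
  rewrite /vwedge {1}(comps_inv (a y) iy) ext_substE.
  rewrite -[LHS]/(wedger _ _) linear_sum; apply: eq_bigr => I _.
  rewrite /vmul By hy /wedger -[RHS]/((_ : K) *: wedger (v y) _) -linearZ; congr (wedger _ _).
  by apply/ffunP => S; rewrite !ffunE; exact: mulrC.
(* psi localizes the expansion of a, which holds only near x; it does not change A^2
   at x because A^2 commutes with functions *)
have [psi [ps /nbhs_singleton p1 p0]] := bump_exists c aE.
have -> : A (A (vwedge a v)) x = A (A (vmul psi (vwedge a v))) x.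
  by rewrite sc2_vmul// /vmul ?p1 ?scale1r//; exact: smooth_vwedge.
have Ss (u : vform E) : smooth_vform u ->
    smooth_vform (fun y => \sum_(I : {set 'I_n}) vmul (h I) (B (enum I) u) y).
  by move=> us; apply: smooth_vsum => I _; apply: smooth_vmul => //; exact: Bs.
have -> : vmul psi (vwedge a v) =
    vmul psi (fun y => \sum_(I : {set 'I_n}) vmul (h I) (B (enum I) v) y).
  apply: vform_ext => y; rewrite /vmul; have [->//|/nbhs_singleton ->] := p0 y.
  by rewrite !scale0r.
rewrite sc2_vmul//; last exact: Ss.
rewrite /vmul p1 scale1r.
have -> : A (A (fun y => \sum_(I : {set 'I_n}) (h I y *: B (enum I) v y))) x =
    \sum_(I : {set 'I_n}) A (A (vmul (h I) (B (enum I) v))) x.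
  have e1 : A (fun y => \sum_(I : {set 'I_n}) (h I y *: B (enum I) v y)) =
      fun y => \sum_(I : {set 'I_n}) A (vmul (h I) (B (enum I) v)) y.
    apply: vform_ext => y; apply: (@sc_sum _ _ (fun I => vmul (h I) (B (enum I) v))) => I.
    by apply: smooth_vmul => //; exact: Bs.
  rewrite e1 (@sc_sum _ _ (fun I => A (vmul (h I) (B (enum I) v))))// => I.
  by apply: sc_smooth; apply: smooth_vmul => //; exact: Bs.
rewrite (eq_bigr (fun I : {set 'I_n} => vmul (h I) (B (enum I) (A (A v))) x)); last first.
  by move=> I _; rewrite sc2_vmul// ?AB//; exact: Bs.
have Bx := nbhs_singleton Bnear.
rewrite [in RHS](comps_inv (a x) ix) ext_substE -[RHS]/(wedger _ _) linear_sum.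
apply: eq_bigr => I _.
rewrite /vmul Bx (nbhs_singleton (he I)) -[LHS]/((_ : K) *: wedger (A (A v) x) _) -linearZ.
congr (wedger _ _).
by apply/ffunP => S; rewrite !ffunE; exact: mulrC.
Qed.

Lemma vconj_sc2 v : smooth_vform v -> vconj (fun v => A (A v)) v = A (A v).
Proof.
move=> vs; rewrite /vconj.
have e : A (vsign v) = vscale (- 1) (vsign (A v)).
  apply: (can_inj (@vsignK _ _ _ _ E)); rewrite sc_vsign//.
  apply: vform_ext => x; rewrite vsignE /vscale vsignE linearZ/= psgnK//.
  exact: grK.
rewrite e scZ; last by apply: smooth_vsign; exact: sc_smooth.
transitivity (vscale (-1) (vsign (A (vsign (A v))))).
  by apply: vform_ext => x; rewrite vsignE /vscale vsignE linearZ.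
rewrite sc_vsign; last exact: sc_smooth.
by apply: vform_ext => x; rewrite /vscale scalerA mulrNN mul1r scale1r.
Qed.

Lemma sc2_tensorial : tensorial (fun v => A (A v)).
Proof.
split=> [v vs|u v us vs|k a v sa ha vs].
- exact: sc2_smooth.
- by rewrite !scD//; exact: sc_smooth.
- apply: vform_ext => x; rewrite sc2_wedge// vconj_iter.
  by case: ifP => // _; rewrite vconj_sc2.
Qed.

Lemma vsign_add (u v : vform E) : vsign (vadd u v) = vadd (vsign u) (vsign v).
Proof. by apply: vform_ext => x; rewrite /vadd !vsignE linearD. Qed.

Lemma vsign_scale k (u : vform E) : vsign (vscale k u) = vscale k (vsign u).
Proof. by apply: vform_ext => x; rewrite /vscale !vsignE linearZ. Qed.

Definition esig (L : eform E) : eform E := fun x => psig (gr E x) (L x).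

Lemma act_esig (L : eform E) (v : vform E) : act (esig L) v = vsign (act L (vsign v)).
Proof.
apply: vform_ext => x; rewrite actE vsignE actE vsignE pact_sig//; exact: grK.
Qed.

Lemma esigK L : esig (esig L) = L.
Proof. by apply: eform_ext => x; rewrite /esig psigK//; exact: grK. Qed.

Lemma act_vadd (L : eform E) u v : act L (vadd u v) = vadd (act L u) (act L v).
Proof. by apply: vform_ext => x; rewrite /vadd !actE linearD. Qed.

Lemma act_vscale (L : eform E) k v : act L (vscale k v) = vscale k (act L v).
Proof. by apply: vform_ext => x; rewrite /vscale !actE linearZ. Qed.

Lemma act_vwedge (L : eform E) k (a : dform c M) v : homogeneous k a ->
  act L (vwedge a v) = vwedge a (act (iter k esig L) v).
Proof.
move=> ha; apply: vform_ext => x; rewrite /vwedge !actE.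
rewrite -(pact_iota (grK E x)) -pactM; last exact: grK.
rewrite (psig_hom_comm (grK E x) _ (ha x)) pactM; last exact: grK.
rewrite (pact_iota (grK E x)); congr (wedge _ (pact _ _ _)).
by elim: k {ha} => //= k ->.
Qed.

Lemma smooth_esig L : smooth_eform L -> smooth_eform (esig L).
Proof.
move=> sL; apply: smooth_eform_of_act => v vs; rewrite act_esig.
by apply: smooth_vsign; apply: smooth_act => //; exact: smooth_vsign.
Qed.

(** The supercommutator of A and L: when L is homogeneous, [esig L] is (-1)^|L| L.
    *)
Definition supercomm (L : eform E) (v : vform E) : vform E :=
  vsub (A (act L v)) (act (esig L) (A v)).

Lemma supercomm_conj L v : smooth_eform L -> smooth_vform v ->
  vconj (supercomm L) v = vscale (- 1) (supercomm (esig L) v).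
Proof.
move=> sL vs; rewrite /vconj /supercomm !vsubE vsign_add vsign_scale esigK.
have vs' := smooth_vsign vs.
have e1 : act L (vsign v) = vsign (act (esig L) v).
  by rewrite act_esig vsignK.
have e2 : vsign (act (esig L) (A (vsign v))) = act L (vsign (A (vsign v))).
  by rewrite act_esig vsignK.
rewrite e1 sc_vsign; last by apply: smooth_act => //; exact: smooth_esig.
rewrite e2 sc_vsign// act_vscale.
by apply: vform_ext => x; rewrite /vscale /vadd/vscale scalerDr.
Qed.

(** The two terms containing the differential of the form cancel. *)
Lemma supercomm_tensorial L : smooth_eform L -> tensorial (supercomm L).
Proof.
move=> sL; have sgL := smooth_esig sL; split=> [v vs|u v us vs|k a v sa ha vs].
- apply: smooth_vsub; first by apply: sc_smooth; exact: smooth_act.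
  by apply: smooth_act => //; exact: sc_smooth.
- rewrite /supercomm act_vadd !scD ?act_vadd//; try exact: smooth_act.
  by apply: vform_ext => x; rewrite /vsub /vadd opprD addrACA.
- rewrite vconj_iter {1}/supercomm (act_vwedge _ _ ha).
  have sk : smooth_eform (iter k esig L).
    by elim: k {ha} => [|k IH]; [exact: sL|exact: (smooth_esig IH)].
  rewrite (sc_wedge sa ha); last exact: smooth_act.
  rewrite (sc_wedge sa ha)// act_vadd act_vscale (act_vwedge _ _ ha).
  rewrite (act_vwedge _ _ (extd_hom ha)).
  have ik : iter k esig L = if odd k then esig L else L.
    by elim: k {ha sk} => //= k ->; case: (odd k) => //=; rewrite esigK.
  have iks : iter k esig (esig L) = esig (iter k esig L).
    by elim: k {ha sk ik} => //= k ->.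
  have ikss : iter k.+1 esig (esig L) = iter k esig L by rewrite iterS iks esigK.
  rewrite ikss iks ik.
  have vw (u w : vform E) x : vwedge a (vsub u w) x = vwedge a u x - vwedge a w x.
    by rewrite /vwedge /vsub linearB.
  case: ifP => ok; rewrite ?supercomm_conj//; apply: vform_ext => x;
    rewrite /vsub/vadd/vscale -signr_odd ok /vwedge /supercomm ?expr1 ?expr0 ?esigK.
    rewrite /vsub /vscale !scaleN1r linearN linearB/=.
    by rewrite opprK [in RHS]linearB/= opprB addrACA subrr add0r addrC.
  by rewrite /vsub /= !scale1r linearB/= opprD addrACA subrr add0r.
Qed.

End OneConnection.

Lemma sub_tensorial (A1 A0 : vform E -> vform E) :
  superconnection A1 -> superconnection A0 ->
  tensorial (fun v => vsub (A1 v) (A0 v)).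
Proof.
move=> h1 h0; split=> [v vs|u v us vs|k a v sa ha vs].
- by apply: smooth_vsub; [exact: (sc_smooth h1)|exact: (sc_smooth h0)].
- rewrite (scD h1 us vs) (scD h0 us vs); apply: vform_ext => x; rewrite /vsub /vadd opprD addrACA.
  by [].
- rewrite (sc_wedge h1 sa ha vs) (sc_wedge h0 sa ha vs) vconj_iter.
  have cE : vconj (fun v => vsub (A1 v) (A0 v)) v =
      vscale (- 1) (vsub (A1 v) (A0 v)).
    rewrite /vconj vsubE vsign_add vsign_scale (sc_vsign h1 vs) (sc_vsign h0 vs).
    by apply: vform_ext => x; rewrite /vadd /vscale /vsub !scaleN1r opprB opprK addrC.
  rewrite -[(-1) ^+ k]signr_odd; case: (odd k); rewrite ?cE; apply: vform_ext => x;
    rewrite /vsub/vadd/vscale/vwedge ?expr1 ?expr0 ?scale1r ?scaleN1r.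
    rewrite opprD addrACA subrr add0r opprK opprB [in RHS]linearB/= addrC.
    by [].
  by rewrite opprD addrACA subrr add0r [in RHS]linearB.
Qed.

End Superconnections.

(** * The supertrace *)

Section DualTrace.
Variables (K : fieldType) (V : vectType K).

(** A family with coordinate functions, without an independence condition. The
    supertrace is defined with bases of the two halves of a fibre and computed in
    the frame of the whole fibre, and both are of this kind. *)
Definition dual_system (I : finType) (e : I -> V) (eta : I -> {linear V -> K^o}) : Prop :=
  forall v, \sum_i (eta i v : K) *: e i = v.

Definition dual_trace (I : finType) (e : I -> V) (eta : I -> {linear V -> K^o})
  (f : {linear V -> V}) : K := \sum_i eta i (f (e i)).

Lemma dual_trace_indep (I J : finType) e eta h theta (f : {linear V -> V}) :
  @dual_system I e eta -> @dual_system J h theta ->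
  dual_trace e eta f = dual_trace h theta f.
Proof.
move=> de dh; rewrite /dual_trace.
transitivity (\sum_i \sum_j (theta j (e i) : K) * eta i (f (h j)) : K).
  apply: eq_bigr => i _; rewrite -{1}(dh (e i)) !linear_sum.
  by apply: eq_bigr => j _; rewrite !linearZ.
rewrite exchange_big/=; apply: eq_bigr => j _.
rewrite -[in RHS](de (f (h j))) linear_sum; apply: eq_bigr => i _.
by rewrite linearZ/= [RHS]mulrC.
Qed.

Lemma dual_traceC (I : finType) e eta (f g : 'End(V)) : @dual_system I e eta ->
  dual_trace e eta (f \o g)%VF = dual_trace e eta (g \o f)%VF.
Proof.
move=> de; have tr2 (p q : 'End(V)) : dual_trace e eta (p \o q)%VF =
    \sum_i \sum_j (eta j (q (e i)) : K) * eta i (p (e j)).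
  apply: eq_bigr => i _; rewrite -[LHS]/(eta i ((p \o q)%VF (e i))) comp_lfunE.
  rewrite -{1}(de (q (e i))) !linear_sum.
  by apply: eq_bigr => j _; rewrite !linearZ.
rewrite !tr2 exchange_big/=; apply: eq_bigr => j _; apply: eq_bigr => i _.
exact: mulrC.
Qed.

End DualTrace.

Section Supertrace.
Variables (R : realType) (c : bool) (n : nat) (M : manifold R n).
Variable E : superbundle c M.
Local Notation K := (scal R c).
Implicit Types (x y : M) (i : chart M) (t : triv E).

Definition ftr t x (f : 'End(fiber E x)) : K^o := \sum_(k : fidx t) eps k (f (ebas k x)).

Lemma ftr_linear t x : linear (@ftr t x).
Proof.
move=> a f g; rewrite /ftr scaler_sumr -big_split/=; apply: eq_bigr => k _.
by rewrite lfunE/= lfunE/= linearP.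
Qed.
HB.instance Definition _ t x :=
  GRing.isLinear.Build K 'End(fiber E x) K^o _ (@ftr t x) (@ftr_linear t x).

Lemma ftrC t x (f g : 'End(fiber E x)) : tdom t x ->
  ftr t (f \o g)%VF = ftr t (g \o f)%VF.
Proof.
move=> tx; apply: (@dual_traceC _ _ _ (fun k => ebas k x) (fun k => @eps _ _ _ _ E t k x)).
by move=> v; exact: ebas_eps.
Qed.

Definition blockf b x (f : 'End(fiber E x)) (v : fib E b x) : fib E b x :=
  part b (f (inj v)).

Lemma blockf_linear b x f : linear (@blockf b x f).
Proof. by move=> k u v; rewrite /blockf !linearP. Qed.
HB.instance Definition _ b x f :=
  GRing.isLinear.Build K (fib E b x) (fib E b x) _ (@blockf b x f) (@blockf_linear b x f).

Lemma basis_dual_system b x d (X : d.-tuple (fib E b x)) : basis_of fullv X ->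
  dual_system (fun k => tnth X k) (fun k => coord X k : {linear fib E b x -> K^o}).
Proof.
move=> /andP[/eqP sX _] v.
rewrite [RHS](coord_span (X := X)); last by rewrite sX memvf.
by apply: eq_bigr => k _; rewrite (tnth_nth 0).
Qed.

(** The supertrace is the trace after composition with the grading involution. In a
    frame it is visibly a smooth function of the entries and does not depend on the
    chosen bases. *)
Lemma strE t x (f : 'End(fiber E x)) : tdom t x -> str f = ftr t (gr E x \o f)%VF.
Proof.
move=> tx; pose G (b : bool) (k : 'I_(rk t b)) : K :=
  (-1) ^+ b * coord (frame t b x) k (blockf f (tnth (frame t b x) k)).
transitivity (\sum_b \sum_k G b k).
  have ptE b : partial_trace b f =
      \sum_k coord (frame t b x) k (blockf f (tnth (frame t b x) k)).
    have := @dual_trace_indep _ _ _ _ _ _ _ _ (@blockf b x f)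
      (basis_dual_system (vbasisP fullv)) (basis_dual_system (frame_basis b tx)).
    exact.
  rewrite /str !ptE big_bool/= addrC /G -!mulr_sumr expr0 expr1 mul1r mulN1r.
  by [].
rewrite (sig_big_dep xpredT (fun _ => xpredT) G)/=.
apply: eq_bigr => -[b k] _; rewrite /G comp_lfunE grE.
by rewrite -[RHS]/(eps _ (grading _)) eps_grading.
Qed.

Lemma str_linear x : linear (fun f : 'End(fiber E x) => str f : K^o).
Proof.
have [t tx] := tdom_cover E x => k f g.
by rewrite !(strE _ tx) comp_lfunDr -comp_lfunZr linearP.
Qed.
HB.instance Definition _ x :=
  GRing.isLinear.Build K 'End(fiber E x) K^o _ (@str R c n M E x : _ -> K^o) (@str_linear x).

Definition emul (L N : eform E) : eform E := fun x => pmul (gr E x) (L x) (N x).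

Lemma StrE t (L : eform E) x : tdom t x -> Str L x = pstr (gr E x) (@ftr t x) (L x).
Proof. by move=> tx; apply/ffunP => S; rewrite !ffunE (strE _ tx). Qed.

Lemma Str_supercomm (p : bool) (L N : eform E) :
  esig L = (fun x => (-1) ^+ p *: L x) ->
  Str (emul L N) = Str (emul (iter p (@esig _ _ _ _ E) N) L).
Proof.
move=> sL; apply/funext => x; have [t tx] := tdom_cover E x.
rewrite !(StrE _ tx) /emul.
rewrite (@pstr_supercomm _ _ _ _ (grK E x) _ _ p); first by case: p {sL}.
  by move=> f h; exact: ftrC.
by have /(congr1 (fun f : eform E => f x)) := sL.
Qed.

Lemma smooth_Str (L : eform E) : smooth_eform L -> smooth_form (Str L).
Proof.
move=> /smooth_eformP sL; apply/smooth_formP => i x ix S.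
have [t tx] := tdom_cover E x.
have tn : \forall y \near x, tdom t y.
  by apply: open_nbhs_nbhs; split=> //; exact: tdom_open.
apply: (@smooth_at_eq _ _ _ _ _ (fun y => \sum_(k : fidx t) (-1) ^+ tag k *
    eps k ((comps i y (L y) S : 'End(fiber E y)) (ebas k y)))); last first.
  apply: smooth_at_sum => k _; apply: smooth_atM; first exact: smooth_at_cst.
  exact: sL.
apply: filterS tn => y ty; rewrite /Str comps_map [RHS]ffunE -[RHS]/(str _) (strE _ ty) /ftr.
apply: eq_bigr => k _; rewrite comp_lfunE grE.
by rewrite -[RHS]/(eps _ (grading _)) eps_grading.
Qed.

Definition eiota (a : dform c M) : eform E := fun x => piota (fiber E x) (a x).

Lemma Str_eiota (a : dform c M) (L : eform E) : Str (emul (eiota a) L) = fwedge a (Str L).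
Proof.
apply/funext => x; apply/ffunP => S; rewrite !ffunE linear_sum; apply: eq_bigr => I _.
rewrite linearZ/= /mulm ffunE linearZ/= conjg1; last exact: grK.
rewrite -comp_lfunZl comp_lfun1l linearZ/= ffunE.
by rewrite scalerA.
Qed.

Definition ptw (w : ext n K^o) : ext n K^o := [ffun S : {set 'I_n} => (-1) ^+ #|S| * w S : K].

Lemma ptw_linear : linear ptw.
Proof.
move=> k u v; apply/ffunP => S; rewrite !ffunE mulrDr /GRing.scale/=.
by congr (_ + _); exact: mulrCA.
Qed.
HB.instance Definition _ :=
  GRing.isLinear.Build K (ext n K^o) (ext n K^o) _ ptw ptw_linear.

Lemma ptw_hom d (w : ext n K^o) : hom_deg d w -> ptw w = (-1) ^+ d *: w.
Proof.
move=> hw; apply/ffunP => S; rewrite !ffunE.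
have [->//|Sd] := eqVneq #|S| d.
by rewrite hw// mulr0 [RHS]mulr0.
Qed.

(** The Leibniz rule for forms that are not homogeneous, one degree at a time. *)
Lemma sc_wedge_gen (A : vform E -> vform E) (a : dform c M) v x : superconnection A ->
  smooth_form a -> smooth_vform v ->
  A (vwedge a v) x = wedge (extd a x) (v x) + wedge (ptw (a x)) (A v x).
Proof.
move=> hA sa vs.
have sd (d : 'I_n.+1) : smooth_form (fun y => degpart d (a y)) by exact: smooth_degpart.
have -> : vwedge a v = (fun y => \sum_(d < n.+1) vwedge (fun y => degpart d (a y)) v y).
  apply: vform_ext => y; rewrite /vwedge {1}[a y]degpart_sum.
  by rewrite -[LHS]/(wedger _ _) linear_sum.
rewrite (@sc_sum _ _ _ _ _ _ hA _ _ (fun d : 'I_n.+1 => vwedge (fun y => degpart d (a y)) v));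
  last first.
  by move=> d; exact: smooth_vwedge.
have -> : extd a x = \sum_(d < n.+1) extd (fun y => degpart d (a y)) x.
  rewrite -extd_sum//; apply: extd_eq; apply: filterE => y.
  exact: degpart_sum.
rewrite [a x]degpart_sum linear_sum/=.
rewrite -[wedge (\sum_d _) (v x)]/(wedger _ _) -[wedge (\sum_d _) (A v x)]/(wedger _ _).
rewrite !linear_sum -big_split/=; apply: eq_bigr => d _.
rewrite (sc_wedge hA (k := d))//; last by move=> y; exact: degpart_hom.
rewrite /vadd /vscale /vwedge /wedger (ptw_hom (@degpart_hom _ _ _ _ _)).
by rewrite -[wedge (_ *: _) (A v x)]/(wedger _ _) linearZ.
Qed.

Lemma pact_odd_wedge x (N : ext n 'End(fiber E x)) (w : ext n K^o) u :
  psig (gr E x) N = - N ->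
  pact (gr E x) N (wedge w u) = wedge (ptw w) (pact (gr E x) N u).
Proof.
move=> oN; rewrite {1}[w]degpart_sum [in RHS](degpart_sum w) !linear_sum/=.
rewrite -[wedge _ u]/(wedger _ _) -[RHS]/(wedger _ _) !linear_sum; apply: eq_bigr => d _.
rewrite -[LHS]/(pact (gr E x) N (wedge _ _)) -(pact_iota (grK E x)) -pactM; last exact: grK.
rewrite (psig_hom_comm (grK E x) _ (@degpart_hom _ _ _ _ _)) pactM; last exact: grK.
rewrite (pact_iota (grK E x)) /wedger (ptw_hom (@degpart_hom _ _ _ _ _)).
have -> : iter d (psig (gr E x)) N = (-1) ^+ d *: N.
  elim: (d : nat) => [|j /= ->]; first by rewrite scale1r.
  by rewrite linearZ/= oN exprS mulN1r scaleNr scalerN.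
rewrite pactZl linearZ/=.
by rewrite -[RHS]/(wedger _ _) linearZ.
Qed.

Lemma extd_cutoff (f : M -> K) x : (\forall y \near x, f y = 1) -> extd (fun0 f) x = 0.
Proof.
move=> f1; have e : \forall y \near x, fun0 f y = fun0 (fun=> 1) y.
  by apply: filterS f1 => y fy; rewrite /fun0 fy.
rewrite (extd_eq e) extd_fun0; last exact: smooth_at_cst.
apply/ffunP => S; rewrite !ffunE big1// => j _; exact: PD_cst.
Qed.

(** In a frame A = d + N with N odd, so [A, L] is the matrix of differentials of the
    entries of L plus the supercommutator of N and L, and the supertrace of the
    latter vanishes. *)
Lemma Str_supercomm_extd (A : vform E -> vform E) (L D : eform E) :
  superconnection A -> smooth_eform L ->
  (forall v, smooth_vform v -> supercomm A L v = act D v) ->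
  Str D = extd (Str L).
Proof.
move=> hA sL hD; apply/funext => x.
have [t tx] := tdom_cover E x; have [phi cphi] := cutoff_exists tx.
have [ps p1 p0] := cphi; have px := nbhs_singleton p1.
pose s k := sect phi (t := t) k.
have ss k : smooth_vform (s k) := smooth_sect k cphi.
have sx k : s k x = etens (eone n K) (ebas k x) by rewrite /s /sect px scale1r.
pose lam l k := coef phi (t := t) l (act L (s k)).
have sLs k : smooth_vform (act L (s k)) by exact: smooth_act.
have slam l k : smooth_form (lam l k) := smooth_coef l cphi (sLs k).
have Lk k : pact (gr E x) (L x) (etens (eone n K) (ebas k x)) =
    \sum_l wedge (lam l k x) (etens (eone n K) (ebas l x)).
  have := sum_coef_sect (act L (s k)) x cphi.
  rewrite px mulr1 scale1r actE sx => <-.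
  by apply: eq_bigr => l _; rewrite /sect px scale1r.
(* N is the connection matrix at x, Dl the matrix of the differentials of the
   entries of L *)
pose N := from_frame (fun k => A (s k) x).
have Nk k : pact (gr E x) N (etens (eone n K) (ebas k x)) = A (s k) x := from_frameE _ k tx.
pose Dl := from_frame (fun k => \sum_l wedge (extd (lam l k) x) (etens (eone n K) (ebas l x))).
have Dk k : pact (gr E x) Dl (etens (eone n K) (ebas k x)) =
    \sum_l wedge (extd (lam l k) x) (etens (eone n K) (ebas l x)) := from_frameE _ k tx.
have oN : psig (gr E x) N = - N.
  apply: (pact_frame_inj tx) => k; rewrite (pact_sig (grK E x)).
  have := psgn_ebas k x 1; rewrite scale1r => ->.
  rewrite !linearZ/= Nk.
  have := sc_vsign hA (smooth_vsign (ss k)); rewrite vsignK vsign_sect (scZ hA)//.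
  move=> /(congr1 (fun f : vform E => f x)); rewrite vsignE /vscale => ->.
  by rewrite scaleN1r scalerN scalerA -expr2 sqrr_sign scale1r pactNl Nk.
have DE : D x = Dl + (pmul (gr E x) N (L x) - pmul (gr E x) (psig (gr E x) (L x)) N).
  apply: (pact_frame_inj tx) => k.
  rewrite !pactDl pactNl.
  rewrite Dk pactM; last exact: grK.
  rewrite pactM; last exact: grK.
  rewrite Nk Lk linear_sum.
  have := hD _ (ss k) => /(congr1 (fun f : vform E => f x)).
  rewrite actE sx => <-.
  rewrite /supercomm /vsub actE /esig.
  have -> : A (act L (s k)) x = A (vmul (fun y => phi y * phi y) (act L (s k))) x.
    have phi2 : smooth_fun (fun y => phi y * phi y).
      by apply/smooth_funP => y; apply: smooth_atM; exact: (proj1 (smooth_funP _) ps).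
    rewrite (sc_vmul hA)// /vadd /vmul px mulr1 scale1r /vwedge extd_cutoff.
      by rewrite -[wedge 0 _]/(wedger _ (0 : ext n K^o)) linear0 add0r.
    by apply: filterS p1 => y ->; rewrite mulr1.
  have -> : vmul (fun y => phi y * phi y) (act L (s k)) =
      (fun y => \sum_l vwedge (lam l k) (s l) y).
    by apply: vform_ext => y; rewrite /vmul -(sum_coef_sect (act L (s k)) y cphi).
  rewrite (@sc_sum _ _ _ _ _ _ hA _ _ (fun l => vwedge (lam l k) (s l))); last first.
    by move=> l; exact: smooth_vwedge.
  rewrite [RHS]addrA; congr (_ - _); rewrite -big_split/=.
  apply: eq_bigr => l _; rewrite sc_wedge_gen// sx; congr (_ + _).
  by rewrite pact_odd_wedge// Nk.
rewrite (StrE _ tx) DE.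
have strD (u v : ext n 'End(fiber E x)) :
    pstr (gr E x) (@ftr t x) (u + v) = pstr (gr E x) (@ftr t x) u + pstr (gr E x) (@ftr t x) v.
  by apply/ffunP => S; rewrite !ffunE comp_lfunDr linearD.
have strN (v : ext n 'End(fiber E x)) :
    pstr (gr E x) (@ftr t x) (- v) = - pstr (gr E x) (@ftr t x) v.
  by apply/ffunP => S; rewrite !ffunE comp_lfunNr linearN.
rewrite !strD strN (@pstr_supercomm _ _ _ _ (grK E x) _ _ true); last 2 first.
- by move=> f h; exact: ftrC.
- by rewrite oN expr1 scaleN1r.
rewrite /= subrr addr0.
transitivity (\sum_(k : fidx t) (-1) ^+ tag k *: extd (lam k k) x).
  apply/ffunP => S; rewrite ffunE /ftr sum_ffunE; apply: eq_bigr => k _.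
  rewrite comp_lfunE grE -[LHS]/(eps k (grading _)) eps_grading [RHS]ffunE.
  apply: (congr1 (fun z : K => (-1) ^+ tag k * z)).
  have := Dk k => /ffunP/(_ S); rewrite pact_etens1 => ->.
  rewrite sum_ffunE linear_sum (bigD1 k)//= big1 ?addr0.
    by rewrite etens_as_conv ffunE linearZ/= eps_ebas// eqxx [LHS]mulr1.
  move=> l lk; rewrite etens_as_conv ffunE linearZ/= eps_ebas//.
  by rewrite eq_sym (negbTE lk) [LHS]mulr0.
transitivity (extd (fun y => \sum_(k : fidx t) (-1) ^+ tag k *: lam k k y) x).
  rewrite (@extd_sum _ _ _ _ _ _ _ (fun (k : fidx t) y => (-1) ^+ tag k *: lam k k y)).
    by apply: eq_bigr => k _; rewrite extdZ.
  by move=> k _; exact: smooth_formZ.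
apply: extd_eq.
have tn : \forall y \near x, tdom t y.
  by apply: open_nbhs_nbhs; split=> //; exact: tdom_open.
apply: filterS2 p1 tn => y py ty; rewrite (StrE _ ty); apply/ffunP => S.
rewrite sum_ffunE ffunE; apply: eq_bigr => k _.
rewrite comp_lfunE grE -[RHS]/(eps k (grading _)) eps_grading [LHS]ffunE.
apply: (congr1 (fun z : K => (-1) ^+ tag k * z)).
by rewrite ffunE py mul1r actE /s /sect py scale1r pact_etens1.
Qed.

End Supertrace.

(** * Curved derivations with a trace *)

(** This section abstracts from a primitive superconnection (A, B): Th is A^2, dl
    the supercommutator with A, sg the degree involution, tau the supertrace and W
    the symplectic form. Then F and C are the two entries of the square of the
    primitive superconnection, and a and b are the variations of A and B. *)
Section CurvedAlgebra.
Variables (A : pzRingType) (V : zmodType) (sg dl : A -> A) (tau : A -> V).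
Variables (Th B W a b F C : A).
Hypothesis sgD : {morph sg : x y / x + y}.
Hypothesis sgM : {morph sg : x y / x * y}.
Hypothesis sg1 : sg 1 = 1.
Hypothesis dlD : {morph dl : x y / x + y}.
Hypothesis dlM : forall x y, dl (x * y) = dl x * y + sg x * dl y.
Hypothesis sg_dl : forall x, sg (dl x) = - dl (sg x).
Hypothesis dl_dl : forall x, dl (dl x) = Th * x - x * Th.
Hypothesis dl_Th : dl Th = 0.
Hypothesis WC : forall x, W * x = x * W.
Hypothesis dl_W : dl W = 0.
Hypothesis tauD : {morph tau : x y / x + y}.
Hypothesis tau_even : forall x y, sg x = x -> tau (x * y) = tau (y * x).
Hypothesis sg_Th : sg Th = Th.
Hypothesis sg_B : sg B = B.
Hypothesis sg_W : sg W = W.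
Hypothesis sg_a : sg a = - a.
Hypothesis sg_b : sg b = b.
Hypothesis curvE : F = Th + W * B.
Hypothesis dpotE : C = - dl B.

Local Lemma morph0 (U : zmodType) (h : A -> U) : {morph h : x y / x + y} -> h 0 = 0.
Proof.
move=> hD; have := hD 0 0; rewrite addr0 => /eqP.
by rewrite -subr_eq0 opprD addrA subrr sub0r oppr_eq0 => /eqP.
Qed.

Local Lemma morphN (U : zmodType) (h : A -> U) : {morph h : x y / x + y} -> {morph h : x / - x}.
Proof.
move=> hD x; apply/eqP; rewrite -addr_eq0 -hD addrC subrr.
by rewrite (morph0 hD).
Qed.

Let dl0 := morph0 dlD.
Let dlN := morphN dlD.
Let sgN := morphN sgD.
Let tau0 := morph0 tauD.
Let tauN := morphN tauD.

(** The sum of F^i X F^j over i + j + 1 = k: both the lower left entry of the k-th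
    power of a triangular matrix with entries F and X, and the derivative of F^k in
    the direction X. *)
Fixpoint power_deriv (F0 : A) (k : nat) (X : A) : A :=
  if k is m.+1 then X * F0 ^+ m + F0 * power_deriv F0 m X else 0.

Local Notation N := (power_deriv F).

Lemma sg_curv : sg F = F.
Proof. by rewrite curvE sgD sgM sg_Th sg_W sg_B. Qed.

Lemma sg_dpot : sg C = - C.
Proof. by rewrite dpotE sgN sg_dl sg_B. Qed.

Lemma power_deriv_alt m X : N m.+1 X = F ^+ m * X + N m X * F.
Proof.
elim: m X => [|m IH] X; first by rewrite /= expr0 mulr1 mul1r mulr0 mul0r.
have NS j : N j.+1 X = X * F ^+ j + F * N j X by [].
rewrite [LHS]NS {1}IH NS mulrDr [in RHS]mulrDl !mulrA -exprS.
by rewrite -[X * F ^+ m * F]mulrA -exprSr addrCA.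
Qed.

Lemma power_deriv_mulr m X : N m (X * F) = N m X * F.
Proof.
elim: m X => [|m IH] X /=; first by rewrite mul0r.
by rewrite IH mulrDl !mulrA -[X * F * _]mulrA -exprS -[X * _ * F]mulrA -exprSr.
Qed.

Lemma power_deriv_self m : N m F = F ^+ m *+ m.
Proof.
elim: m => [|m IH] /=; first by rewrite mulr0n.
by rewrite IH mulrnAr -!exprS mulrS.
Qed.

Lemma tau_power_deriv_swap k X Y : tau (N k X * Y) = tau (X * N k Y).
Proof.
elim: k Y => [|m IH] Y; first by rewrite /= mul0r mulr0.
rewrite (power_deriv_alt m Y) /= mulrDl mulrDr !tauD !mulrA; congr (_ + _).
by rewrite -!mulrA (tau_even _ sg_curv) -mulrA IH power_deriv_mulr.
Qed.

(** By cyclicity all summands F^i X F^j have the same image under tau. *)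
Lemma tau_power_deriv m X : tau (N m.+1 X) = tau (X * F ^+ m) *+ m.+1.
Proof.
rewrite /= tauD (tau_even _ sg_curv) tau_power_deriv_swap power_deriv_self.
rewrite mulrS; congr (_ + _).
elim: (m) {1 3}(m) => [|k IH] j; first by rewrite !mulr0n mulr0 tau0.
by rewrite !mulrS mulrDr tauD IH.
Qed.

Lemma dl_one : dl 1 = 0.
Proof.
have := dlM 1 1; rewrite !mulr1 sg1 mul1r => /eqP.
by rewrite -subr_eq0 opprD addrA subrr sub0r oppr_eq0 => /eqP.
Qed.

Lemma dl_curvX k : dl (F ^+ k) = N k (dl F).
Proof.
elim: k => [|k IH]; first by rewrite expr0 dl_one.
by rewrite exprS dlM sg_curv IH.
Qed.

(** The Bianchi identity: A^2 and W are annihilated by dl. *)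
Lemma dl_curv : dl F = - (W * C).
Proof. by rewrite curvE dlD dl_Th add0r dlM dl_W mul0r add0r sg_W dpotE mulrN opprK. Qed.

Lemma power_derivW k X : N k (- (W * X)) = - (W * N k X).
Proof.
elim: k => [|k IH] /=; first by rewrite mulr0 oppr0.
by rewrite IH mulrN mulNr !mulrDr opprD -!mulrA; congr (_ - _); rewrite mulrA -WC mulrA.
Qed.

Lemma dl_curvXW k : dl (F ^+ k) = - (W * N k C).
Proof. by rewrite dl_curvX dl_curv power_derivW. Qed.

Lemma dl_power_deriv_dpot k : dl (N k C) = N k (dl C).
Proof.
elim: k => [|k IH]; first exact: dl0.
rewrite [N k.+1 C]/= [RHS]/= dlD !dlM sg_curv IH sg_dpot dl_curvXW dl_curv.
rewrite mulrN !mulNr opprK -addrA; congr (_ + _).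
by rewrite addrA mulrA -(WC C) subrr add0r.
Qed.

Lemma comm_powerX k : B * F ^+ k - F ^+ k * B = N k (B * F - F * B).
Proof.
elim: k => [|k IH]; first by rewrite expr0 mulr1 mul1r subrr.
rewrite /= -IH mulrBl mulrBr exprS !mulrA addrA; congr (_ - _).
by rewrite subrK.
Qed.

(** The square of dl is the commutator with Th, which may be replaced by F because W
    * B commutes with B. *)
Lemma dl_dpot : dl C = B * F - F * B.
Proof.
rewrite dpotE dlN dl_dl opprB curvE mulrDr mulrDl [B * (W * B)]mulrA -(WC B).
by rewrite opprD addrACA subrr addr0.
Qed.

(** The inner terms F^i (B F - F B) F^j telescope. *)
Lemma dl_power_deriv k : dl (N k C) = B * F ^+ k - F ^+ k * B.
Proof. by rewrite dl_power_deriv_dpot dl_dpot comm_powerX. Qed.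

Lemma tau_dl_curvX k : tau (dl (F ^+ k)) = - tau (W * N k C).
Proof. by rewrite dl_curvXW tauN. Qed.

Lemma tau_dl_power_deriv k : tau (dl (N k C)) = 0.
Proof.
by rewrite dl_power_deriv tauD tauN (tau_even _ sg_B) subrr.
Qed.

Local Notation F' := (dl a + W * b).
Local Notation C' := (- dl b - (a * B - B * a)).

Lemma sg_curv_deriv : sg F' = F'.
Proof. by rewrite sgD sg_dl sgM sg_W sg_b sg_a dlN opprK. Qed.

(** [dl a + W * b] is the variation of F. The term with C comes from dl (F^m),
    because a is odd. *)
Lemma tau_transgression1 m : tau (F' * F ^+ m) =
  tau (dl (a * F ^+ m)) + tau (W * (b * F ^+ m - a * N m C)).
Proof.
have aWN : a * (W * N m C) = W * (a * N m C) by rewrite mulrA -(WC a) -mulrA.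
rewrite dlM sg_a dl_curvXW mulrN mulNr opprK aWN.
rewrite mulrBr mulrDl -(mulrA W b) !tauD tauN -addrA; congr (_ + _).
by rewrite addrC subrK.
Qed.

(** The first factor on the left is the variation of C, so that, up to the factor m
    + 1, this is the variation of tau (N_(m+1) C). *)
Lemma tau_transgression2 m : tau (C' * F ^+ m + C * N m F') =
  - tau (dl (b * F ^+ m - a * N m C)).
Proof.
have bN : tau (b * dl (F ^+ m)) = - tau (W * (b * N m C)).
  by rewrite dl_curvXW mulrN tauN mulrA -(WC b) -mulrA.
have aN : tau (a * dl (N m C)) = tau ((a * B - B * a) * F ^+ m).
  rewrite dl_power_deriv mulrBr mulrBl !mulrA !tauD !tauN; congr (_ - _).
  by rewrite -[in RHS]mulrA -(tau_even _ sg_B) mulrA.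
have CN : tau (C * N m F') = tau (dl a * N m C) + tau (W * (b * N m C)).
  rewrite -tau_power_deriv_swap -(tau_even _ sg_curv_deriv) mulrDl tauD.
  by rewrite -mulrA.
rewrite tauD CN mulrBl mulNr !tauD !tauN -aN dlD dlN !dlM sg_b sg_a mulNr !tauD.
rewrite !tauN bN tauD tauN.
by rewrite !opprB [RHS]addrACA [LHS]addrC; congr (_ + _); exact: addrC.
Qed.

End CurvedAlgebra.

(** * Extension of scalars for forms *)

Section ScalarExtension.
Variables (R : realType) (c c' : bool) (n : nat) (M : manifold R n).
Hypothesis cc' : c ==> c'.
Implicit Types (x y : M) (i : chart M).

(** The supertraces have coefficients in the ground field of the bundle, the
    polynomial has complex ones; emb is the inclusion, and extends to forms
    compatibly with the whole calculus. *)
Definition emb (z : scal R c) : scal R c' := mkK c' (reK z) (imK z).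

Lemma reK_emb z : reK (emb z) = reK z. Proof. by rewrite /emb reK_mkK. Qed.
Lemma imK_emb z : imK (emb z) = imK z.
Proof.
rewrite /emb imK_mkK// => c0; apply: imK_real.
by move: cc'; rewrite c0; case: (c).
Qed.

Lemma embD : {morph emb : z w / z + w}.
Proof. by move=> z w; apply: K_ext; rewrite ?(reKD, imKD, reK_emb, imK_emb). Qed.
Lemma embM : {morph emb : z w / z * w}.
Proof. by move=> z w; apply: K_ext; rewrite ?(reKM, imKM, reK_emb, imK_emb). Qed.
Lemma emb0 : emb 0 = 0.
Proof. by apply: K_ext; rewrite ?(reK_emb, imK_emb, reK0, imK0). Qed.
Lemma emb1 : emb 1 = 1.
Proof. by apply: K_ext; rewrite ?(reK_emb, imK_emb, reK1, imK1). Qed.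
Lemma embN : {morph emb : z / - z}.
Proof. by move=> z; apply: K_ext; rewrite ?(reKN, imKN, reK_emb, imK_emb). Qed.
Lemma emb_ofR (a : R) : emb (ofR c a) = ofR c' a.
Proof. by apply: K_ext; rewrite ?(reK_emb, imK_emb, reK_ofR, imK_ofR). Qed.
Lemma emb_bool (b : bool) : emb b%:R = b%:R.
Proof. by case: b; rewrite ?emb0 ?emb1. Qed.
Lemma emb_sign k : emb ((-1) ^+ k) = (-1) ^+ k.
Proof. by elim: k => [|k IH]; rewrite ?expr0 ?emb1// !exprS embM embN emb1 IH. Qed.
Lemma emb_sum (I : Type) (r : seq I) (P : pred I) (F : I -> scal R c) :
  emb (\sum_(i <- r | P i) F i) = \sum_(i <- r | P i) emb (F i).
Proof. exact: (big_morph _ embD emb0). Qed.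

Definition ext_emb (a : ext n (scal R c)^o) : ext n (scal R c')^o :=
  [ffun S => emb (a S)].

Lemma ext_embD : {morph ext_emb : u v / u + v}.
Proof. by move=> u v; apply/ffunP => S; rewrite !ffunE embD. Qed.

Lemma ext_emb0 : ext_emb 0 = 0.
Proof. by apply/ffunP => S; rewrite !ffunE emb0. Qed.

Lemma ext_emb_wedge a b : ext_emb (wedge a b) = wedge (ext_emb a) (ext_emb b).
Proof.
apply/ffunP => S; rewrite !ffunE emb_sum; apply: eq_bigr => I _.
by rewrite !ffunE [LHS]embM embM emb_sign.
Qed.

Lemma ext_emb_covec u : ext_emb (covec u) = covec (fun l => emb (u l)).
Proof. by apply/ffunP => S; rewrite !ffunE emb_sum. Qed.

Lemma ext_emb_subst_basis J I :
  ext_emb (subst_basis J I) = subst_basis (fun k l => emb (J k l)) I.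
Proof.
rewrite /subst_basis; elim: (enum I) => [|k s IH] /=.
  by apply/ffunP => S; rewrite !ffunE emb_bool.
by rewrite ext_emb_wedge ext_emb_covec IH.
Qed.

Lemma ext_emb_subst J (a : ext n (scal R c)^o) :
  ext_emb (ext_subst J a) = ext_subst (fun k l => emb (J k l)) (ext_emb a).
Proof.
apply/ffunP => S; rewrite !ffunE emb_sum; apply: eq_bigr => I _.
by rewrite [LHS]embM -ext_emb_subst_basis !ffunE.
Qed.

Lemma comps_emb i y (a : ext n (scal R c)^o) :
  comps i y (ext_emb a) = ext_emb (comps i y a).
Proof.
rewrite !compsE ext_emb_subst; congr ext_subst.
by apply/funext => k; apply/funext => l; rewrite emb_ofR.
Qed.

Lemma smooth_at_emb x (f : M -> scal R c) :
  smooth_at x f -> smooth_at x (fun y => emb (f y)).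
Proof.
move=> [h1 h2]; split.
  by under eq_fun do rewrite reK_emb.
by under eq_fun do rewrite imK_emb.
Qed.

Lemma PD_emb i j x (f : M -> scal R c) :
  PD i j (fun y => emb (f y)) x = emb (PD i j f x).
Proof.
apply: K_ext.
  rewrite reK_emb 2!reK_partial.
  by under eq_fun do rewrite reK_emb.
rewrite imK_emb 2!imK_partial.
by under eq_fun do rewrite imK_emb.
Qed.

Definition form_emb (a : dform c M) : dform c' M := fun x => ext_emb (a x).

Lemma smooth_form_emb a : smooth_form a -> smooth_form (form_emb a).
Proof.
move=> /smooth_formP ha; apply/smooth_formP => i x ix S.
rewrite /form_emb; under eq_fun do rewrite comps_emb ffunE.
by apply: smooth_at_emb; exact: ha.
Qed.

Lemma homogeneous_emb k a : homogeneous k a -> homogeneous k (form_emb a).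
Proof. by move=> ha x S Sk; rewrite ffunE ha// emb0. Qed.

Lemma extd_emb a x : extd (form_emb a) x = ext_emb (extd a x).
Proof.
rewrite !extdE (big_morph _ ext_embD ext_emb0); apply: eq_bigr => j _.
rewrite ext_emb_wedge ext_emb_covec; congr wedge.
  by congr covec; apply/funext => l; rewrite emb_bool.
apply/ffunP => S; rewrite !ffunE -PD_emb; congr (PD _ _ _ x).
by apply/funext => y; rewrite /form_emb comps_emb ffunE.
Qed.

End ScalarExtension.

(** * The ring of smooth endomorphism-valued forms *)

Section SmoothEndForms.
Variables (R : realType) (c : bool) (n : nat) (M : manifold R n).
Variable E : superbundle c M.
Local Notation K := (scal R c).
Implicit Types (x y : M) (i : chart M) (t : triv E).

(** Restricting to smooth forms gives a ring, in which the computations of the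
    preceding sections are purely algebraic. *)
Record sef := Sef { sefv :> eform E ; sef_smooth : smooth_eform sefv }.

Lemma sef_ext (L N : sef) : (forall x, sefv L x = sefv N x) -> L = N.
Proof.
case: L N => L Ls [N Ns] /= /eform_ext e; case: _ / e Ns => Ns.
by congr Sef; exact: Prop_irrelevance.
Qed.

Lemma sef_act_inj (L N : sef) :
  (forall v, smooth_vform v -> act L v = act N v) -> L = N.
Proof. by move=> /act_inj e; apply: sef_ext => x; rewrite e. Qed.

Lemma smooth_sef_act (L : sef) v : smooth_vform v -> smooth_vform (act L v).
Proof. exact/smooth_act/sef_smooth. Qed.

Definition eform_add (L N : eform E) : eform E := fun x => L x + N x.
Definition eform_scale (z : K) (L : eform E) : eform E := fun x => z *: L x.
Definition eform_zero : eform E := fun=> 0.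
Definition eform_one : eform E := fun x => pone n (fiber E x).

Lemma act_add (L N : eform E) (v : vform E) : act (eform_add L N) v = vadd (act L v) (act N v).
Proof. by apply: vform_ext => x; rewrite /vadd !actE pactDl. Qed.

Lemma act_scale z (L : eform E) (v : vform E) : act (eform_scale z L) v = vscale z (act L v).
Proof. by apply: vform_ext => x; rewrite /vscale !actE pactZl. Qed.

Lemma act_zero (v : vform E) : act eform_zero v = vform0 E.
Proof. by apply: vform_ext => x; rewrite !actE pact0l. Qed.

Lemma act_one (v : vform E) : act eform_one v = v.
Proof. by apply: vform_ext => x; rewrite actE pact1//; exact: grK. Qed.

Lemma act_emul (L N : eform E) (v : vform E) : act (emul L N) v = act L (act N v).
Proof. by apply: vform_ext => x; rewrite !actE pactM//; exact: grK. Qed.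

Lemma smooth_eform_add (L N : eform E) : smooth_eform L -> smooth_eform N -> smooth_eform
  (eform_add L N).
Proof.
move=> sL sN; apply: smooth_eform_of_act => v vs; rewrite act_add.
by apply: smooth_vadd; exact: smooth_act.
Qed.

Lemma smooth_eform_scale z (L : eform E) : smooth_eform L -> smooth_eform (eform_scale z L).
Proof.
move=> sL; apply: smooth_eform_of_act => v vs; rewrite act_scale.
by apply: smooth_vscale; exact: smooth_act.
Qed.

Lemma smooth_eform_zero : smooth_eform eform_zero.
Proof.
apply: smooth_eform_of_act => v vs; rewrite act_zero; exact: smooth_vform0.
Qed.

Lemma smooth_eform_one : smooth_eform eform_one.
Proof. by apply: smooth_eform_of_act => v vs; rewrite act_one. Qed.

Lemma smooth_emul (L N : eform E) : smooth_eform L -> smooth_eform N -> smooth_eform (emul L N).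
Proof.
move=> sL sN; apply: smooth_eform_of_act => v vs; rewrite act_emul.
by do 2!apply: smooth_act => //.
Qed.

HB.instance Definition _ := gen_eqMixin sef.
HB.instance Definition _ := gen_choiceMixin sef.

Definition sef_add (L N : sef) := Sef (smooth_eform_add (sef_smooth L) (sef_smooth N)).
Definition sef_opp (L : sef) := Sef (smooth_eform_scale (-1) (sef_smooth L)).
Definition sef_zero := Sef smooth_eform_zero.
Definition sef_one := Sef smooth_eform_one.
Definition sef_mul (L N : sef) := Sef (smooth_emul (sef_smooth L) (sef_smooth N)).
Definition sef_scale z (L : sef) := Sef (smooth_eform_scale z (sef_smooth L)).

Lemma sef_addA : associative sef_add.
Proof. by move=> L N P; apply: sef_ext => x; exact: addrA. Qed.
Lemma sef_addC : commutative sef_add.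
Proof. by move=> L N; apply: sef_ext => x; exact: addrC. Qed.
Lemma sef_add0 : left_id sef_zero sef_add.
Proof. by move=> L; apply: sef_ext => x; exact: add0r. Qed.
Lemma sef_addN : left_inverse sef_zero sef_opp sef_add.
Proof.
move=> L; apply: sef_ext => x.
by rewrite -[LHS]/(-1 *: sefv L x + sefv L x) scaleN1r addNr.
Qed.

HB.instance Definition _ := GRing.isZmodule.Build sef sef_addA sef_addC sef_add0 sef_addN.

Lemma sef_mulA : associative sef_mul.
Proof.
by move=> L N P; apply: sef_ext => x; apply/esym; apply: pmulA; exact: grK.
Qed.
Lemma sef_mul1 : left_id sef_one sef_mul.
Proof. by move=> L; apply: sef_ext => x; apply: pmul1l; exact: grK. Qed.
Lemma sef_mulr1 : right_id sef_one sef_mul.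
Proof. by move=> L; apply: sef_ext => x; exact: pmul1r. Qed.
Lemma sef_mulDl : left_distributive sef_mul +%R.
Proof.
move=> L N P; apply: sef_ext => x.
by have := pmul_linearl (gr E x) (sefv P x) 1 (sefv L x) (sefv N x); rewrite !scale1r.
Qed.
Lemma sef_mulDr : right_distributive sef_mul +%R.
Proof. by move=> L N P; apply: sef_ext => x; exact: (linearD (pmul (gr E x) (sefv L x))). Qed.

HB.instance Definition _ := GRing.Zmodule_isPzRing.Build sef
  sef_mulA sef_mul1 sef_mulr1 sef_mulDl sef_mulDr.

Lemma sef_scaleA a b L : sef_scale a (sef_scale b L) = sef_scale (a * b) L.
Proof. by apply: sef_ext => x; exact: scalerA. Qed.
Lemma sef_scale1 : left_id 1 sef_scale.
Proof. by move=> L; apply: sef_ext => x; exact: scale1r. Qed.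
Lemma sef_scaleDr : right_distributive sef_scale +%R.
Proof. by move=> a L N; apply: sef_ext => x; exact: scalerDr. Qed.
Lemma sef_scaleDl L : {morph sef_scale^~ L : a b / a + b}.
Proof. by move=> a b; apply: sef_ext => x; exact: scalerDl. Qed.

HB.instance Definition _ := GRing.Zmodule_isLmodule.Build K sef
  sef_scaleA sef_scale1 sef_scaleDr sef_scaleDl.

Lemma sefN (L : sef) x : sefv (- L) x = - sefv L x. Proof. exact: scaleN1r. Qed.
Lemma act_sefM (L N : sef) v : act (L * N) v = act L (act N v).
Proof. exact: act_emul. Qed.
Lemma act_sefD (L N : sef) v : act (L + N) v = vadd (act L v) (act N v).
Proof. exact: act_add. Qed.
Lemma act_sefZ z (L : sef) v : act (z *: L) v = vscale z (act L v).
Proof. exact: act_scale. Qed.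
Lemma act_sefN (L : sef) v : act (- L) v = vscale (-1) (act L v).
Proof. exact: act_scale. Qed.
Lemma act_sef1 v : act (1 : sef) v = v. Proof. exact: act_one. Qed.
Lemma act_sefB (L N : sef) v : act (L - N) v = vsub (act L v) (act N v).
Proof. by rewrite act_sefD act_sefN vsubE. Qed.

Lemma sef_scaleAl z (L N : sef) : z *: (L * N) = z *: L * N.
Proof. by apply: sef_act_inj => v _; rewrite !(act_sefM, act_sefZ). Qed.
Lemma sef_scaleAr z (L N : sef) : z *: (L * N) = L * (z *: N).
Proof. by apply: sef_act_inj => v _; rewrite !(act_sefM, act_sefZ) act_vscale. Qed.

Definition sg (L : sef) : sef := Sef (smooth_esig (sef_smooth L)).

Lemma act_sg (L : sef) v : act (sg L) v = vsign (act L (vsign v)).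
Proof. exact: act_esig. Qed.

Lemma sgD : {morph sg : L N / L + N}.
Proof. by move=> L N; apply: sef_ext => x; exact: (linearD (psig (gr E x))). Qed.
Lemma sgM : {morph sg : L N / L * N}.
Proof.
by move=> L N; apply: sef_act_inj => v _; rewrite !(act_sg, act_sefM) vsignK.
Qed.
Lemma sg1 : sg 1 = 1.
Proof. by apply: sef_act_inj => v _; rewrite act_sg !act_sef1 vsignK. Qed.
Lemma sgK L : sg (sg L) = L.
Proof. by apply: sef_act_inj => v _; rewrite !act_sg !vsignK. Qed.
Lemma sgZ z L : sg (z *: L) = z *: sg L.
Proof. by apply: sef_act_inj => v _; rewrite !(act_sg, act_sefZ) vsign_scale. Qed.

Definition tau (L : sef) : M -> ext n K^o := Str L.

Lemma tauD : {morph tau : L N / L + N}.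
Proof.
move=> L N; apply/funext => x; apply/ffunP => S.
rewrite -[RHS]/((tau L x + tau N x) S) !ffunE.
by rewrite [LHS](linearD (@str _ _ _ _ E x : _ -> K^o)).
Qed.

Lemma tauZ z L x : tau (z *: L) x = z *: tau L x.
Proof.
by apply/ffunP => S; rewrite !ffunE [LHS](linearZ_LR (@str _ _ _ _ E x : _ -> K^o)).
Qed.

Lemma tau_even (L N : sef) : sg L = L -> tau (L * N) = tau (N * L).
Proof.
move=> sL; apply: (@Str_supercomm _ _ _ _ _ false L N).
apply: eform_ext => x; rewrite expr0 scale1r.
by rewrite -[LHS]/(sefv (sg L) x) sL.
Qed.

Lemma smooth_tau L : smooth_form (tau L : dform c M).
Proof. exact/smooth_Str/sef_smooth. Qed.

Definition tens_sef T (hT : tensorial T) : sef :=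
  let s := cid2 (tensorial_act hT) in Sef (s2valP s).

Lemma tens_sefE T (hT : tensorial T) v : smooth_vform v -> act (tens_sef hT) v = T v.
Proof. by move=> vs; apply/esym; exact: (s2valP' (cid2 (tensorial_act hT)) v vs). Qed.

Section Connection.
Variable A : vform E -> vform E.
Hypothesis hA : superconnection A.

Definition csq : sef := tens_sef (sc2_tensorial hA).
(** The supercommutator with A as an operator on smooth forms, characterized by its
    action. *)
Lemma supercomm_sef : {d : sef -> sef | forall L v, smooth_vform v ->
  act (d L) v = vsub (A (act L v)) (act (sg L) (A v))}.
Proof.
exists (fun L => tens_sef (supercomm_tensorial hA (sef_smooth L))) => L v vs.
exact: tens_sefE.
Qed.

Definition dl : sef -> sef := sval supercomm_sef.

Lemma csqE v : smooth_vform v -> act csq v = A (A v).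
Proof. exact: tens_sefE. Qed.

Lemma dlE (L : sef) v : smooth_vform v ->
  act (dl L) v = vsub (A (act L v)) (act (sg L) (A v)).
Proof. exact: svalP supercomm_sef L v. Qed.

Lemma dlD : {morph dl : L N / L + N}.
Proof.
move=> L N; apply: sef_act_inj => v vs; rewrite act_sefD !(dlE _ vs) sgD !act_sefD.
rewrite (scD hA (smooth_sef_act L vs) (smooth_sef_act N vs)).
by apply: vform_ext => x; rewrite /vsub /vadd opprD addrACA.
Qed.

Lemma dlZ z L : dl (z *: L) = z *: dl L.
Proof.
apply: sef_act_inj => v vs.
rewrite act_sefZ !(dlE _ vs) sgZ !act_sefZ (scZ hA _ (smooth_sef_act L vs)).
by apply: vform_ext => x; rewrite /vsub /vscale scalerBr.
Qed.

Lemma dlM L N : dl (L * N) = dl L * N + sg L * dl N.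
Proof.
apply: sef_act_inj => v vs.
rewrite act_sefD !act_sefM !(dlE _ vs) (dlE _ (smooth_sef_act N vs)).
rewrite sgM !act_sefM [vsub (A (act N v)) (act (sg N) _)]vsubE act_vadd act_vscale.
by apply: vform_ext => x; rewrite /vsub /vadd/vscale scaleN1r addrA subrK.
Qed.

Lemma sg_dl L : sg (dl L) = - dl (sg L).
Proof.
apply: sef_act_inj => v vs; rewrite act_sg (dlE _ (smooth_vsign vs)).
rewrite -[LHS]/(vconj (supercomm A L) v) (supercomm_conj hA (sef_smooth L) vs).
by rewrite act_sefN (dlE _ vs).
Qed.

Lemma dl_dl L : dl (dl L) = csq * L - L * csq.
Proof.
apply: sef_act_inj => v vs; have vA := sc_smooth hA vs.
have vL := smooth_sef_act L vs; have vLA := smooth_sef_act (sg L) vA.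
rewrite act_sefB !act_sefM (dlE _ vs) sg_dl act_sefN (dlE _ vA) (dlE _ vs) sgK.
rewrite (csqE vs) (csqE vL) [vsub (A (act L v)) _]vsubE.
rewrite (scD hA (sc_smooth hA vL) (smooth_vscale _ vLA)) (scZ hA _ vLA).
apply: vform_ext => x; rewrite /vsub /vadd /vscale !scaleN1r !opprB.
by rewrite addrA subrK.
Qed.

Lemma sg_csq : sg csq = csq.
Proof.
apply: sef_act_inj => v vs; rewrite act_sg (csqE vs) (csqE (smooth_vsign vs)).
exact: (vconj_sc2 hA vs).
Qed.

Lemma dl_csq : dl csq = 0.
Proof.
apply: sef_act_inj => v vs; rewrite (dlE _ vs) sg_csq (csqE vs) (csqE (sc_smooth hA vs)).
by rewrite act_zero; apply: vform_ext => x; rewrite /vsub subrr.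
Qed.

Lemma tau_dl L : tau (dl L) = extd (tau L : dform c M).
Proof.
apply: (Str_supercomm_extd hA (sef_smooth L)) => v vs.
by rewrite dlE.
Qed.

End Connection.

Definition cdiff (A1 A0 : vform E -> vform E) (h1 : superconnection A1)
  (h0 : superconnection A0) : sef := tens_sef (sub_tensorial h1 h0).

Lemma sg_cdiff A1 A0 h1 h0 : sg (@cdiff A1 A0 h1 h0) = - cdiff h1 h0.
Proof.
apply: sef_act_inj => v vs; have vs' := smooth_vsign vs.
rewrite act_sg act_sefN !tens_sefE// vsubE vsign_add vsign_scale.
rewrite (sc_vsign h1 vs) (sc_vsign h0 vs).
by apply: vform_ext => x; rewrite /vadd /vscale /vsub !scaleN1r opprB opprK addrC.
Qed.


End SmoothEndForms.

(** * Integrals of polynomial families *)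

Section PolynomialIntegral.
Variable R : realType.
Implicit Types (p q : {poly R}).

Definition intp p : R := \int[lebesgue_measure]_(t in `[0%R, 1%R]) p.[t].

Lemma intp_deriv p : intp (deriv p) = p.[1] - p.[0].
Proof.
rewrite /intp /Rintegral (@continuous_FTC2 _ _ (horner p) 0 1)//.
- by apply: continuous_subspaceT; exact: continuous_horner.
- split=> [x _||]; first exact: derivable_horner.
    exact: cvg_at_right_filter (@continuous_horner R p 0).
  exact: cvg_at_left_filter (@continuous_horner R p 1).
- by move=> x _; rewrite derivE.
Qed.

Lemma poly_primitive p : exists q, deriv q = p.
Proof.
exists (\poly_(i < (size p).+1) (if i is j.+1 then p`_j / j.+1%:R else 0)).
apply/polyP => i; rewrite coef_deriv coef_poly ltnS.
case: ltnP => [ip|pi]; last by rewrite nth_default// mul0rn.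
by rewrite /= -[LHS]mulr_natr divfK// pnatr_eq0.
Qed.

Lemma intp_linear : linear (intp : {poly R} -> R^o).
Proof.
move=> a p q; have [P <-] := poly_primitive p; have [Q <-] := poly_primitive q.
rewrite -derivZ -derivD !intp_deriv !hornerD !hornerZ.
by rewrite -[RHS]/(a * (P.[1] - P.[0]) + (Q.[1] - Q.[0])); ring.
Qed.
HB.instance Definition _ :=
  GRing.isLinear.Build R {poly R} R^o _ (intp : {poly R} -> R^o) intp_linear.

Local Notation realC := (@ofR R true).

(** All integrands are polynomial in t. Writing them as finite combinations of real
    polynomials makes the integral a finite sum, which commutes with every linear
    operation. *)
Definition has_integral (g : R -> R[i]) (I : R[i]) : Prop :=
  exists s : seq ({poly R} * R[i]),
    (forall t, g t = \sum_(u <- s) (realC u.1.[t] : R[i]) * u.2) /\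
    I = \sum_(u <- s) (realC (intp u.1) : R[i]) * u.2.

Lemma Re_sum (I : Type) (r : seq I) (F : I -> R[i]) :
  complex.Re (\sum_(i <- r) F i) = \sum_(i <- r) complex.Re (F i).
Proof. exact: (big_morph _ (@reKD R true) (@reK0 R true)). Qed.

Lemma Im_sum (I : Type) (r : seq I) (F : I -> R[i]) :
  complex.Im (\sum_(i <- r) F i) = \sum_(i <- r) complex.Im (F i).
Proof. exact: (big_morph _ (@imKD R true) (@imK0 R true)). Qed.

Lemma cintegral_has g I : has_integral g I -> cintegral g = I.
Proof.
move=> [s [gE ->]].
have ReM (a : R) (z : R[i]) : complex.Re ((realC a : R[i]) * z) = a * complex.Re z.
  by case: z => x y /=; rewrite mul0r subr0.
have ImM (a : R) (z : R[i]) : complex.Im ((realC a : R[i]) * z) = a * complex.Im z.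
  by case: z => x y /=; rewrite mul0r addr0.
have int_lin (h : R[i] -> R) :
    \int[lebesgue_measure]_(t in `[0%R, 1%R]) (\sum_(u <- s) u.1.[t] * h u.2) =
    \sum_(u <- s) intp u.1 * h u.2.
  transitivity (intp (\sum_(u <- s) h u.2 *: u.1)).
    rewrite /intp; apply: eq_Rintegral => t _.
    rewrite horner_sum; apply: eq_bigr => u _; by rewrite hornerZ mulrC.
  rewrite -[LHS]/((intp : {poly R} -> R^o) _) linear_sum; apply: eq_bigr => u _.
  by rewrite linearZ/= [RHS]mulrC.
apply/eqP; rewrite eq_complex /cintegral/=; apply/andP; split; apply/eqP.
  rewrite Re_sum; under [RHS]eq_bigr do rewrite ReM.
  rewrite -int_lin; apply: eq_Rintegral => t _; rewrite gE Re_sum.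
  by apply: eq_bigr => u _; rewrite ReM.
rewrite Im_sum; under [RHS]eq_bigr do rewrite ImM.
rewrite -int_lin; apply: eq_Rintegral => t _; rewrite gE Im_sum.
by apply: eq_bigr => u _; rewrite ImM.
Qed.

Lemma has_integralZ z g I : has_integral g I -> has_integral (fun t => z * g t) (z * I).
Proof.
move=> [s [gE ->]]; exists [seq (u.1, z * u.2) | u <- s]; split=> [t|].
  by rewrite gE mulr_sumr big_map; apply: eq_bigr => u _; exact: mulrCA.
by rewrite mulr_sumr big_map; apply: eq_bigr => u _; exact: mulrCA.
Qed.

Lemma has_integralD g h I J : has_integral g I -> has_integral h J ->
  has_integral (fun t => g t + h t) (I + J).
Proof.
move=> [s [gE ->]] [s' [hE ->]]; exists (s ++ s'); split=> [t|].
  by rewrite gE hE big_cat.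
by rewrite big_cat.
Qed.

Lemma has_integral_sum (T : Type) (r : seq T) (g : T -> R -> R[i]) (I : T -> R[i]) :
  (forall k, has_integral (g k) (I k)) ->
  has_integral (fun t => \sum_(k <- r) g k t) (\sum_(k <- r) I k).
Proof.
move=> h; elim: r => [|k r IH].
  by exists [::]; split=> [t|]; rewrite !big_nil.
rewrite big_cons (_ : (fun t => _) = (fun t => g k t + \sum_(k <- r) g k t)).
  exact: has_integralD.
by apply/funext => t; rewrite big_cons.
Qed.

Lemma has_integral_unique g I J : has_integral g I -> has_integral g J -> I = J.
Proof. by move=> /cintegral_has <- /cintegral_has. Qed.

End PolynomialIntegral.

Section Families.
Variables (R : realType) (c : bool) (n : nat) (M : manifold R n).
Variable E : superbundle c M.
Local Notation S := (sef E).

(** The derivative G' is carried along with G so that both are given by the same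
    coefficients. *)
Definition poly_family (G G' : R -> S) : Prop :=
  exists s : seq ({poly R} * S),
    (forall t, G t = \sum_(u <- s) ofR c u.1.[t] *: u.2) /\
    (forall t, G' t = \sum_(u <- s) ofR c (deriv u.1).[t] *: u.2).

Definition family_integral (G : R -> S) (I : S) : Prop :=
  exists s : seq ({poly R} * S),
    (forall t, G t = \sum_(u <- s) ofR c u.1.[t] *: u.2) /\
    I = \sum_(u <- s) ofR c (intp u.1) *: u.2.

Lemma poly_family_integral G G' : poly_family G G' -> exists I, family_integral G I.
Proof.
by move=> [s [GE _]]; exists (\sum_(u <- s) ofR c (intp u.1) *: u.2); exists s.
Qed.

Lemma poly_family_deriv G G' : poly_family G G' -> family_integral G' (G 1 - G 0).
Proof.
move=> [s [GE G'E]]; exists [seq ((deriv u.1), u.2) | u <- s]; split=> [t|].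
  by rewrite G'E big_map.
rewrite !GE big_map -sumrB; apply: eq_bigr => u _ /=.
by rewrite intp_deriv ofRD ofRN scalerBl.
Qed.

Lemma poly_family_eq G G' H H' : (forall t, G t = H t) -> (forall t, G' t = H' t) ->
  poly_family G G' -> poly_family H H'.
Proof. by move=> e e' [s [h h']]; exists s; split=> t; rewrite -?e -?e'. Qed.

Lemma poly_family_cst (a : S) : poly_family (fun=> a) (fun=> 0).
Proof.
exists [:: (1, a)]; split=> t; rewrite big_seq1/= ?derivC ?hornerE.
  by rewrite ofR1 scale1r.
by rewrite ofR0 scale0r.
Qed.

Lemma poly_family_lin (a : S) : poly_family (fun t => ofR c t *: a) (fun=> a).
Proof.
exists [:: ('X, a)]; split=> t; rewrite big_seq1/= ?derivX ?hornerE//.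
by rewrite ofR1 scale1r.
Qed.

Lemma poly_familyD G G' H H' : poly_family G G' -> poly_family H H' ->
  poly_family (fun t => G t + H t) (fun t => G' t + H' t).
Proof.
move=> [s [h h']] [s2 [k k']]; exists (s ++ s2).
by split=> t; rewrite big_cat/= -?h -?k -?h' -?k'.
Qed.

Lemma poly_family_linear (phi : S -> S) G G' :
  {morph phi : x y / x + y} -> (forall (r : R) x, phi (ofR c r *: x) = ofR c r *: phi x) ->
  poly_family G G' -> poly_family (fun t => phi (G t)) (fun t => phi (G' t)).
Proof.
move=> pD pZ [s [h h']].
have p0 : phi 0 = 0 by have := pZ 0 0; rewrite ofR0 !scale0r.
exists [seq (u.1, phi u.2) | u <- s]; split=> t; rewrite ?h ?h' big_map (big_morph _ pD p0);
  by apply: eq_bigr => u _; rewrite pZ.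
Qed.

Lemma poly_familyN G G' : poly_family G G' ->
  poly_family (fun t => - G t) (fun t => - G' t).
Proof.
apply: (@poly_family_linear (fun x => - x)); first exact: opprD.
by move=> r x; rewrite scalerN.
Qed.

Lemma poly_familyM G G' H H' : poly_family G G' -> poly_family H H' ->
  poly_family (fun t => G t * H t) (fun t => G' t * H t + G t * H' t).
Proof.
move=> [s [h h']] [s2 [k k']].
exists [seq (u.1 * v.1, u.2 * v.2) | u <- s, v <- s2].
have e (p q : S) (a b : R) : (ofR c a *: p) * (ofR c b *: q) = ofR c (a * b) *: (p * q).
  by rewrite -sef_scaleAl -sef_scaleAr scalerA ofRM.
split=> t; rewrite big_allpairs_dep/=.
  rewrite h k mulr_suml; apply: eq_bigr => u _; rewrite mulr_sumr.
  by apply: eq_bigr => v _; rewrite e hornerM.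
rewrite h h' k k' !mulr_suml -big_split/=; apply: eq_bigr => u _.
rewrite !mulr_sumr -big_split/=; apply: eq_bigr => v _.
by rewrite !e derivM hornerD !hornerM ofRD scalerDl.
Qed.

(** The coefficients of Str and of d Str are such functionals phi, hence both
    operations pass under the integral. *)
Lemma family_integral_functional (phi : S -> R[i]) G I :
  {morph phi : x y / x + y} ->
  (forall (r : R) x, phi (ofR c r *: x) = (ofR true r : R[i]) * phi x) ->
  family_integral G I -> has_integral (fun t => phi (G t)) (phi I).
Proof.
move=> pD pZ [s [h ->]].
have p0 : phi 0 = 0.
  by have := pZ 0 0; rewrite ofR0 scale0r => ->; rewrite [ofR true 0]ofR0 mul0r.
exists [seq (u.1, phi u.2) | u <- s]; split=> [t|]; rewrite ?h big_map (big_morph _ pD p0);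
  by apply: eq_bigr => u _; rewrite pZ.
Qed.

End Families.

(** * Powers of primitive superconnections *)

Section PrimitiveSuperconnections.
Variables (R : realType) (c : bool) (n : nat) (M : manifold R n).
Variable (w : dform false M).
Hypothesis hw : symplectic w.
Variable E : superbundle c M.
Local Notation K := (scal R c).
Local Notation om := (real_form c w).
Implicit Types (x y : M) (i : chart M).

Lemma real_formE c' : real_form c' w = form_emb c' w.
Proof. by apply/funext => x; apply/ffunP => S; rewrite !ffunE. Qed.

Lemma smooth_om c' : smooth_form (real_form c' w).
Proof. by have [sw _ _ _] := hw; rewrite real_formE; exact: smooth_form_emb. Qed.

Lemma hom_om c' : homogeneous 2 (real_form c' w).
Proof. by have [_ h2 _ _] := hw; rewrite real_formE; exact: homogeneous_emb. Qed.

Lemma extd_om c' x : extd (real_form c' w) x = 0.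
Proof.
have [_ _ dw _] := hw; rewrite real_formE extd_emb// dw.
exact: ext_emb0.
Qed.

Lemma act_eiota (a : dform c M) (v : vform E) : act (eiota E a) v = vwedge a v.
Proof. by apply: vform_ext => x; rewrite actE pact_iota//; exact: grK. Qed.

Lemma smooth_eiota (a : dform c M) : smooth_form a -> smooth_eform (eiota E a).
Proof.
by move=> sa; apply: smooth_eform_of_act => v vs; rewrite act_eiota; exact: smooth_vwedge.
Qed.

(** Exterior multiplication by the symplectic form: a central element, as its degree
    is even, and annihilated by every [dl], as it is closed. *)
Definition wsef : sef E := Sef (smooth_eiota (smooth_om c)).

Lemma act_wsef v : act wsef v = vwedge om v. Proof. exact: act_eiota. Qed.

Lemma act_om (L : eform E) v : act L (vwedge om v) = vwedge om (act L v).
Proof. by rewrite (act_vwedge _ _ (hom_om c)) /= esigK. Qed.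

Lemma wsefC (L : sef E) : wsef * L = L * wsef.
Proof. by apply: sef_act_inj => v _; rewrite !act_sefM !act_wsef act_om. Qed.

Lemma vsign_vwedge2 (a : dform c M) (v : vform E) : homogeneous 2 a ->
  vsign (vwedge a v) = vwedge a (vsign v).
Proof.
move=> ha; apply: vform_ext => x; apply/ffunP => S; rewrite !ffunE/=.
rewrite -grE linear_sum scaler_sumr; apply: eq_bigr => I IS.
rewrite linearZ/= grE !ffunE !scalerA.
have [I2|I2] := eqVneq #|I| 2; last by rewrite ha// !(mulr0, mul0r, scale0r).
congr (_ *: _); rewrite mulrC; congr (_ * _).
by rewrite -(card_setD_sub IS) I2 -signr_odd oddD signr_odd.
Qed.

Lemma vsign_om v : vsign (vwedge om v) = vwedge om (vsign v) :> vform E.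
Proof. exact/vsign_vwedge2/hom_om. Qed.

Lemma sg_wsef : sg wsef = wsef.
Proof.
by apply: sef_act_inj => v _; rewrite act_sg !act_wsef vsign_om vsignK.
Qed.

Lemma tau_wsefM (L : sef E) : tau (wsef * L) = fwedge om (tau L : dform c M).
Proof. exact: Str_eiota. Qed.

Lemma conn_om (A : vform E -> vform E) v : superconnection A -> smooth_vform v ->
  A (vwedge om v) = vwedge om (A v).
Proof.
move=> hA vs; rewrite (sc_wedge hA (smooth_om c) (hom_om c) vs).
apply: vform_ext => x; rewrite /vadd /vscale /vwedge extd_om.
rewrite -[wedge 0 _]/(wedger _ (0 : ext n K^o)) linear0 add0r.
by rewrite expr2 mulrNN mulr1 scale1r.
Qed.

Lemma act_sef0 v : act (0 : sef E) v = vform0 E. Proof. exact: act_zero. Qed.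

Lemma dl_wsef (A : vform E -> vform E) (hA : superconnection A) : dl hA wsef = 0.
Proof.
apply: sef_act_inj => v vs; rewrite dlE// sg_wsef !act_wsef (conn_om hA vs).
by apply: vform_ext => x; rewrite act_sef0 /vsub subrr.
Qed.

Section OnePSC.
Variable A : psuperconn E.
Local Notation hA := (connP A).

Definition potf : sef E := Sef (pot_smooth A).

(** A non-zero block of B from parity b to parity b2 in form degree k satisfies k +
    b + b2 even. *)
Lemma sg_potf : sg potf = potf.
Proof.
apply: sef_ext => x; apply/ffunP => S; rewrite ffunE /=; apply/lfunP => u.
rewrite lfunE/= comp_lfunE comp_lfunE !grE.
transitivity (\sum_(b : bool) (pot A x S : 'End(fiber E x)) (inj (part b u))); last first.
  rewrite -linear_sum; congr (_ _); rewrite big_bool.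
  by apply: fiber_ext => b; rewrite linearD; case: b; case: (u) => u1 u2 /=;
    rewrite ?addr0 ?add0r.
have -> : grading u = \sum_(b : bool) (-1) ^+ b *: inj (part b u).
  rewrite big_bool /= expr0 expr1 scale1r scaleN1r.
  by apply: fiber_ext => b; rewrite linearD linearN; case: b; case: (u) => u1 u2 /=;
    rewrite ?oppr0 ?addr0 ?add0r.
rewrite !linear_sum; apply: eq_bigr => b _.
rewrite !linearZ/= scalerA; apply: fiber_ext => b2.
rewrite linearZ/= part_grading scalerA.
have [e|e] := eqVneq (odd #|S| (+) (b (+) b2)) false; last first.
  by rewrite (@pot_even _ _ _ _ _ A) ?scaler0.
rewrite -[(-1) ^+ #|S|]signr_odd -!signr_addb -addbA addbCA e.
by rewrite scale1r.
Qed.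

Definition Fsef : sef E := csq hA + wsef * potf.
Definition Csef : sef E := - dl hA potf.

(** The square is a triangular matrix: the off-diagonal terms with omega cancel. *)
Lemma psc_op_sq (u v : vform E) : smooth_vform u -> smooth_vform v ->
  psc_op w A (psc_op w A (u, v)) =
  (act Fsef u, vadd (act Csef u) (act Fsef v)).
Proof.
move=> us vs; have uA := sc_smooth hA us; have vA := sc_smooth hA vs.
have wv : smooth_vform (vwedge om v) by apply: smooth_vwedge => //; exact: smooth_om.
have Bu : smooth_vform (act (pot A) u) by apply: smooth_act => //; exact: pot_smooth.
set Fu := act Fsef u; set Fv := act Fsef v; set Cu := act Csef u.
rewrite /psc_op/=; congr pair.
  rewrite (scD hA uA wv) (conn_om hA vs) /Fu act_sefD act_sefM act_wsef (csqE _ us).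
  apply: vform_ext => x; rewrite /vadd /vwedge /vsub linearB/= -addrA; congr (_ + _).
  by rewrite addrC subrK.
rewrite act_vadd act_om vsubE [vsub (act _ u) _]vsubE (scD hA Bu (smooth_vscale _ vA)).
rewrite (scZ hA _ vA) /Cu /Fv act_sefN (dlE _ _ us) sg_potf act_sefD act_sefM act_wsef (csqE _
  vs).
apply: vform_ext => x; rewrite /vadd /vscale /vsub !scaleN1r opprD opprK opprB.
rewrite -!addrA; congr (_ + _).
by rewrite addrC addrA.
Qed.

Lemma iter_psc_op k (u v : vform E) : smooth_vform u -> smooth_vform v ->
  iter k (psc_op w A \o psc_op w A) (u, v) =
  (act (Fsef ^+ k) u, vadd (act (power_deriv Fsef k Csef) u) (act (Fsef ^+ k) v)).
Proof.
move=> us vs; elim: k => [|k IH].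
  rewrite expr0 !act_sef1 /=; congr pair.
  by apply: vform_ext => x; rewrite /vadd act_zero add0r.
rewrite iterS IH [LHS]psc_op_sq; last 2 first.
- exact: smooth_sef_act.
- by apply: smooth_vadd; exact: smooth_sef_act.
rewrite act_vadd exprS -[power_deriv _ k.+1 _]/(_ * _ + Fsef * power_deriv Fsef k Csef).
rewrite (act_sefD (_ * _) (Fsef * _)) !act_sefM.
by congr pair; apply: vform_ext => x; rewrite [LHS]addrA.
Qed.

End OnePSC.

(** The pair is recovered from the values of P on pairs (v, 0), because an
    endomorphism-valued form is determined by its action. *)
Lemma identified_inj (P : pop E) (L N : eform E * eform E) :
  identified P L -> identified P N -> L = N.
Proof.
move=> [_ _ hL] [_ _ hN]; have s0 := @smooth_vform0 _ _ _ _ E.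
case: L hL => L1 L2 hL; case: N hN => N1 N2 hN.
have v0 : vsign (vform0 E) = vform0 E.
  by apply: vform_ext => x; rewrite vsignE linear0.
have a0 (L : eform E) : act L (vform0 E) = vform0 E.
  by apply: vform_ext => x; rewrite actE linear0.
have z (L : eform E) : vsign (act L (vsign (vform0 E))) = vform0 E.
  by rewrite v0 a0 v0.
have addv0 (u : vform E) : vadd u (vform0 E) = u.
  by apply: vform_ext => x; rewrite /vadd addr0.
congr pair; apply: act_inj => v vs.
  by have := hL v (vform0 E) vs s0; rewrite (hN v (vform0 E) vs s0) => -[].
have := hL v (vform0 E) vs s0; rewrite (hN v (vform0 E) vs s0) /= => -[_].
by rewrite !z !addv0.
Qed.

Lemma ident_eq (P : pop E) L : identified P L -> ident P = L.
Proof.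
move=> h; rewrite /ident; case: xgetP => [N _ hN|/(_ L)//].
exact: identified_inj hN h.
Qed.

Lemma ident_sef (P : pop E) (L N : sef E) :
  (forall u v, smooth_vform u -> smooth_vform v ->
    P (u, v) = (act L u, vadd (act N u) (act (sg L) v))) ->
  ident P = (sefv L, sefv N).
Proof.
move=> h; apply: ident_eq; split; [exact: sef_smooth|exact: sef_smooth|move=> u v us vs].
by rewrite h// act_sg.
Qed.

Lemma sg_Fsef (A : psuperconn E) k : sg (Fsef A ^+ k) = Fsef A ^+ k.
Proof.
have sF : sg (Fsef A) = Fsef A by rewrite /Fsef sgD sgM sg_csq sg_wsef sg_potf.
by elim: k => [|k IH]; rewrite ?expr0 ?sg1// exprS sgM IH sF.
Qed.

Lemma ident_iter (A : psuperconn E) k :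
  ident (fun u => iter k (psc_op w A \o psc_op w A) u) =
  (sefv (Fsef A ^+ k), sefv (power_deriv (Fsef A) k (Csef A))).
Proof. by apply: ident_sef => u v us vs; rewrite iter_psc_op// sg_Fsef. Qed.

Section Path.
Variables A0 A1 : psuperconn E.

Definition path_conn (t : R) (v : vform E) : vform E :=
  vadd (vscale (ofR c t) (conn A1 v)) (vscale (ofR c (1 - t)) (conn A0 v)).

Lemma ofR_path (t : R) : ofR c t + ofR c (1 - t) = 1.
Proof. by rewrite -ofRD addrC subrK ofR1. Qed.

Lemma path_convex (U : lmodType K) (t : R) (u : U) : ofR c t *: u + ofR c (1 - t) *: u = u.
Proof. by rewrite -scalerDl ofR_path scale1r. Qed.

Lemma path_conn_wedge t k (a : dform c M) (v : vform E) :
  smooth_form a -> homogeneous k a -> smooth_vform v ->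
  path_conn t (vwedge a v) =
    vadd (vwedge (extd a) v) (vscale ((-1) ^+ k) (vwedge a (path_conn t v))).
Proof.
move=> sa ha vs; rewrite /path_conn (sc_wedge (connP A1) sa ha vs) (sc_wedge (connP A0) sa ha vs).
apply: vform_ext => x; rewrite /vadd /vscale /vwedge !scalerDr addrACA path_convex.
congr (_ + _); rewrite linearD !linearZ/= scalerDr !scalerA.
by rewrite ![(-1) ^+ k * _]mulrC.
Qed.

Lemma path_linear t : linear_op (path_conn t).
Proof.
split=> [v vs|u v us vs|k v vs]; rewrite /path_conn.
- by apply: smooth_vadd; apply: smooth_vscale; apply: sc_smooth => //; exact: connP.
- rewrite (scD (connP A1))// (scD (connP A0))//.
  by apply: vform_ext => x; rewrite /vadd /vscale !scalerDr addrACA.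
- rewrite (scZ (connP A1))// (scZ (connP A0))//.
  apply: vform_ext => x; rewrite /vadd /vscale scalerDr !scalerA.
  by rewrite ![k * _]mulrC.
Qed.

(** The coefficients t and 1 - t have sum 1, which preserves the Leibniz rule. *)
Lemma path_superconnection t : superconnection (path_conn t).
Proof.
have [sm lD lZ] := path_linear t.
have pv f v : smooth_fun f -> smooth_vform v -> path_conn t (vmul f v) =
    vadd (vwedge (extd (fun0 f)) v) (vmul f (path_conn t v)).
  move=> fs vs; rewrite vmulE (path_conn_wedge t (smooth_fun0 fs) (@fun0_hom _ _ _ _ f) vs).
  by congr vadd; apply: vform_ext => y; rewrite /vscale expr0 scale1r -vmulE.
split; first split; first exact: path_linear.
- move=> f g v fs gs vs; rewrite (pv f (vmul g v))//; last exact: smooth_vmul.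
  rewrite (pv f v)//; apply: vform_ext => x.
  rewrite /vsub /vadd /vmul /vwedge [wedge _ (_ *: _)]linearZ/=.
  by rewrite [X in _ - (X - _)]scalerDr !addrK subrr.
- move=> b v vs hv; apply/vparity_vsign.
  have [_ p1 _] := connP A1; have [_ p0 _] := connP A0.
  have /vparity_vsign h1 := p1 b v vs hv; have /vparity_vsign h0 := p0 b v vs hv.
  rewrite /path_conn vsign_add !vsign_scale h1 h0.
  apply: vform_ext => x; rewrite /vadd /vscale scalerDr !scalerA.
  by rewrite ![(-1) ^+ _ * _]mulrC.
- by move=> k a v sa ha vs; exact: path_conn_wedge.
Qed.

Definition path_pot (t : R) : sef E := ofR c t *: potf A1 + ofR c (1 - t) *: potf A0.

Lemma path_pot_even t : eparity false (path_pot t).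
Proof.
move=> x S b1 b2 v h; rewrite -[(path_pot t : eform E) x S]/((_ *: pot A1 x + _ *: pot A0 x) S).
rewrite !ffunE lfunE/= !lfunE/= linearD !linearZ/=.
by rewrite (@pot_even _ _ _ _ _ A1)// (@pot_even _ _ _ _ _ A0)// !scaler0 addr0.
Qed.

Definition path_psc (t : R) : psuperconn E :=
  PSuperconn (path_superconnection t) (sef_smooth (path_pot t)) (@path_pot_even t).

Lemma pop_path_psc t : pop_path (psc_op w A1) (psc_op w A0) t = psc_op w (path_psc t).
Proof.
apply/funext => -[u v]; rewrite /pop_path /psc_op /=; congr pair.
  apply: vform_ext => x; rewrite /vadd /path_conn /vscale /vadd !scalerDr.
  by rewrite addrACA path_convex.
have -> : act (path_pot t) u =
    vadd (vscale (ofR c t) (act (pot A1) u)) (vscale (ofR c (1 - t)) (act (pot A0) u)).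
  by rewrite act_sefD !act_sefZ.
apply: vform_ext => x; rewrite /vadd /vsub /path_conn /vscale /vadd !scalerBr opprD.
by rewrite addrACA.
Qed.

Definition dA : sef E := cdiff (connP A1) (connP A0).
Definition dB : sef E := potf A1 - potf A0.

Lemma sg_dA : sg dA = - dA. Proof. exact: sg_cdiff. Qed.
Lemma sg_dB : sg dB = dB.
Proof.
rewrite /dB sgD sg_potf; congr (_ + _).
by rewrite -scaleN1r sgZ sg_potf.
Qed.

Lemma act_dA v : smooth_vform v -> act dA v = vsub (conn A1 v) (conn A0 v).
Proof. exact: tens_sefE. Qed.

Lemma ident_diff t k :
  ident (fun u => pop_sub (psc_op w A1) (psc_op w A0)
    (iter k (psc_op w (path_psc t) \o psc_op w (path_psc t)) u)) =
  (sefv (dA * Fsef (path_psc t) ^+ k),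
   sefv (dB * Fsef (path_psc t) ^+ k -
    dA * power_deriv (Fsef (path_psc t)) k (Csef (path_psc t)))).
Proof.
apply: ident_sef => u v us vs; rewrite iter_psc_op//.
rewrite sgM sg_dA sg_Fsef; set F := Fsef _; set N := power_deriv _ _ _.
have Fu : smooth_vform (act (F ^+ k) u) by exact: smooth_sef_act.
have Fv : smooth_vform (act (F ^+ k) v) by exact: smooth_sef_act.
have Nu : smooth_vform (act N u) by exact: smooth_sef_act.
rewrite mulNr act_sefN (act_sefB (dB * _)) !act_sefM !act_dA // (act_sefB (potf A1)). 
rewrite /pop_sub /psc_op/=; congr pair.
  by apply: vform_ext => x; rewrite /vsub /vadd opprD addrACA subrr addr0.
rewrite (scD (connP A1))// (scD (connP A0))//.
apply: vform_ext => x; rewrite /vsub /vadd /vscale scaleN1r.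
by rewrite !opprD !opprK addrACA [X in _ + X]addrACA addrA.
Qed.

End Path.

End PrimitiveSuperconnections.

(** * The path between two primitive superconnections *)

Section PathFamilies.
Variables (R : realType) (c : bool) (n : nat) (M : manifold R n).
Variable (w : dform false M).
Hypothesis hw : symplectic w.
Variable E : superbundle c M.
Variables A0 A1 : psuperconn E.
Local Notation At := (path_psc A0 A1).
Local Notation a := (dA A0 A1).
Local Notation b := (dB A0 A1).
Local Notation Om := (wsef hw E).
Local Notation F t := (Fsef hw (At t)).
Local Notation C t := (Csef (At t)).
Local Notation dl0 := (dl (connP A0)).
Local Notation dlt t := (dl (connP (At t))).

Lemma path_connE t v : smooth_vform v ->
  path_conn A0 A1 t v = vadd (conn A0 v) (vscale (ofR c t) (act a v)).
Proof.
move=> vs; rewrite act_dA//; apply: vform_ext => x; rewrite /path_conn /vadd /vscale /vsub.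
rewrite scalerBr addrCA; congr (_ + _).
rewrite ofRD scalerDl ofR1 scale1r; congr (_ + _).
by rewrite ofRN scaleNr.
Qed.

Lemma path_potE t : path_pot A0 A1 t = potf A0 + ofR c t *: b.
Proof.
rewrite /path_pot /dB scalerBr addrCA; congr (_ + _).
by rewrite ofRD scalerDl ofR1 scale1r ofRN scaleNr.
Qed.

Lemma potf_path t : potf (At t) = path_pot A0 A1 t.
Proof. exact: sef_ext. Qed.

(** Expansion of (A_0 + t a)^2. *)
Lemma csq_path t : csq (connP (At t)) =
  csq (connP A0) + ofR c t *: dl0 a + (ofR c t *: a) * (ofR c t *: a).
Proof.
apply: sef_act_inj => v vs; set hA0 := connP A0.
have v0 := sc_smooth hA0 vs; have va := smooth_sef_act a vs.
have vt : smooth_vform (vscale (ofR c t) (act a v)) by exact: smooth_vscale.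
rewrite csqE// -[conn (At t)]/(path_conn A0 A1 t) (path_connE t vs) path_connE; last exact:
  smooth_vadd.
rewrite (scD hA0 v0 vt) (scZ hA0 _ va) act_vadd act_vscale.
rewrite (act_sefD (_ + _)) (act_sefD (csq _)) act_sefZ act_sefM !act_sefZ (csqE hA0 vs).
rewrite (dlE hA0 _ vs) sg_dA act_sefN act_vscale.
apply: vform_ext => x; rewrite /vadd /vscale /vsub scaleN1r opprK !scalerDr.
by rewrite !addrA.
Qed.

Lemma dl_path t L : dlt t L = dl0 L + ofR c t *: (a * L - sg L * a).
Proof.
apply: sef_act_inj => v vs; set hA0 := connP A0.
have v0 := sc_smooth hA0 vs; have vL := smooth_sef_act L vs.
rewrite dlE// -[conn (At t)]/(path_conn A0 A1 t) (path_connE t vs) (path_connE t vL) act_vadd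
  act_vscale.
rewrite (act_sefD (dl0 L)) act_sefZ (act_sefB (a * L)) !act_sefM (dlE hA0 _ vs).
apply: vform_ext => x; rewrite /vadd /vscale /vsub scalerBr opprD.
by rewrite addrACA.
Qed.

Lemma family_path_pot : poly_family (path_pot A0 A1) (fun=> b).
Proof.
apply: poly_family_eq (poly_familyD (poly_family_cst (potf A0)) (poly_family_lin b)) => t.
  by rewrite path_potE.
by rewrite add0r.
Qed.

(** The derivative of A_t^2 is the supercommutator of A_t and a. *)
Lemma family_Fsef : poly_family (fun t => F t) (fun t => dlt t a + Om * b).
Proof.
have h1 := poly_familyD (poly_family_cst (csq (connP A0))) (poly_family_lin (dl0 a)).
have h2 := poly_familyM (poly_family_lin a) (poly_family_lin a).
have h3 := poly_familyM (poly_family_cst Om) family_path_pot.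
apply: poly_family_eq (poly_familyD (poly_familyD h1 h2) h3) => t.
  by rewrite /Fsef csq_path potf_path.
rewrite dl_path add0r mul0r add0r sg_dA mulNr opprK scalerDr.
by rewrite -sef_scaleAr -sef_scaleAl.
Qed.

Lemma family_Csef : poly_family (fun t => C t)
  (fun t => - dlt t b - (a * potf (At t) - potf (At t) * a)).
Proof.
have h0 := family_path_pot.
have h1 := poly_family_linear (dlD (connP A0)) (fun r => dlZ (connP A0) (ofR c r)) h0.
have h2 := poly_familyM (poly_family_lin a) h0.
have h3 := poly_familyM h0 (poly_family_lin a).
apply: poly_family_eq (poly_familyN (poly_familyD h1 (poly_familyD h2 (poly_familyN h3)))) => t.
  rewrite /Csef dl_path sg_potf potf_path scalerBr -sef_scaleAl -sef_scaleAr.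
  by rewrite sef_scaleAl sef_scaleAr.
rewrite -opprD dl_path sg_dB potf_path scalerBr -!sef_scaleAl -!sef_scaleAr; congr (- _).
rewrite -[RHS]addrA; congr (_ + _).
by rewrite [X in X - _]addrC opprD addrACA.
Qed.

End PathFamilies.

(** * Transgression of the powers *)

Section Transgression.
Variables (R : realType) (c : bool) (n : nat) (M : manifold R n).
Variable (w : dform false M).
Hypothesis hw : symplectic w.
Variable E : superbundle c M.
Local Notation K := (scal R c).

Lemma poly_familyX (G G' : R -> sef E) k : poly_family G G' ->
  poly_family (fun t => G t ^+ k) (fun t => power_deriv (G t) k (G' t)).
Proof.
move=> h; elim: k => [|k IH]; first exact: poly_family_cst.
apply: poly_family_eq (poly_familyM h IH) => t; first by rewrite exprS.
by [].
Qed.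

Lemma poly_family_power_deriv (G G' X X' : R -> sef E) k :
  poly_family G G' -> poly_family X X' ->
  exists Y, poly_family (fun t => power_deriv (G t) k (X t)) Y.
Proof.
move=> hG hX; elim: k => [|k [Y IH]]; first by exists (fun=> 0); exact: poly_family_cst.
eexists; apply: poly_family_eq (poly_familyD (poly_familyM hX (poly_familyX k hG))
  (poly_familyM hG IH)) => t.
  by [].
reflexivity.
Qed.

Definition ctau (L : sef E) : dform true M := form_emb true (tau L).

Let cT : c ==> true. Proof. by case: (c). Qed.

Lemma smooth_ctau L : smooth_form (ctau L).
Proof. exact/smooth_form_emb/smooth_tau. Qed.

Lemma ctauD L N x : ctau (L + N) x = ctau L x + ctau N x.
Proof. by rewrite /ctau /form_emb tauD ext_embD. Qed.

Lemma ctauZ z L x : ctau (z *: L) x = (emb true z : scal R true) *: ctau L x.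
Proof.
rewrite /ctau /form_emb tauZ; apply/ffunP => S; rewrite !ffunE.
exact: embM.
Qed.

Lemma ctau_wsefM L x : ctau (wsef hw E * L) x = fwedge (real_form true w) (ctau L) x.
Proof.
rewrite /ctau /form_emb (tau_wsefM hw L) /fwedge (ext_emb_wedge cT); congr wedge.
by apply/ffunP => S; rewrite !ffunE emb_ofR.
Qed.

Lemma extd_ctau L x : extd (ctau L) x = ext_emb true (extd (tau L : dform c M) x).
Proof. exact: extd_emb. Qed.

Lemma ctau_dl (A : vform E -> vform E) (hA : superconnection A) L x :
  ctau (dl hA L) x = extd (ctau L) x.
Proof. by rewrite extd_ctau /ctau /form_emb tau_dl. Qed.

Lemma ctau0 x : ctau 0 x = 0.
Proof. have := ctauZ 0 (0 : sef E) x; rewrite scale0r emb0// => ->; exact: scale0r. Qed.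

Lemma ctauN L x : ctau (- L) x = - ctau L x.
Proof. by apply/eqP; rewrite -addr_eq0 -ctauD addNr ctau0. Qed.

Section OnePSC.
Variable A : psuperconn E.

Lemma ctau_cocycle1 k x :
  extd (ctau (Fsef hw A ^+ k)) x +
  fwedge (real_form true w) (ctau (power_deriv (Fsef hw A) k (Csef A))) x = 0.
Proof.
rewrite -(ctau_dl (connP A)) -ctau_wsefM {1}/ctau /form_emb.
rewrite (@tau_dl_curvX (sef E) (M -> ext n K^o) (@sg _ _ _ _ E) (dl (connP A)) (@tau _ _ _ _ E)
  (csq (connP A)) (potf A) (wsef hw E) _ _ (@sgD _ _ _ _ E) (@sgM _ _ _ _ E) (@sg1 _ _ _ _ E)
  (dlD (connP A)) (dlM (connP A)) (dl_csq (connP A))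
  (@wsefC _ _ _ _ _ hw E) (dl_wsef hw (connP A)) (@tauD _ _ _ _ E) (sg_csq (connP A)) (sg_potf
    A) (sg_wsef hw E)
  erefl erefl).
rewrite -[ext_emb true _]/(ext_emb true ((- tau _) x)).
rewrite -ext_embD// -[X in ext_emb true X]/((- tau (wsef hw E * power_deriv (Fsef hw A) k (Csef
  A)) + tau _) x).
by rewrite addNr ext_emb0.
Qed.

Lemma ctau_cocycle2 k x : extd (ctau (power_deriv (Fsef hw A) k (Csef A))) x = 0.
Proof.
rewrite -(ctau_dl (connP A)) /ctau /form_emb.
rewrite (@tau_dl_power_deriv (sef E) (M -> ext n K^o) (@sg _ _ _ _ E) (dl (connP A)) (@tau _ _
  _ _ E) (csq (connP A)) (potf A) (wsef hw E) _ _ (@sgD _ _ _ _ E) (@sgM _ _ _ _ E) (@sg1 _ _ _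
  _ E) (dlD (connP A)) (dlM (connP A))
  (@sg_dl _ _ _ _ _ _ (connP A)) (dl_dl (connP A)) (dl_csq (connP A))
  (@wsefC _ _ _ _ _ hw E) (dl_wsef hw (connP A)) (@tauD _ _ _ _ E) (@tau_even _ _ _ _ E)
    (sg_csq (connP A)) (sg_potf A) (sg_wsef hw E)
  erefl erefl).
exact: ext_emb0.
Qed.

Lemma ctau_power_deriv m X x :
  ctau (power_deriv (Fsef hw A) m.+1 X) x = ctau (X * Fsef hw A ^+ m) x *+ m.+1.
Proof.
rewrite /ctau /form_emb (@tau_power_deriv (sef E) (M -> ext n K^o) (@sg _ _ _ _ E)
  (@tau _ _ _ _ E) (csq (connP A)) (potf A) (wsef hw E) _ (@sgD _ _ _ _ E) (@sgM _ _ _ _ E)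
  (@tauD _ _ _ _ E) (@tau_even _ _ _ _ E) (sg_csq (connP A)) (sg_potf A)
  (sg_wsef hw E) erefl).
elim: m.+1 => [|j IH]; first exact: ext_emb0.
by rewrite !mulrS -IH -ext_embD.
Qed.

End OnePSC.

Section Path.
Variables A0 A1 : psuperconn E.
Local Notation At := (path_psc A0 A1).
Local Notation a := (dA A0 A1).
Local Notation b := (dB A0 A1).
Local Notation Om := (wsef hw E).
Local Notation F t := (Fsef hw (At t)).
Local Notation C t := (Csef (At t)).
Local Notation dlt t := (dl (connP (At t))).

(** The two entries of (A_1 - A_0) A_t^(2k), for the primitive superconnections. *)
Definition transgressor1 (t : R) k : sef E := a * F t ^+ k.
Definition transgressor2 (t : R) k : sef E := b * F t ^+ k - a * power_deriv (F t) k (C t).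

Lemma transgressor1_integral k : exists I, family_integral (transgressor1^~ k) I.
Proof.
apply: poly_family_integral; apply: poly_familyM (poly_family_cst a) _.
exact/poly_familyX/family_Fsef.
Qed.

Lemma transgressor2_integral k : exists I, family_integral (transgressor2^~ k) I.
Proof.
have hF := family_Fsef hw A0 A1; have hC := family_Csef A0 A1.
have [Y hN] := poly_family_power_deriv k hF hC.
have h1 := poly_familyM (poly_family_cst b) (poly_familyX k hF).
have h2 := poly_familyM (poly_family_cst a) hN.
exact: poly_family_integral (poly_familyD h1 (poly_familyN h2)).
Qed.

(** Evaluation of a form at one point on one index set reduces integrals of forms to
    integrals of complex numbers. *)
Lemma ctau_functional (phi : sef E -> ext n (scal R true)^o) (S : {set 'I_n})
    (G : R -> sef E) (I : sef E) :
  {morph phi : x y / x + y} ->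
  (forall z x, phi (z *: x) = (emb true z : scal R true) *: phi x) ->
  family_integral G I ->
  has_integral (fun t => phi (G t) S : R[i]) (phi I S : R[i]).
Proof.
move=> pD pZ; apply: (@family_integral_functional _ _ _ _ E (fun L => phi L S : R[i])).
  by move=> x y; rewrite pD ffunE.
by move=> r x; rewrite pZ emb_ofR// [LHS]ffunE.
Qed.

Lemma has_integral_eq (g h : R -> R[i]) I : g =1 h -> has_integral g I -> has_integral h I.
Proof. by move=> /funext ->. Qed.

Lemma extd_ctauD L N x : extd (ctau (L + N)) x = extd (ctau L) x + extd (ctau N) x.
Proof. by rewrite -!(ctau_dl (connP A0)) dlD ctauD. Qed.

Lemma extd_ctauZ z L x : extd (ctau (z *: L)) x = (emb true z : scal R true) *: extd (ctau L) x.
Proof. by rewrite -!(ctau_dl (connP A0)) dlZ ctauZ. Qed.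

Lemma ctau_transgression1 m x t :
  ctau (power_deriv (F t) m.+1 (dlt t a + Om * b)) x =
  (extd (ctau (transgressor1 t m)) x + ctau (Om * transgressor2 t m) x) *+ m.+1.
Proof.
rewrite ctau_power_deriv -(ctau_dl (connP (At t))) -ctauD; congr (_ *+ _).
rewrite /ctau /form_emb.
rewrite (@tau_transgression1 (sef E) (M -> ext n K^o) (@sg _ _ _ _ E) (dlt t) (@tau _ _ _ _ E)
  (csq (connP (At t))) (potf (At t)) Om a b _ _ (@sgD _ _ _ _ E) (@sgM _ _ _ _ E)
  (@sg1 _ _ _ _ E) (dlD (connP (At t))) (dlM (connP (At t))) (dl_csq (connP (At t)))
  (@wsefC _ _ _ _ _ hw E) (dl_wsef hw (connP (At t))) (@tauD _ _ _ _ E)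
  (sg_csq (connP (At t))) (sg_potf (At t)) (sg_wsef hw E) (sg_dA A0 A1) erefl erefl).
by rewrite -tauD.
Qed.

Lemma ctau_transgression2 m x t :
  ctau ((- dlt t b - (a * potf (At t) - potf (At t) * a)) * F t ^+ m +
    C t * power_deriv (F t) m (dlt t a + Om * b)) x =
  - extd (ctau (transgressor2 t m)) x.
Proof.
rewrite -(ctau_dl (connP (At t))) -ctauN /ctau /form_emb.
rewrite (@tau_transgression2 (sef E) (M -> ext n K^o) (@sg _ _ _ _ E) (dlt t) (@tau _ _ _ _ E)
  (csq (connP (At t))) (potf (At t)) Om a b _ _ (@sgD _ _ _ _ E) (@sgM _ _ _ _ E)
  (@sg1 _ _ _ _ E) (dlD (connP (At t))) (dlM (connP (At t))) (@sg_dl _ _ _ _ _ _ (connP (At t)))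
  (dl_dl (connP (At t))) (dl_csq (connP (At t)))
  (@wsefC _ _ _ _ _ hw E) (dl_wsef hw (connP (At t))) (@tauD _ _ _ _ E) (@tau_even _ _ _ _ E)
  (sg_csq (connP (At t))) (sg_potf (At t)) (sg_wsef hw E) (sg_dA A0 A1) (sg_dB A0 A1)
  erefl erefl).
by congr ext_emb; rewrite -[in RHS]scaleN1r tauZ scaleN1r.
Qed.

(** Integration of the first transgression identity over t in [0, 1]; the left side
    is the integral of the derivative of the supertrace of F_t^(m+1). *)
Lemma ctau_curv_difference m x I J :
  family_integral (transgressor1^~ m) I -> family_integral (transgressor2^~ m) J ->
  ctau (F 1 ^+ m.+1) x - ctau (F 0 ^+ m.+1) x =
  (extd (ctau I) x + fwedge (real_form true w) (ctau J) x) *+ m.+1.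
Proof.
move=> hI hJ; rewrite -ctau_wsefM -ctauN -ctauD; apply/ffunP => S.
have hF := poly_family_deriv (poly_familyX m.+1 (family_Fsef hw A0 A1)).
have h := ctau_functional S (fun L N => ctauD L N x) (fun z L => ctauZ z L x) hF.
have h1 := ctau_functional S (fun L N => extd_ctauD L N x) (fun z L => extd_ctauZ z L x) hI.
have wD : {morph (fun L => ctau (Om * L) x) : L N / L + N}.
  by move=> L N; rewrite mulrDr ctauD.
have wZ z L : ctau (Om * (z *: L)) x = (emb true z : scal R true) *: ctau (Om * L) x.
  by rewrite -sef_scaleAr ctauZ.
have h2 := ctau_functional S wD wZ hJ.
have h3 := has_integralZ m.+1%:R (has_integralD h1 h2).
have mulS (u v : ext n (scal R true)^o) :
    ((u + v) *+ m.+1) S = (m.+1%:R * ((u S : R[i]) + v S) : R[i]).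
  by rewrite -scaler_nat !ffunE.
rewrite mulS; apply: has_integral_unique h (has_integral_eq _ h3) => t.
by rewrite ctau_transgression1 mulS.
Qed.

(** By cyclicity it is enough to differentiate C_t F_t^m; then the second
    transgression identity is integrated. *)
Lemma ctau_dpot_difference m x J :
  family_integral (transgressor2^~ m) J ->
  ctau (power_deriv (F 1) m.+1 (C 1)) x - ctau (power_deriv (F 0) m.+1 (C 0)) x =
  - extd (ctau J) x *+ m.+1.
Proof.
move=> hJ; rewrite !ctau_power_deriv -mulrnBl -ctauN -ctauD; congr (_ *+ _); apply/ffunP => S.
have hF := family_Fsef hw A0 A1; have hC := family_Csef A0 A1.
have hG := poly_family_deriv (poly_familyM hC (poly_familyX m hF)).
have h := ctau_functional S (fun L N => ctauD L N x) (fun z L => ctauZ z L x) hG.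
have h1 := ctau_functional S (fun L N => extd_ctauD L N x) (fun z L => extd_ctauZ z L x) hJ.
have -> : (- extd (ctau J) x) S = (- 1 * (extd (ctau J) x S : R[i]) : R[i]).
  by rewrite !ffunE mulN1r.
apply: has_integral_unique h (has_integral_eq _ (has_integralZ (-1) h1)) => t.
by rewrite ctau_transgression2 !ffunE mulN1r.
Qed.

End Path.
End Transgression.

(** * Transgression of polynomials *)

Section SupertracePolynomials.
Variables (R : realType) (c : bool) (n : nat) (M : manifold R n).
Variable (w : dform false M).
Hypothesis hw : symplectic w.
Variable E : superbundle c M.
Implicit Types (f p : {poly R[i]}).
Local Notation comf := (@dform R true n M).

Definition psum p (u : nat -> comf) : comf := fun x => \sum_(k < size p) p`_k *: u k x.

Lemma psum_wide p u m x : (size p <= m)%N ->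
  psum p u x = \sum_(k < m) p`_k *: u k x.
Proof.
move=> pm; rewrite /psum (big_ord_widen m (fun k => p`_k *: u k x) pm) big_mkcond.
apply: eq_bigr => k _ /=; case: ltnP => // h.
by rewrite nth_default// scale0r.
Qed.

(** The coefficient of z^m in p' is (m + 1) times that of z^(m+1) in p: the factor m
    + 1 that cyclicity of the trace produces is absorbed by the derivative. *)
Lemma psum_deriv p u v : (forall x, u 0%N x = 0) ->
  (forall m x, u m.+1 x = v m x *+ m.+1) -> psum p u = psum (deriv p) v.
Proof.
move=> u0 uS; apply/funext => x; rewrite (psum_wide u x (leqnSn _)) big_ord_recl.
rewrite u0 scaler0 add0r (psum_wide v x (m := size p)); last first.
  have [->|p0] := eqVneq p 0; first by rewrite deriv0.
  exact: ltnW (lt_size_deriv p0).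
by apply: eq_bigr => k _; rewrite lift0 uS coef_deriv -scalerMnr scalerMnl.
Qed.

Lemma psumB p u v x : psum p u x - psum p v x = psum p (fun k y => u k y - v k y) x.
Proof. by rewrite /psum -sumrB; apply: eq_bigr => k _; rewrite scalerBr. Qed.

Lemma smooth_psum p u : (forall k, smooth_form (u k)) -> smooth_form (psum p u).
Proof. by move=> su; apply: smooth_form_sum => k _; exact: smooth_formZ. Qed.

Lemma extd_psum p u : (forall k, smooth_form (u k)) ->
  extd (psum p u) = psum p (fun k => extd (u k)).
Proof.
move=> su; apply/funext => x; rewrite /psum extd_sum; last first.
  by move=> k _; exact: smooth_formZ.
by apply: eq_bigr => k _; rewrite extdZ.
Qed.

Lemma wedge_psum p (a : comf) u x :
  fwedge a (psum p u) x = psum p (fun k => fwedge a (u k)) x.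
Proof.
by rewrite /fwedge /psum linear_sum; apply: eq_bigr => k _; rewrite linearZ.
Qed.

Lemma Str_polyE f (B P : pop E) (L N : nat -> sef E) :
  (forall k, ident (fun u => B (iter k (P \o P) u)) = (sefv (L k), sefv (N k))) ->
  Str_poly f B P = (psum f (fun k => ctau (L k)), psum f (fun k => ctau (N k))).
Proof.
have e (T : sef E) x : cplx_form (Str (sefv T)) x = ctau T x by [].
move=> h; rewrite /Str_poly /psum.
apply: (congr2 pair); apply/funext => x; apply: eq_bigr => k _.
  by rewrite h e.
by rewrite h e.
Qed.

Section OnePSC.
Variable A : psuperconn E.

Lemma Str_poly_psc f : Str_poly f id (psc_op w A) =
  (psum f (fun k => ctau (Fsef hw A ^+ k)),
   psum f (fun k => ctau (power_deriv (Fsef hw A) k (Csef A)))).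
Proof. by apply: Str_polyE => k; exact: ident_iter. Qed.

Lemma Str_poly_cocycle f : cocycle w (Str_poly f id (psc_op w A)).
Proof.
have s1 k := smooth_ctau (Fsef hw A ^+ k).
have s2 k := smooth_ctau (power_deriv (Fsef hw A) k (Csef A)).
rewrite Str_poly_psc; split; first by split; exact: smooth_psum.
rewrite /bdry /=; congr pair; apply/funext => x.
  rewrite extd_psum// wedge_psum /psum -big_split/=; apply: big1 => k _.
  by rewrite -scalerDr ctau_cocycle1 scaler0.
rewrite extd_psum// /psum big1 ?oppr0// => k _.
by rewrite ctau_cocycle2 scaler0.
Qed.

End OnePSC.

Section Path.
Variables A0 A1 : psuperconn E.
Local Notation At := (path_psc A0 A1).

Lemma path1 : psc_op w (At 1) = psc_op w A1.
Proof.
rewrite -pop_path_psc /pop_path; apply/funext => u.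
rewrite subrr ofR1 ofR0 [RHS]surjective_pairing; congr pair; apply: vform_ext => x;
  by rewrite /vadd /vscale scale1r scale0r addr0.
Qed.

Lemma path0 : psc_op w (At 0) = psc_op w A0.
Proof.
rewrite -pop_path_psc /pop_path; apply/funext => u.
rewrite subr0 ofR1 ofR0 [RHS]surjective_pairing; congr pair; apply: vform_ext => x;
  by rewrite /vadd /vscale scale1r scale0r add0r.
Qed.

Lemma form_integral_psum p (G : R -> nat -> sef E) (I : nat -> sef E) :
  (forall k, family_integral (G^~ k) (I k)) ->
  form_integral (fun t => psum p (fun k => ctau (G t k))) = psum p (fun k => ctau (I k)).
Proof.
move=> hI; apply/funext => x; apply/ffunP => S; rewrite ffunE.
have h k : has_integral (fun t => p`_k * (ctau (G t k) x S : R[i])) (p`_k * (ctau (I k) x S :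
  R[i])).
  apply: has_integralZ.
  exact: (ctau_functional S (fun L N => ctauD L N x) (fun z L => ctauZ z L x) (hI k)).
rewrite (cintegral_has (I := \sum_(k < size p) p`_k * (ctau (I k) x S : R[i]))).
  by rewrite /psum sum_ffunE; apply: eq_bigr => k _; rewrite [RHS]ffunE.
apply: has_integral_eq (has_integral_sum _ (fun k : 'I__ => h k)) => t.
by rewrite /psum sum_ffunE; apply: eq_bigr => k _; rewrite [in RHS]ffunE.
Qed.

End Path.
End SupertracePolynomials.

Local Close Scope classical_set_scope.

Theorem corollary1p7 (R : realType) (n : nat) (M : manifold R n)
    (w : dform false M) (hw : symplectic w) (c : bool) (E : superbundle c M)
    (f : {poly R[i]}) (A0 A1 : psuperconn E) :
  pair_sub (Str_poly f id (psc_op w A1)) (Str_poly f id (psc_op w A0)) =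
    bdry w (pair_integral (fun t : R =>
      Str_poly f^`() (pop_sub (psc_op w A1) (psc_op w A0))
        (pop_path (psc_op w A1) (psc_op w A0) t))) /\
  same_class w (Str_poly f id (psc_op w A1)) (Str_poly f id (psc_op w A0)).
Proof.
set At := path_psc A0 A1.
have [I hI] := choice (@transgressor1_integral _ _ _ _ _ hw _ A0 A1).
have [J hJ] := choice (@transgressor2_integral _ _ _ _ _ hw _ A0 A1).
pose Z : dform true M * dform true M :=
  (psum (deriv f) (fun k => ctau (I k)), psum (deriv f) (fun k => ctau (J k))).
have ZE : pair_integral (fun t : R =>
      Str_poly (deriv f) (pop_sub (psc_op w A1) (psc_op w A0))
        (pop_path (psc_op w A1) (psc_op w A0) t)) = Z.
  have -> : (fun t : R => Str_poly (deriv f) (pop_sub (psc_op w A1) (psc_op w A0))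
        (pop_path (psc_op w A1) (psc_op w A0) t)) =
      fun t => (psum (deriv f) (fun k => ctau (transgressor1 hw A0 A1 t k)),
                psum (deriv f) (fun k => ctau (transgressor2 hw A0 A1 t k))).
    apply/funext => t; rewrite pop_path_psc; apply: Str_polyE => k.
    exact: (ident_diff hw A0 A1 t k).
  rewrite /pair_integral /Z; congr pair.
    exact: (form_integral_psum (deriv f) hI).
  exact: (form_integral_psum (deriv f) hJ).
have sI k := smooth_ctau (I k).
have sJ k := smooth_ctau (J k).
have dE : pair_sub (Str_poly f id (psc_op w A1)) (Str_poly f id (psc_op w A0)) = bdry w Z.
  rewrite -(path1 w A0 A1) -(path0 w A0 A1) (Str_poly_psc hw (At 1)) (Str_poly_psc hw (At 0))
    /pair_sub /bdry /=.
  congr pair; apply/funext => x; rewrite psumB.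
    rewrite (@psum_deriv _ _ _ f _ (fun k y => extd (ctau (I k)) y +
      fwedge (real_form true w) (ctau (J k)) y)).
    - rewrite extd_psum// wedge_psum /psum -big_split/=.
      by apply: eq_bigr => k _; rewrite scalerDr.
    - by move=> y; rewrite !expr0 subrr.
    - by move=> m y; exact: ctau_curv_difference.
  rewrite (@psum_deriv _ _ _ f _ (fun k y => - extd (ctau (J k)) y)).
  - rewrite extd_psum// /psum -sumrN.
    by apply: eq_bigr => k _; rewrite scalerN.
  - by move=> y; rewrite subrr.
  - by move=> m y; exact: ctau_dpot_difference.
split; first by rewrite ZE.
split; try exact: Str_poly_cocycle.
by exists Z => //; split; exact: smooth_psum.
Qed.
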